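(* Let $n\ge 2$, $R>1$, $\sigma>0$, and let $\omega=(1,\alpha_1,\dots,\alpha_{n-1})=(1,\alpha)\in\mathbb{R}^n$ with $|\alpha_i|<1$ for $1\le i\le n-1$ be non-resonant, i.e. $k\cdot\omega\neq 0$ for all $k\in\mathbb{Z}^n\setminus\{0\}$. Let $l(I)=\omega\cdot I$, and let $\Delta=\Delta_\omega$ be the function associated with $\omega$ defined in the context. Then there exist positive constants $\varepsilon_0,c,c_1,c_2$ depending only on $n,R,\sigma$ and $\omega$ such that the following holds. Let $0<\varepsilon\le\varepsilon_0$ and let $f$ be a bounded real-analytic function on $D=\mathbb{T}^n\times B$ having a holomorphic extension to $V_\sigma(D)$ with $|f|_\sigma\le\varepsilon$. Then for any $\delta$ with $$\left(\Delta(c\varepsilon^{-1})\right)^{-1}\le c_1\delta<R/2,$$ every solution $(\theta(t),I(t))$ of the Hamiltonian system with Hamiltonian $H(\theta,I)=l(I)+f(\theta,I)$ and initial condition $(\theta_0,I_0)$, $I_0\in B_{R/2}$, satisfies $$|I(t)-I_0|\le c_1\delta\quad\text{for all } |t|\le \delta\,\varepsilon^{-1}\exp\left(c_2\,\Delta(c\varepsilon^{-1})\right).$$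
   Context: $\mathbb{T}^n=\mathbb{R}^n/\mathbb{Z}^n$; $|\cdot|$ on vectors (real, complex or integer) is the supremum norm. $B=B_R\subset\mathbb{R}^n$ is an open ball of radius $R$ for the supremum norm, $B_{R/2}$ is the concentric ball of radius $R/2$, and $D=\mathbb{T}^n\times B$. The complex neighbourhood is $V_\sigma(D)=\{(\theta,I)\in(\mathbb{C}^n/\mathbb{Z}^n)\times\mathbb{C}^n : |\mathrm{Im}\,\theta|<\sigma,\ d(I,B)<\sigma\}$, where $d$ is the distance associated with the supremum norm, and $|f|_\sigma=\sup_{z\in V_\sigma(D)}|f(z)|$. The Hamiltonian system of $H$ is $\dot\theta=\partial_I H$, $\dot I=-\partial_\theta H$. For $x\in\mathbb{R}$, $|x|_{\mathbb{Z}}=\min_{p\in\mathbb{Z}}|x-p|$. For $\omega=(1,\alpha)$ non-resonant, define for integers $K\ge 1$ $$\Psi(K)=\Psi_\omega(K)=\max\{|k\cdot\alpha|_{\mathbb{Z}}^{-1} : k\in\mathbb{Z}^{n-1},\ 0<|k|\le K\}.$$ Extend $\Psi$ to a continuous non-decreasing function on $[1,+\infty)$ (fixed once and for all, e.g. by linear interpolation between consecutive integers), still denoted $\Psi$. Set $\Lambda(x)=x\Psi(x)$ for $x\ge1$; it is continuous and strictly increasing, and $\Delta=\Lambda^{-1}$ denotes its inverse function, defined on $[\Lambda(1),+\infty)$. *)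

(* Defs.v *)
From HB Require Import structures.
From mathcomp Require Import all_boot all_order all_algebra.
From mathcomp Require Import complex.
From mathcomp Require Import all_classical all_reals all_analysis.

Set Implicit Arguments.
Unset Strict Implicit.
Unset Printing Implicit Defensive.

Import Order.TTheory GRing.Theory Num.Theory.
Import numFieldNormedType.Exports.

Local Open Scope classical_set_scope.
Local Open Scope ring_scope.
Local Open Scope complex_scope.

(* Norms and balls on row vectors are those of the library, i.e. those of the
   supremum norm.  The dimension n of the text is m.+1 in [freq], [Psi_set],
   [extends_Psi] and [Delta], where alpha lives in R^m. *)

Section Frequency.
Variables (R : realType) (m : nat).
Implicit Types (alpha : 'rV[R]_m) (Psi : R -> R).

Definition idot (n : nat) (k : 'rV[int]_n) (x : 'rV[R]_n) : R :=
  \sum_(i < n) (k 0 i)%:~R * x 0 i.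

Definition rdot (n : nat) (x y : 'rV[R]_n) : R := \sum_(i < n) x 0 i * y 0 i.

Definition inorm (n : nat) (k : 'rV[int]_n) : nat := \max_(i < n) absz (k ord0 i).

Definition nonresonant (n : nat) (omega : 'rV[R]_n) : Prop :=
  forall k : 'rV[int]_n, k != 0 -> idot k omega != 0.

Definition freq alpha : 'rV[R]_m.+1 := row_mx (1%:M : 'rV[R]_1) alpha.

Definition distZ (x : R) : R := inf [set `|x - p%:~R| | p in [set: int]].

Definition Psi_set alpha (K : nat) : set R :=
  [set (distZ (idot k alpha))^-1 | k in [set k | (0 < inorm k <= K)%N]].

(* Psi K is the greatest element of [Psi_set alpha K] at every integer K >= 1,
   and Psi is continuous and non-decreasing on [1, +oo[; its values below 1
   are irrelevant. *)
Definition extends_Psi alpha Psi : Prop :=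
  [/\ forall K : nat, (1 <= K)%N ->
        Psi_set alpha K (Psi K%:R) /\ ubound (Psi_set alpha K) (Psi K%:R),
      {within `[1, +oo[, continuous Psi} &
      {in `[1, +oo[ &, {homo Psi : x y / x <= y}}].

Definition Lambda Psi (x : R) : R := x * Psi x.

(* On [Lambda Psi 1, +oo[ this is the inverse of [Lambda Psi]; elsewhere it has
   the irrelevant value 1. *)
Definition Delta Psi : R -> R := 'pinv_(fun=> 1) `[1, +oo[ (Lambda Psi).

End Frequency.

(* Functions on T^n x A are functions on the cover that are Z^n-periodic in the
   first variable. *)
Section ComplexDomain.
Variables (R : realType) (n : nat).
Implicit Types (B : set 'rV[R]_n.+1).

Definition cvec (x : 'rV[R]_n.+1) : 'rV[R[i]^o]_n.+1 :=
  map_mx (fun y : R => y%:C) x.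

Definition shift_int (K : pzRingType) (k : 'rV[int]_n.+1) (x : 'rV[K]_n.+1) :
  'rV[K]_n.+1 := x + map_mx intr k.

(* The norm of a complex vector is a non-negative real element of R[i]. *)
Definition cdist (x : 'rV[R[i]^o]_n.+1) B : R :=
  inf [set complex.Re `|x - cvec J| | J in B].

Definition cnbhd (sigma : R) B : set ('rV[R[i]^o]_n.+1 * 'rV[R[i]^o]_n.+1) :=
  [set z | `|map_mx (@complex.Im R) z.1| < sigma /\ cdist z.2 B < sigma].

Definition cfun_norm (sigma : R) B
    (F : 'rV[R[i]^o]_n.+1 * 'rV[R[i]^o]_n.+1 -> R[i]^o) : \bar R :=
  ereal_sup [set (complex.Re `|F z|)%:E | z in cnbhd sigma B].

Definition periodic_on B (f : 'rV[R]_n.+1 * 'rV[R]_n.+1 -> R) : Prop :=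
  forall k theta I, B I -> f (shift_int k theta, I) = f (theta, I).

(* [differentiable] over the scalars R[i] is complex Frechet differentiability.
   A function f with such an extension F is automatically real-analytic on
   T^n x B, and bounded there as soon as F is bounded. *)
Definition holomorphic_extension (sigma : R) B
    (f : 'rV[R]_n.+1 * 'rV[R]_n.+1 -> R)
    (F : 'rV[R[i]^o]_n.+1 * 'rV[R[i]^o]_n.+1 -> R[i]^o) : Prop :=
  [/\ forall z, cnbhd sigma B z ->
        differentiable (F : 'rV[R[i]^o]_n.+1 * 'rV[R[i]^o]_n.+1 -> R[i]^o) z,
      forall k z, cnbhd sigma B z -> F (shift_int k z.1, z.2) = F z &
      forall theta I, B I -> F (cvec theta, cvec I) = (f (theta, I))%:C].

End ComplexDomain.

Section Hamiltonian.
Variables (R : realType) (n : nat).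
Local Notation phase := ('rV[R]_n.+1 * 'rV[R]_n.+1)%type.
Implicit Types (H : phase -> R) (B : set 'rV[R]_n.+1) (J : set R)
  (z : R -> phase).

(* Right-hand side of theta' = d_I H, I' = - d_theta H. *)
Definition ham_field H (z : phase) : phase :=
  (\row_i 'D_(0, 'e_i) H z, - \row_i 'D_('e_i, 0) H z).

(* Solutions with values in T^n x B, defined on an open time interval
   containing 0; the angle is lifted from T^n to R^n. *)
Definition ham_solution H B J z : Prop :=
  [/\ open J, is_interval J, J 0 &
      forall t, J t -> B (z t).2 /\ is_derive t 1 z (ham_field H (z t))].

Definition maximal_ham_solution H B J z : Prop :=
  ham_solution H B J z /\
  forall J' z', ham_solution H B J' z' -> J `<=` J' ->
    (forall t, J t -> z' t = z t) -> J' = J.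

End Hamiltonian.

(* Main.v *)
Require Import Defs.
From HB Require Import structures.
From mathcomp Require Import all_boot all_order all_algebra.
From mathcomp Require Import complex.
From mathcomp Require Import all_classical all_reals all_analysis.
From mathcomp Require Import ring lra zify.
From mathcomp Require finmap monalg.
Import -(notations) finmap.
Import -(notations) monalg.
Set Implicit Arguments.
Unset Strict Implicit.
Unset Printing Implicit Defensive.

Import Order.TTheory GRing.Theory Num.Theory.
Import numFieldNormedType.Exports.

Local Open Scope classical_set_scope.
Local Open Scope ring_scope.
Local Open Scope complex_scope.

(** Around an initial action [c], put I_i = c_i - rho + rho e(w_i) with
    e(w) = exp(2 i pi w).  The perturbation becomes holomorphic and 1-periodic
    in 2n variables, hence, up to an error O(eps exp(- b N)), it is a Laurent
    polynomial p of degree N whose coefficients are O(eps) for an exponentially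
    weighted l^1 norm.  In the Poisson algebra of Laurent polynomials, l + p has
    a formal first integral P_j = e(w_j) + P_1 + P_2 + ...: the homological
    equation is solvable at each order, and up to order N it only involves the
    divisors k . omega with |k| <= N, which are at least 1 / Psi(N).  When
    N Psi(N) eps is small, the truncation at order N is O(Psi(N) eps)-close to
    e(w_j) and its bracket with l + p is O(eps exp(- b N)).  Along a solution
    I_j - c_j is therefore O(Psi(N) eps) + O(eps exp(- b N)) |t|; one takes N to
    be the integer part of Delta(c / eps).  No averaging is performed: the
    normal form of the linear flow is used only to see that the obstructions to
    the existence of P_j vanish. *)

(** The obstacle is that a bracket costs one derivative. Measured on shrinking strips, N successive
    homological equations would use up the width of analyticity. Here a derivative is paid for by
    the degree, which is O(N), on one fixed width: a step costs N Psi(N) eps, and this is what Delta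
    controls, since K = Delta(c / eps) means K Psi(K) eps = c; the resulting displacement Psi(N) eps
    is then of order 1 / K. For this the formal order is the degree of a monomial and not a power of
    eps: the part of order j of the perturbation is its homogeneous component of degree j, which the
    weight makes geometrically small, so that order s meets angular exponents at most s.
    Exponentiating the actions turns analyticity in them into decay of coefficients as well. The
    chart is centred at the initial action, but no constant depends on the centre. A maximal
    solution must also be shown to exist for the whole time; this needs global existence and
    uniqueness for a modified field that coincides with the Hamiltonian one near the initial
    action. *)

Lemma le0_eps (R : realType) (x : R) :
  (forall e : R, 0 < e -> x <= e) -> x <= 0.
Proof. by move=> H; apply/ler_addgt0Pl => e e0; rewrite addr0 H. Qed.

(** * Complex integrals and derivatives *)

(** The library norm of R[i] takes values in R[i]; this is the same modulus with values in R,
    directly comparable with real bounds. *)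
HB.lock Definition nm (R : realType) (z : R[i]) : R := Normc.normc z.
Arguments nm {R} z.

Section ComplexModulus.
Variable R : realType.
Implicit Types (z w : R[i]) (x : R).

Lemma nm0 : nm 0 = 0 :> R. Proof. rewrite nm.unlock; exact: Normc.normc0. Qed.
Lemma nm1 : nm 1 = 1 :> R. Proof. rewrite nm.unlock; exact: Normc.normc1. Qed.
Lemma nmM z w : nm (z * w) = nm z * nm w. Proof. rewrite nm.unlock; exact: Normc.normcM. Qed.
Lemma nmV z : nm z^-1 = (nm z)^-1. Proof. rewrite nm.unlock; exact: Normc.normcV. Qed.
Lemma nmN z : nm (- z) = nm z. Proof. rewrite nm.unlock; exact: normcN. Qed.
Lemma nmD z w : nm (z + w) <= nm z + nm w. Proof. rewrite nm.unlock; exact: le_normcD. Qed.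
Lemma nmB z w : nm (z - w) <= nm z + nm w. Proof. by rewrite -(nmN w) nmD. Qed.
Lemma nm_ge0 z : 0 <= nm z. Proof. by rewrite nm.unlock; case: z => a b; exact: sqrtr_ge0. Qed.
Lemma nm_distC z w : nm (z - w) = nm (w - z). Proof. by rewrite -nmN opprB. Qed.

Lemma nmX z n : nm (z ^+ n) = nm z ^+ n.
Proof. by elim: n => [|n IH]; rewrite ?expr0 ?nm1// !exprS nmM IH. Qed.

Lemma nm_eq0 z : (nm z == 0) = (z == 0).
Proof.
by apply/eqP/eqP => [|->]; [rewrite nm.unlock; exact: Normc.eq0_normc|exact: nm0].
Qed.

Lemma nm_gt0 z : (0 < nm z) = (z != 0).
Proof. by rewrite lt_def nm_ge0 andbT nm_eq0. Qed.

Lemma nm_Re z : `|complex.Re z| <= nm z.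
Proof.
by rewrite nm.unlock; case: z => a b /=; rewrite -(sqrtr_sqr a) ler_wsqrtr// lerDl sqr_ge0.
Qed.

Lemma nm_Im z : `|complex.Im z| <= nm z.
Proof.
by rewrite nm.unlock; case: z => a b /=; rewrite -(sqrtr_sqr b) ler_wsqrtr// lerDr sqr_ge0.
Qed.

Lemma nmC x : nm x%:C = `|x|.
Proof. by rewrite nm.unlock /= expr0n /= addr0 sqrtr_sqr. Qed.

Lemma nm_i : nm 'i = 1 :> R.
Proof. by rewrite nm.unlock /= expr0n /= add0r expr1n sqrtr1. Qed.

Lemma complex_split z : z = (complex.Re z)%:C + 'i * (complex.Im z)%:C.
Proof. exact: complexE. Qed.

Lemma nm_le_ReIm z : nm z <= `|complex.Re z| + `|complex.Im z|.
Proof.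
by rewrite {1}[z]complex_split (le_trans (nmD _ _))// nmM nm_i mul1r !nmC.
Qed.

Lemma nm_sum (I : Type) (s : seq I) (P : pred I) (F : I -> R[i]) :
  nm (\sum_(i <- s | P i) F i) <= \sum_(i <- s | P i) nm (F i).
Proof.
elim/big_rec2: _ => [|i y x _ le_xy]; first by rewrite nm0.
by rewrite (le_trans (nmD _ _))// lerD2l.
Qed.

Lemma nm_triB z w t : nm (z - w) <= nm (z - t) + nm (t - w).
Proof. by rewrite -[z - w](subrKA t) nmD. Qed.

Lemma cReD z w : complex.Re (z + w) = complex.Re z + complex.Re w.
Proof. by case: z; case: w. Qed.
Lemma cImD z w : complex.Im (z + w) = complex.Im z + complex.Im w.
Proof. by case: z; case: w. Qed.
Lemma cReN z : complex.Re (- z) = - complex.Re z. Proof. by case: z. Qed.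
Lemma cImN z : complex.Im (- z) = - complex.Im z. Proof. by case: z. Qed.
Lemma cReB z w : complex.Re (z - w) = complex.Re z - complex.Re w.
Proof. by rewrite cReD cReN. Qed.
Lemma cImB z w : complex.Im (z - w) = complex.Im z - complex.Im w.
Proof. by rewrite cImD cImN. Qed.
Lemma cReM z w : complex.Re (z * w) =
  complex.Re z * complex.Re w - complex.Im z * complex.Im w.
Proof. by case: z; case: w. Qed.
Lemma cImM z w : complex.Im (z * w) =
  complex.Re z * complex.Im w + complex.Im z * complex.Re w.
Proof. by case: z; case: w. Qed.
Lemma complex_eq z w :
  complex.Re z = complex.Re w -> complex.Im z = complex.Im w -> z = w.
Proof. by case: z => a b; case: w => c d /= -> ->. Qed.

End ComplexModulus.

HB.lock Definition rint (R : realType) (f : R -> R) (a b : R) : R :=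
  \int[@lebesgue_measure R]_(x in `[a, b]) f x.
Arguments rint {R} f a b.

HB.lock Definition cint (R : realType) (g : R -> R[i]) (a b : R) : R[i] :=
  rint (fun x => complex.Re (g x)) a b +i* rint (fun x => complex.Im (g x)) a b.
Arguments cint {R} g a b.

Section Integral.
Variable R : realType.
Implicit Types (a b c e x : R).
Local Notation mu := (@lebesgue_measure R).

Definition rcont (f : R -> R) (a b : R) := forall x : R, a <= x <= b ->
  forall e : R, 0 < e -> exists2 d : R, 0 < d &
    forall y : R, a <= y <= b -> `|y - x| < d -> `|f y - f x| < e.

Lemma rcont_within f a b : rcont f a b -> {within `[a, b], continuous f}.
Proof.
move=> fc; apply/subspace_continuousP => x /=; rewrite in_itv/= => xab.
apply/cvgrPdist_lt => e e0; have [d d0 H] := fc _ xab _ e0.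
apply/nbhs_ballP; exists d => //= y xy yab.
rewrite distrC; apply: H; first by move: yab; rewrite /= in_itv.
by rewrite distrC.
Qed.

Lemma rcont_integrable f a b :
  rcont f a b -> mu.-integrable `[a, b] (EFin \o f).
Proof.
move=> fc; apply: continuous_compact_integrable; first exact: segment_compact.
exact: rcont_within.
Qed.

Lemma rint_cst c a b : a <= b -> rint (fun=> c) a b = c * (b - a).
Proof.
move=> ab; rewrite rint.unlock Rintegral_cst//= lebesgue_measure_itv/= lte_fin.
move: ab; rewrite le_eqVlt => /predU1P[->|ab]; first by rewrite ltxx subrr.
by rewrite ab -EFinB.
Qed.

Lemma rint_split f a b c : a <= b -> b <= c -> rcont f a c ->
  rint f a c = rint f a b + rint f b c.
Proof.
move=> ab bc /rcont_integrable fi; rewrite rint.unlock.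
have := @Rintegral_itvB R f (BLeft a) (BRight c) b fi.
rewrite !bnd_simp => /(_ ab bc); rewrite Rintegral_itv_obnd_cbnd.
  by move=> <-; rewrite addrC subrK.
by apply: integrableS fi => //; apply: subset_itv; rewrite bnd_simp.
Qed.

Lemma rint_add f g a b : rcont f a b -> rcont g a b ->
  rint (fun x => f x + g x) a b = rint f a b + rint g a b.
Proof. by move=> fc gc; rewrite rint.unlock RintegralD//; exact: rcont_integrable. Qed.

Lemma rint_scale c f a b : rcont f a b ->
  rint (fun x => c * f x) a b = c * rint f a b.
Proof. by move=> fc; rewrite rint.unlock RintegralZl//; exact: rcont_integrable. Qed.

Lemma rcont_cst c a b : rcont (fun=> c) a b.
Proof. by move=> x _ e e0; exists 1 => // y _ _; rewrite subrr normr0. Qed.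

Lemma rint_bound f c e a b : a <= b -> rcont f a b ->
  (forall x : R, a <= x <= b -> `|f x - c| <= e) ->
  `|rint f a b - c * (b - a)| <= e * (b - a).
Proof.
move=> ab fc fe.
have fi := rcont_integrable fc.
have ci k : mu.-integrable `[a, b] (EFin \o fun=> k).
  exact: rcont_integrable (@rcont_cst k a b).
have le1 : rint f a b <= (c + e) * (b - a).
  rewrite -rint_cst// rint.unlock; apply: le_Rintegral => //= x; rewrite in_itv/= => xab.
  by have := fe _ xab; rewrite ler_norml => /andP[_]; rewrite lerBlDl.
have le2 : (c - e) * (b - a) <= rint f a b.
  rewrite -rint_cst// rint.unlock; apply: le_Rintegral => //= x; rewrite in_itv/= => xab.
  by have := fe _ xab; rewrite ler_norml => /andP[]; rewrite lerBrDl.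
by rewrite ler_norml; apply/andP; split; lra.
Qed.

Definition ccont (g : R -> R[i]) (a b : R) := forall x : R, a <= x <= b ->
  forall e : R, 0 < e -> exists2 d : R, 0 < d &
    forall y : R, a <= y <= b -> `|y - x| < d -> nm (g y - g x) < e.

Lemma ccont_Re g a b : ccont g a b -> rcont (fun x => complex.Re (g x)) a b.
Proof.
move=> gc x xab e e0; have [d d0 H] := gc x xab e e0; exists d => // y yab yx.
by rewrite -cReB; exact: le_lt_trans (nm_Re _) (H _ yab yx).
Qed.

Lemma ccont_Im g a b : ccont g a b -> rcont (fun x => complex.Im (g x)) a b.
Proof.
move=> gc x xab e e0; have [d d0 H] := gc x xab e e0; exists d => // y yab yx.
by rewrite -cImB; exact: le_lt_trans (nm_Im _) (H _ yab yx).
Qed.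

Lemma ccontD f g a b : ccont f a b -> ccont g a b ->
  ccont (fun x => f x + g x) a b.
Proof.
move=> fc gc x xab e e0; have e2 : 0 < e / 2 by lra.
have [d d0 H] := fc x xab _ e2; have [d' d'0 H'] := gc x xab _ e2.
exists (Num.min d d'); first by rewrite lt_min d0.
move=> y yab; rewrite lt_min => /andP[yd yd'].
have -> : f y + g y - (f x + g x) = (f y - f x) + (g y - g x) by ring.
rewrite (le_lt_trans (nmD _ _))//.
by have := H _ yab yd; have := H' _ yab yd'; lra.
Qed.

Lemma ccontZ (c : R[i]) g a b : ccont g a b -> ccont (fun x => c * g x) a b.
Proof.
move=> gc x xab e e0; have c0 : 0 < nm c + 1 by have := nm_ge0 c; lra.
have [d d0 H] := gc x xab _ (divr_gt0 e0 c0); exists d => // y yab yd.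
rewrite -mulrBr nmM.
have := H _ yab yd; rewrite ltr_pdivlMr// => h; apply: le_lt_trans h.
by rewrite mulrC ler_wpM2l ?nm_ge0//; lra.
Qed.

Lemma ccontB f g a b : ccont f a b -> ccont g a b ->
  ccont (fun x => f x - g x) a b.
Proof.
move=> fc gc; have := ccontD fc (ccontZ (-1) gc).
by under [X in ccont X]eq_fun do rewrite mulN1r.
Qed.

Lemma cint_cst (c : R[i]) a b : a <= b -> cint (fun=> c) a b = c * (b - a)%:C.
Proof.
move=> ab; rewrite cint.unlock !rint_cst//; apply: complex_eq => /=.
  by rewrite cReM /= mulr0 subr0.
by rewrite cImM /= mulr0 add0r.
Qed.

Lemma cint_add f g a b : ccont f a b -> ccont g a b ->
  cint (fun x => f x + g x) a b = cint f a b + cint g a b.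
Proof.
move=> fc gc; rewrite cint.unlock; apply: complex_eq; rewrite ?cReD ?cImD /=.
  by rewrite -rint_add; [|exact: ccont_Re..]; congr rint; apply/funext => x;
     rewrite cReD.
by rewrite -rint_add; [|exact: ccont_Im..]; congr rint; apply/funext => x;
   rewrite cImD.
Qed.

Lemma rcontZ c f a b : rcont f a b -> rcont (fun x => c * f x) a b.
Proof.
move=> fc x xab e e0; have c0 : 0 < `|c| + 1 by rewrite ltr_wpDl.
have [d d0 H] := fc x xab _ (divr_gt0 e0 c0); exists d => // y yab yd.
rewrite -mulrBr normrM.
have := H _ yab yd; rewrite ltr_pdivlMr// => h; apply: le_lt_trans h.
by rewrite mulrC ler_wpM2l//; lra.
Qed.

Lemma cint_scale (c : R[i]) g a b : ccont g a b ->
  cint (fun x => c * g x) a b = c * cint g a b.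
Proof.
move=> gc; have gR := ccont_Re gc; have gI := ccont_Im gc.
rewrite cint.unlock; apply: complex_eq; rewrite ?cReM ?cImM /=.
  rewrite -mulNr -!rint_scale// -rint_add; [|exact: rcontZ..].
  by congr rint; apply/funext => x; rewrite cReM mulNr.
rewrite -!rint_scale// -rint_add; [|exact: rcontZ..].
by congr rint; apply/funext => x; rewrite cImM.
Qed.

Lemma cint_sub f g a b : ccont f a b -> ccont g a b ->
  cint (fun x => f x - g x) a b = cint f a b - cint g a b.
Proof.
move=> fc gc; rewrite -mulN1r -cint_scale// -cint_add//; last exact: ccontZ.
by congr cint; apply/funext => x; rewrite mulN1r.
Qed.

Lemma cint_split g a b c : a <= b -> b <= c -> ccont g a c ->
  cint g a c = cint g a b + cint g b c.
Proof.
move=> ab bc gc; rewrite cint.unlock; apply: complex_eq; rewrite ?cReD ?cImD /= -rint_split//.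
  exact: ccont_Re.
exact: ccont_Im.
Qed.

(** Real and imaginary parts are bounded separately, hence the factor 2, which reappears in the
    constants of the Fourier estimates. *)
Lemma cint_bound g (c : R[i]) e a b : a <= b -> ccont g a b ->
  (forall x : R, a <= x <= b -> nm (g x - c) <= e) ->
  nm (cint g a b - c * (b - a)%:C) <= 2 * e * (b - a).
Proof.
move=> ab gc ge; rewrite (le_trans (nm_le_ReIm _))//.
rewrite cint.unlock cReB cImB cReM cImM /= !mulr0 subr0 add0r.
have h1 : `|rint (fun x => complex.Re (g x)) a b - complex.Re c * (b - a)|
    <= e * (b - a).
  apply: rint_bound => //; first exact: ccont_Re.
  by move=> x xab; rewrite -cReB (le_trans (nm_Re _))// ge.
have h2 : `|rint (fun x => complex.Im (g x)) a b - complex.Im c * (b - a)|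
    <= e * (b - a).
  apply: rint_bound => //; first exact: ccont_Im.
  by move=> x xab; rewrite -cImB (le_trans (nm_Im _))// ge.
lra.
Qed.

End Integral.

Section ComplexDerivative.
Variable R : realType.
Local Notation C := R[i].
Implicit Types (f g : C -> C) (z d : C).

(** Little-o form of the complex derivative: without a quotient, h = 0 needs no separate treatment
    and the rules of calculus become real inequalities. *)
Definition cderiv g z d := forall e : R, 0 < e ->
  exists2 r : R, 0 < r &
    forall h, nm h < r -> nm (g (z + h) - g z - d * h) <= e * nm h.

Definition cderivable g z := exists d, cderiv g z d.

Lemma cderiv_ext f g z d : f =1 g -> cderiv f z d -> cderiv g z d.
Proof. by move=> /funext ->. Qed.

Lemma cderiv_lip g z d : cderiv g z d -> exists2 r : R, 0 < r &
  forall h, nm h < r -> nm (g (z + h) - g z) <= (nm d + 1) * nm h.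
Proof.
move=> /(_ 1 ltr01)[r r0 H]; exists r => // h hr.
have -> : g (z + h) - g z = (g (z + h) - g z - d * h) + d * h by ring.
rewrite (le_trans (nmD _ _))// nmM mulrDl mul1r addrC lerD2l.
by have := H _ hr; rewrite mul1r.
Qed.

Lemma cderiv_cont g z d : cderiv g z d -> forall e : R, 0 < e ->
  exists2 r : R, 0 < r & forall h, nm h < r -> nm (g (z + h) - g z) < e.
Proof.
move=> /cderiv_lip[r r0 H] e e0; have d0 : 0 < nm d + 1.
  by have := nm_ge0 d; lra.
exists (Num.min r (e / (nm d + 1))); first by rewrite lt_min r0 divr_gt0.
move=> h; rewrite lt_min => /andP[hr he].
by rewrite (le_lt_trans (H _ hr))// mulrC -ltr_pdivlMr.
Qed.

Lemma cderiv_cst c z : cderiv (fun=> c) z 0.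
Proof.
move=> e e0; exists 1 => // h _.
by rewrite subrr mul0r subrr nm0 mulr_ge0 ?nm_ge0// ltW.
Qed.

Lemma cderiv_id z : cderiv (fun w => w) z 1.
Proof.
move=> e e0; exists 1 => // h _.
have -> : z + h - z - 1 * h = 0 by ring.
by rewrite nm0 mulr_ge0 ?nm_ge0// ltW.
Qed.

Lemma cderivD f g z d d' : cderiv f z d -> cderiv g z d' ->
  cderiv (fun w => f w + g w) z (d + d').
Proof.
move=> fz gz e e0; have e2 : 0 < e / 2 by lra.
have [r r0 H] := fz _ e2; have [s s0 H'] := gz _ e2.
exists (Num.min r s); first by rewrite lt_min r0.
move=> h; rewrite lt_min => /andP[hr hs].
have -> : f (z + h) + g (z + h) - (f z + g z) - (d + d') * h =
  (f (z + h) - f z - d * h) + (g (z + h) - g z - d' * h) by ring.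
rewrite (le_trans (nmD _ _))//.
by have := H _ hr; have := H' _ hs; lra.
Qed.

Lemma cderivZ c f z d : cderiv f z d -> cderiv (fun w => c * f w) z (c * d).
Proof.
move=> fz e e0; have c0 : 0 < nm c + 1 by have := nm_ge0 c; lra.
have [r r0 H] := fz _ (divr_gt0 e0 c0); exists r => // h hr.
have -> : c * f (z + h) - c * f z - c * d * h = c * (f (z + h) - f z - d * h).
  by ring.
rewrite nmM (le_trans (ler_wpM2l (nm_ge0 _) (H _ hr)))//.
rewrite mulrA ler_wpM2r ?nm_ge0// mulrA ler_pdivrMr// mulrC ler_wpM2l ?ltW//.
by lra.
Qed.

Lemma cderivN f z d : cderiv f z d -> cderiv (fun w => - f w) z (- d).
Proof.
move=> /(cderivZ (-1)); rewrite mulN1r; apply: cderiv_ext => w.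
by rewrite mulN1r.
Qed.

Lemma cderivB f g z d d' : cderiv f z d -> cderiv g z d' ->
  cderiv (fun w => f w - g w) z (d - d').
Proof. by move=> fz gz; apply: cderivD => //; exact: cderivN. Qed.

Lemma cderivM f g z d d' : cderiv f z d -> cderiv g z d' ->
  cderiv (fun w => f w * g w) z (d * g z + f z * d').
Proof.
move=> fz gz e e0.
set A := nm (f z) + nm (g z) + nm d + 2.
have A0 : 0 < A.
  by rewrite /A; have := nm_ge0 (f z); have := nm_ge0 (g z); have := nm_ge0 d; lra.
set e1 := Num.min 1 (e / A).
have e10 : 0 < e1 by rewrite lt_min ltr01 divr_gt0.
have e11 : e1 <= 1 by rewrite ge_min lexx.
have e1A : e1 * A <= e by rewrite -ler_pdivlMr// ge_min lexx orbT.
have [r r0 H] := fz _ e10; have [s s0 H'] := gz _ e10.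
have [t t0 H''] := cderiv_cont gz e10.
exists (Num.min r (Num.min s t)); first by rewrite !lt_min r0 s0.
move=> h; rewrite !lt_min => /and3P[hr hs ht].
have -> : f (z + h) * g (z + h) - f z * g z - (d * g z + f z * d') * h =
  (f (z + h) - f z - d * h) * (g z + (g (z + h) - g z)) +
  f z * (g (z + h) - g z - d' * h) + d * h * (g (z + h) - g z) by ring.
have h0 := nm_ge0 h.
have := H'' _ ht; have := H _ hr; have := H' _ hs.
set u := g (z + h) - g z; set v := _ - d * h; set w := u - _.
move=> wh vh ue.
apply: (le_trans (nmD _ _)); apply: (le_trans (lerD (nmD _ _) (lexx _))).
rewrite !nmM.
have b1 : nm v * nm (g z + u) <= e1 * nm h * (nm (g z) + 1).
  apply: ler_pM; rewrite ?nm_ge0//.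
  by rewrite (le_trans (nmD _ _))// lerD2l; lra.
have b2 : nm (f z) * nm w <= nm (f z) * (e1 * nm h).
  by rewrite ler_wpM2l ?nm_ge0.
have b3 : nm d * nm h * nm u <= nm d * nm h * e1.
  by rewrite ler_wpM2l ?mulr_ge0 ?nm_ge0// ltW.
apply: (le_trans (lerD (lerD b1 b2) b3)).
have -> : e1 * nm h * (nm (g z) + 1) + nm (f z) * (e1 * nm h) + nm d * nm h * e1
  = (e1 * (nm (g z) + 1 + nm (f z) + nm d)) * nm h by ring.
by rewrite ler_wpM2r// (le_trans _ e1A)// ler_pM2l// /A; lra.
Qed.

Lemma cderiv_comp f g z d d' : cderiv g z d -> cderiv f (g z) d' ->
  cderiv (fun w => f (g w)) z (d' * d).
Proof.
move=> gz fz e e0.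
set A := nm d + 1 + nm d'.
have A0 : 0 < A by rewrite /A; have := nm_ge0 d; have := nm_ge0 d'; lra.
have e10 : 0 < e / A by rewrite divr_gt0.
have [r r0 H] := fz _ e10; have [s s0 H'] := gz _ e10.
have [t t0 H1] := cderiv_lip gz; have [u u0 H2] := cderiv_cont gz r0.
exists (Num.min s (Num.min t u)); first by rewrite !lt_min s0 t0.
move=> h; rewrite !lt_min => /and3P[hs ht hu].
have hr := H2 _ hu; have hk := H1 _ ht; have hg := H' _ hs; have := H _ hr.
set k := g (z + h) - g z in hk hr *.
have -> : g z + k = g (z + h) by rewrite /k; ring.
move=> hf.
have -> : f (g (z + h)) - f (g z) - d' * d * h =
  (f (g (z + h)) - f (g z) - d' * k) + d' * (g (z + h) - g z - d * h).
  by rewrite /k; ring.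
rewrite (le_trans (nmD _ _))// nmM.
have b1 : e / A * nm k <= e / A * ((nm d + 1) * nm h) by rewrite ler_pM2l.
have b2 := ler_wpM2l (nm_ge0 d') hg.
apply: (le_trans (lerD (le_trans hf b1) b2)).
have -> : e / A * ((nm d + 1) * nm h) + nm d' * (e / A * nm h) =
  e / A * A * nm h by rewrite /A; ring.
by rewrite divfK// gt_eqF.
Qed.

Lemma cderivV z : z != 0 -> cderiv (fun w => w^-1) z (- z ^- 2).
Proof.
move=> z0 e e0; have nz : 0 < nm z by rewrite nm_gt0.
have n3 : 0 < nm z ^+ 3 by rewrite exprn_gt0.
exists (Num.min (nm z / 2) (e * nm z ^+ 3 / 2)).
  by rewrite lt_min divr_gt0//= divr_gt0// mulr_gt0.
move=> h; rewrite lt_min => /andP[h1 h2].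
have zh : nm z / 2 <= nm (z + h).
  have : nm z <= nm (z + h) + nm h.
    by rewrite -{1}[z](addrK h) -[in X in _ <= _ + X]nmN nmD.
  by lra.
have zh0 : z + h != 0 by rewrite -nm_gt0; lra.
have -> : (z + h)^-1 - z^-1 - - z ^- 2 * h = h * h / (z ^+ 2 * (z + h)).
  by field; rewrite z0 zh0.
rewrite !nmM nmV nmM nmX [e * _]mulrC -mulrA ler_wpM2l ?nm_ge0//.
rewrite ler_pdivrMr ?mulr_gt0 ?exprn_gt0//; last by rewrite nm_gt0.
apply: (le_trans (ltW h2)).
have -> : e * nm z ^+ 3 / 2 = e * (nm z ^+ 2 * (nm z / 2)) by field.
by rewrite ler_pM2l// ler_wpM2l// exprn_ge0// nm_ge0.
Qed.

Lemma cderiv_shift g z c d : cderiv g (z + c) d -> cderiv (fun w => g (w + c)) z d.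
Proof.
move=> gz e e0; have [r r0 H] := gz e e0; exists r => // h hr.
by have := H _ hr; rewrite [z + c + h]addrAC.
Qed.

Lemma ccont_hline g (a b y : R) :
  (forall x, a <= x <= b -> cderivable g (x +i* y)) ->
  ccont (fun x => g (x +i* y)) a b.
Proof.
move=> gd x xab e e0; have [d /cderiv_cont/(_ _ e0)[r r0 H]] := gd _ xab.
exists r => // x' _ xr; have := H ((x' - x)%:C); rewrite nmC => /(_ xr).
congr (nm (g _ - _) < _); apply: complex_eq => /=; ring.
Qed.

Lemma ccont_vline g (a b x : R) :
  (forall y, a <= y <= b -> cderivable g (x +i* y)) ->
  ccont (fun y => g (x +i* y)) a b.
Proof.
move=> gd y yab e e0; have [d /cderiv_cont/(_ _ e0)[r r0 H]] := gd _ yab.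
exists r => // y' _ yr; have := H ('i * (y' - y)%:C).
rewrite nmM nm_i mul1r nmC => /(_ yr).
congr (nm (g _ - _) < _); apply: complex_eq => /=; ring.
Qed.

End ComplexDerivative.

(** * Goursat's lemma *)

Section Bisection.
Variable R : realType.
Variables (P : R -> R -> R -> Prop) (W H : R).
Hypotheses (W0 : 0 <= W) (H0 : 0 <= H).
Hypothesis quad : forall x y t : R, 0 < t ->
  P x y (t / 2) -> P (x + t / 2 * W) y (t / 2) -> P x (y + t / 2 * H) (t / 2) ->
  P (x + t / 2 * W) (y + t / 2 * H) (t / 2) -> P x y t.

(** P x y t speaks of the rectangle of corner (x, y) and sides t W, t H. If P failed on the whole it
    would fail on nested quarters shrinking to a point (X, Y), against the local hypothesis there. W
    or H may vanish, so that intervals are covered too. *)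
Lemma quad_bisection (x0 y0 : R) :
  (forall X Y : R, x0 <= X <= x0 + W -> y0 <= Y <= y0 + H ->
    exists2 r : R, 0 < r & forall x y t : R, 0 < t < r ->
      x <= X <= x + t * W -> y <= Y <= y + t * H ->
      x0 <= x -> x + t * W <= x0 + W -> y0 <= y -> y + t * H <= y0 + H ->
      P x y t) ->
  P x0 y0 1.
Proof.
move=> loc; apply/not_notP => nP.
pose inv (q : R * R * R) := [/\ 0 < q.2, ~ P q.1.1 q.1.2 q.2,
  x0 <= q.1.1 /\ q.1.1 + q.2 * W <= x0 + W &
  y0 <= q.1.2 /\ q.1.2 + q.2 * H <= y0 + H].
have step q : inv q -> exists q', [/\ inv q', q'.2 = q.2 / 2,
   q.1.1 <= q'.1.1 /\ q'.1.1 + q'.2 * W <= q.1.1 + q.2 * W &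
   q.1.2 <= q'.1.2 /\ q'.1.2 + q'.2 * H <= q.1.2 + q.2 * H].
  case: q => [[x y] t] [/= t0 nPq [x1 x2] [y1 y2]].
  have tW : 0 <= t / 2 * W by rewrite mulr_ge0//; lra.
  have tH : 0 <= t / 2 * H by rewrite mulr_ge0//; lra.
  have t2 : 0 < t / 2 by lra.
  apply/not_existsP => nq; apply: nPq; apply: quad => //;
    apply/not_notP => nPc.
  - by apply: (nq (x, y, t / 2)); split=> //; [split=> //|..]; split=> /=; lra.
  - by apply: (nq (x + t / 2 * W, y, t / 2)); split=> //; [split=> //|..];
      split=> /=; lra.
  - by apply: (nq (x, y + t / 2 * H, t / 2)); split=> //; [split=> //|..];
      split=> /=; lra.
  - by apply: (nq (x + t / 2 * W, y + t / 2 * H, t / 2)); split=> //;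
      [split=> //|..]; split=> /=; lra.
have [nx Hnx] : exists nx : R * R * R -> R * R * R, forall q, inv q ->
   [/\ inv (nx q), (nx q).2 = q.2 / 2,
   q.1.1 <= (nx q).1.1 /\ (nx q).1.1 + (nx q).2 * W <= q.1.1 + q.2 * W &
   q.1.2 <= (nx q).1.2 /\ (nx q).1.2 + (nx q).2 * H <= q.1.2 + q.2 * H].
  have /choice[g Hg] : forall q, exists q', inv q -> [/\ inv q', q'.2 = q.2 / 2,
     q.1.1 <= q'.1.1 /\ q'.1.1 + q'.2 * W <= q.1.1 + q.2 * W &
     q.1.2 <= q'.1.2 /\ q'.1.2 + q'.2 * H <= q.1.2 + q.2 * H].
    move=> q; have [iq|niq] := pselect (inv q); last by exists q.
    by have [q' Hq'] := step _ iq; exists q'.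
  by exists g.
pose s n := iter n nx (x0, y0, 1).
have inv0 : inv (x0, y0, 1) by split => //=; split; lra.
have invs n : inv (s n) by elim: n => // n /Hnx[].
have st n : (s n).2 = 2^-1 ^+ n.
  by elim: n => // n IH; have [_ -> _ _] := Hnx _ (invs n); rewrite IH exprSr.
have mono n k : [/\ (s n).1.1 <= (s (n + k)%N).1.1,
     (s (n + k)%N).1.1 + (s (n + k)%N).2 * W <= (s n).1.1 + (s n).2 * W,
     (s n).1.2 <= (s (n + k)%N).1.2 &
     (s (n + k)%N).1.2 + (s (n + k)%N).2 * H <= (s n).1.2 + (s n).2 * H].
  elim: k => [|k [h1 h2 h3 h4]]; first by rewrite addn0; split.
  rewrite addnS; have [_ _ [a1 a2] [a3 a4]] := Hnx _ (invs (n + k)%N).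
  by split; [exact: le_trans a1|exact: le_trans h2|exact: le_trans a3|
             exact: le_trans h4].
have s0 n : 0 < (s n).2 by case: (invs n).
have cross n k : (s n).1.1 <= (s k).1.1 + (s k).2 * W /\
                 (s n).1.2 <= (s k).1.2 + (s k).2 * H.
  have [a1 a2 a3 a4] := mono n k; have [b1 b2 b3 b4] := mono k n.
  rewrite addnC in b1 b2 b3 b4.
  have w0 := mulr_ge0 (ltW (s0 (n + k)%N)) W0.
  have h0 := mulr_ge0 (ltW (s0 (n + k)%N)) H0.
  by split; lra.
(* Lower left corners increase and stay below all upper right corners, so their suprema give a point
   of every rectangle of the sequence. *)
pose X := sup (range (fun n => (s n).1.1)).
pose Y := sup (range (fun n => (s n).1.2)).
have Xub n : (s n).1.1 <= X.
  apply: ub_le_sup; last by exists n.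
  by exists ((s 0%N).1.1 + (s 0%N).2 * W) => _ [k _ <-]; case: (cross k 0%N).
have Yub n : (s n).1.2 <= Y.
  apply: ub_le_sup; last by exists n.
  by exists ((s 0%N).1.2 + (s 0%N).2 * H) => _ [k _ <-]; case: (cross k 0%N).
have Xlub n : X <= (s n).1.1 + (s n).2 * W.
  apply: ge_sup; first by exists (s 0%N).1.1, 0%N.
  by move=> _ [k _ <-]; case: (cross k n).
have Ylub n : Y <= (s n).1.2 + (s n).2 * H.
  apply: ge_sup; first by exists (s 0%N).1.2, 0%N.
  by move=> _ [k _ <-]; case: (cross k n).
have X01 : x0 <= X <= x0 + W.
  by have := Xub 0%N; have := Xlub 0%N; rewrite /s /= mul1r => -> ->.
have Y01 : y0 <= Y <= y0 + H.
  by have := Yub 0%N; have := Ylub 0%N; rewrite /s /= mul1r => -> ->.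
have [r r0 Hr] := loc _ _ X01 Y01.
have [n nr] : exists n, 2^-1 ^+ n < r.
  have : (fun n => 2^-1 ^+ n : R) @ \oo --> (0 : R).
    by apply: cvg_expr; rewrite gtr0_norm; lra.
  move/cvgrPdist_lt => /(_ _ r0)[n _ /(_ n (leqnn _))] /=.
  rewrite sub0r normrN normrX gtr0_norm; last by lra.
  by exists n.
have [t0 nPn [i1 i2] [i3 i4]] := invs n.
apply: nPn; apply: Hr; rewrite ?Xub ?Xlub ?Yub ?Ylub// t0 st.
exact: nr.
Qed.

End Bisection.

(** The integral of g dz along the counterclockwise boundary of a rectangle, with opposite sides
    paired. *)
HB.lock Definition contour (R : realType) (g : R[i] -> R[i]) (x y w h : R) : R[i] :=
  cint (fun u => g (u +i* y) - g (u +i* (y + h))) x (x + w) +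
  'i * cint (fun v => g ((x + w) +i* v) - g (x +i* v)) y (y + h).
Arguments contour {R} g x y w h.

Section Goursat.
Variable R : realType.
Local Notation C := R[i].
Implicit Types (g : C -> C) (x y w h : R).

Lemma contour_splitx g x y w1 w2 h : 0 <= w1 -> 0 <= w2 -> 0 <= h ->
  (forall u : R, x <= u <= x + (w1 + w2) ->
     cderivable g (u +i* y) /\ cderivable g (u +i* (y + h))) ->
  (forall v : R, y <= v <= y + h -> [/\ cderivable g (x +i* v),
     cderivable g ((x + w1) +i* v) & cderivable g ((x + (w1 + w2)) +i* v)]) ->
  contour g x y (w1 + w2) h = contour g x y w1 h + contour g (x + w1) y w2 h.
Proof.
move=> w10 w20 h0 Hu Hv; rewrite contour.unlock !addrA.
rewrite (@cint_split _ _ x (x + w1) (x + w1 + w2)); [|lra|lra|]; last first.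
  by apply: ccontB; apply: ccont_hline => u; rewrite -addrA => /Hu[].
have -> : cint (fun v => g ((x + w1 + w2) +i* v) - g (x +i* v)) y (y + h) =
    cint (fun v => g ((x + w1) +i* v) - g (x +i* v)) y (y + h) +
    cint (fun v => g ((x + w1 + w2) +i* v) - g ((x + w1) +i* v)) y (y + h).
  rewrite -cint_add.
  - by congr cint; apply/funext => v; ring.
  - by apply: ccontB; apply: ccont_vline => v /Hv[].
  - by apply: ccontB; apply: ccont_vline => v /Hv[]; rewrite addrA.
by ring.
Qed.

Lemma contour_splity g x y w h1 h2 : 0 <= w -> 0 <= h1 -> 0 <= h2 ->
  (forall v : R, y <= v <= y + (h1 + h2) ->
     cderivable g (x +i* v) /\ cderivable g ((x + w) +i* v)) ->
  (forall u : R, x <= u <= x + w -> [/\ cderivable g (u +i* y),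
     cderivable g (u +i* (y + h1)) & cderivable g (u +i* (y + (h1 + h2)))]) ->
  contour g x y w (h1 + h2) = contour g x y w h1 + contour g x (y + h1) w h2.
Proof.
move=> w0 h10 h20 Hv Hu; rewrite contour.unlock !addrA.
rewrite (@cint_split _ (fun v => g ((x + w) +i* v) - g (x +i* v))
  y (y + h1) (y + h1 + h2)); [|lra|lra|]; last first.
  by apply: ccontB; apply: ccont_vline => v; rewrite -addrA => /Hv[].
have -> : cint (fun u => g (u +i* y) - g (u +i* (y + h1 + h2))) x (x + w) =
    cint (fun u => g (u +i* y) - g (u +i* (y + h1))) x (x + w) +
    cint (fun u => g (u +i* (y + h1)) - g (u +i* (y + h1 + h2))) x (x + w).
  rewrite -cint_add.
  - by congr cint; apply/funext => v; ring.
  - by apply: ccontB; apply: ccont_hline => v /Hu[].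
  - by apply: ccontB; apply: ccont_hline => v /Hu[]; rewrite addrA.
by ring.
Qed.

(** An affine function contributes nothing: its differences across opposite sides are the constants
    - D i h and D w, whose contributions cancel. Only the error e remains. *)
Lemma contour_approx g x y w h A D Z (e : R) : 0 <= w -> 0 <= h ->
  (forall u v : R, x <= u <= x + w -> y <= v <= y + h -> cderivable g (u +i* v)) ->
  (forall u v : R, x <= u <= x + w -> y <= v <= y + h ->
     nm (g (u +i* v) - A - D * ((u +i* v) - Z)) <= e) ->
  nm (contour g x y w h) <= 4 * e * (w + h).
Proof.
move=> w0 h0 gd ge.
have xl : x <= x <= x + w by lra.
have xr : x <= x + w <= x + w by lra.
have yl : y <= y <= y + h by lra.
have yr : y <= y + h <= y + h by lra.
have c1 : ccont (fun u => g (u +i* y) - g (u +i* (y + h))) x (x + w).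
  by apply: ccontB; apply: ccont_hline => u ux; apply: gd.
have c2 : ccont (fun v => g ((x + w) +i* v) - g (x +i* v)) y (y + h).
  by apply: ccontB; apply: ccont_vline => v vy; apply: gd.
pose k1 := - (D * (0 +i* h)); pose k2 := D * w%:C.
have b1 : nm (cint (fun u => g (u +i* y) - g (u +i* (y + h))) x (x + w)
    - k1 * (x + w - x)%:C) <= 2 * (2 * e) * (x + w - x).
  apply: cint_bound => //; first by lra.
  move=> u ux; have := ge _ _ ux yl; have := ge _ _ ux yr.
  set p := _ - _ - _; set q := _ - _ - _ => ep eq.
  have -> : g (u +i* y) - g (u +i* (y + h)) - k1 = q - p.
    rewrite /q /p /k1 opprK; have -> : u +i* (y + h) = u +i* y + 0 +i* h.
      by apply: complex_eq => /=; ring.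
    by ring.
  by rewrite (le_trans (nmB _ _))//; lra.
have b2 : nm (cint (fun v => g ((x + w) +i* v) - g (x +i* v)) y (y + h)
    - k2 * (y + h - y)%:C) <= 2 * (2 * e) * (y + h - y).
  apply: cint_bound => //; first by lra.
  move=> v vy; have := ge _ _ xl vy; have := ge _ _ xr vy.
  set p := _ - _ - _; set q := _ - _ - _ => ep eq.
  have -> : g ((x + w) +i* v) - g (x +i* v) - k2 = p - q.
    rewrite /q /p /k2; have -> : (x + w) +i* v = x +i* v + w%:C.
      by apply: complex_eq => /=; ring.
    by ring.
  by rewrite (le_trans (nmB _ _))//; lra.
rewrite contour.unlock.
set I1 := cint _ _ _ in b1 *; set I2 := cint _ _ _ in b2 *.
have -> : I1 + 'i * I2 = (I1 - k1 * (x + w - x)%:C)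
    + 'i * (I2 - k2 * (y + h - y)%:C).
  have -> : x + w - x = w by ring.
  have -> : y + h - y = h by ring.
  have -> : k1 = - (D * ('i * h%:C)).
    by congr (- (D * _)); apply: complex_eq => /=; ring.
  by rewrite /k2; ring.
by rewrite (le_trans (nmD _ _))// nmM nm_i mul1r; lra.
Qed.

(** The bound e t^2 adds up over four quarters, as 4 (t / 2)^2 = t^2, and holds on small rectangles,
    where g is affine up to a small multiple of the diameter. *)
Lemma goursat g x0 y0 W H : 0 <= W -> 0 <= H ->
  (forall u v : R, x0 <= u <= x0 + W -> y0 <= v <= y0 + H ->
     cderivable g (u +i* v)) ->
  contour g x0 y0 W H = 0.
Proof.
move=> W0 H0 gd; apply/eqP; rewrite -nm_eq0 eq_le nm_ge0 andbT.
apply: le0_eps => e e0.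
(* Local errors e / (4 S) turn the bound of [contour_approx] into e t^2 (W + H)^2 / S <= e t^2;
   adding 1 keeps S positive when both sides vanish. *)
set S := (W + H) ^+ 2 + 1.
have S0 : 0 < S by rewrite /S; have := sqr_ge0 (W + H); lra.
pose P (x y t : R) := x0 <= x -> x + t * W <= x0 + W -> y0 <= y ->
  y + t * H <= y0 + H -> nm (contour g x y (t * W) (t * H)) <= e * t ^+ 2.
suff : P x0 y0 1.
  by rewrite /P !mul1r !lexx => /(_ isT isT isT isT); rewrite expr1n mulr1.
apply: (@quad_bisection R P W H) => //.
- move=> x y t t0; have tW : 0 <= t / 2 * W by rewrite mulr_ge0//; lra.
  have tH : 0 <= t / 2 * H by rewrite mulr_ge0//; lra.
  have tWE : t * W = t / 2 * W + t / 2 * W by field.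
  have tHE : t * H = t / 2 * H + t / 2 * H by field.
  rewrite /P tWE tHE; move: (t / 2 * W) (t / 2 * H) tW tH => w h w0 h0.
  have -> : e * t ^+ 2 = e * (t / 2) ^+ 2 + e * (t / 2) ^+ 2 +
    (e * (t / 2) ^+ 2 + e * (t / 2) ^+ 2) by field.
  move: (e * (t / 2) ^+ 2) => k Q1 Q2 Q3 Q4 hx1 hx2 hy1 hy2.
  have {}Q1 := Q1 hx1 ltac:(lra) hy1 ltac:(lra).
  have {}Q2 := Q2 ltac:(lra) ltac:(lra) hy1 ltac:(lra).
  have {}Q3 := Q3 hx1 ltac:(lra) ltac:(lra) ltac:(lra).
  have {}Q4 := Q4 ltac:(lra) ltac:(lra) ltac:(lra) ltac:(lra).
  have gd' (u v : R) : x <= u <= x + (w + w) ->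
      y <= v <= y + (h + h) -> cderivable g (u +i* v).
    by move=> ux vy; apply: gd; lra.
  have bx1 : x <= x <= x + (w + w) by lra.
  have bx2 : x <= x + w <= x + (w + w) by lra.
  have bx3 : x <= x + (w + w) <= x + (w + w) by lra.
  have by1 : y <= y <= y + (h + h) by lra.
  have by2 : y <= y + h <= y + (h + h) by lra.
  have by3 : y <= y + (h + h) <= y + (h + h) by lra.
  have wx (u : R) : x <= u <= x + w -> x <= u <= x + (w + w) by lra.
  have wx' (u : R) : x + w <= u <= x + w + w -> x <= u <= x + (w + w) by lra.
  rewrite contour_splitx//; [|lra| |]; last 2 first.
  - by move=> u ux; split; apply: gd'.
  - by move=> v vy; split; apply: gd'.
  rewrite !contour_splity//; last 4 first.
  - by move=> v vy; split; apply: gd' => //; rewrite -addrA.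
  - by move=> u /wx' ux; split; apply: gd'.
  - by move=> v vy; split; apply: gd'.
  - by move=> u /wx ux; split; apply: gd'.
  rewrite (le_trans (nmD _ _))//.
  apply: (le_trans (lerD (nmD _ _) (nmD _ _))).
  by clear -Q1 Q2 Q3 Q4; lra.
- move=> X Y XW YH; have [D gD] := gd _ _ XW YH.
  have e1 : 0 < e / (4 * S) by rewrite divr_gt0// mulr_gt0.
  have [r r0 Hr] := gD _ e1.
  have WH1 : 0 < W + H + 1 by lra.
  exists (r / (W + H + 1)); first by rewrite divr_gt0.
  move=> x y t /andP[t0 tr] Xx Yy x0x xW y0y yH _ _ _ _.
  have tr' : t * (W + H + 1) < r by rewrite -ltr_pdivlMr.
  have tW : 0 <= t * W by rewrite mulr_ge0// ltW.
  have tH : 0 <= t * H by rewrite mulr_ge0// ltW.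
  have ap : nm (contour g x y (t * W) (t * H)) <=
      4 * (e / (4 * S) * (t * W + t * H)) * (t * W + t * H).
    apply: (@contour_approx _ _ _ _ _ (g (X +i* Y)) D (X +i* Y)) => //.
      by move=> u v ux vy; apply: gd; lra.
    move=> u v ux vy.
    have nmh : nm (u +i* v - X +i* Y) <= t * W + t * H.
      rewrite (le_trans (nm_le_ReIm _))//= lerD// ler_norml; apply/andP; split; lra.
    have := Hr (u +i* v - X +i* Y); rewrite subrKC.
    have lt : nm (u +i* v - X +i* Y) < r.
      by apply: (le_lt_trans nmh); move: tr'; rewrite !mulrDr mulr1; lra.
    move=> /(_ lt) h; apply: (le_trans h).
    by rewrite ler_pM2l.
  apply: (le_trans ap).
  have -> : 4 * (e / (4 * S) * (t * W + t * H)) * (t * W + t * H) =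
    e * t ^+ 2 * ((W + H) ^+ 2 / S) by field; rewrite gt_eqF.
  rewrite -[leRHS]mulr1 ler_wpM2l//; first by rewrite mulr_ge0 ?sqr_ge0// ltW.
  by rewrite ler_pdivrMr// mul1r /S lerDl.
Qed.

(** The frame between the rectangle and the small square is cut into four rectangles avoiding a +
    ib, and [goursat] applies to each. *)
Lemma contour_shrink g x y w h (a b t : R) : 0 < t ->
  x < a - t -> a + t < x + w -> y < b - t -> b + t < y + h ->
  (forall u v : R, x <= u <= x + w -> y <= v <= y + h ->
     u +i* v != a +i* b -> cderivable g (u +i* v)) ->
  contour g x y w h = contour g (a - t) (b - t) (t + t) (t + t).
Proof.
move=> t0 tx1 tx2 ty1 ty2 gd.
have gdx (u v : R) : u < a \/ a < u -> x <= u <= x + w -> y <= v <= y + h ->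
    cderivable g (u +i* v).
  move=> ua ux vy; apply: gd => //; apply/eqP => -[uE _].
  by move: ua; rewrite uE ltxx => -[].
have gdy (u v : R) : v < b \/ b < v -> x <= u <= x + w -> y <= v <= y + h ->
    cderivable g (u +i* v).
  move=> ua ux vy; apply: gd => //; apply/eqP => -[_ uE].
  by move: ua; rewrite uE ltxx => -[].
clear gd.
have wE : w = (a - t - x) + ((t + t) + (x + w - (a + t))) by ring.
have hE : h = (b - t - y) + ((t + t) + (y + h - (b + t))) by ring.
have xE : x + (a - t - x) = a - t by ring.
have yE : y + (b - t - y) = b - t by ring.
rewrite {}wE (@contour_splitx g x y (a - t - x)); [|lra|lra|lra| |]; last 2 first.
- by move=> u ux; split; apply: gdy; lra.
- by move=> v vy; split; apply: gdx; lra.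
rewrite xE (@contour_splitx g (a - t) y (t + t)); [|lra|lra|lra| |]; last 2 first.
- by move=> u ux; split; apply: gdy; lra.
- by move=> v vy; split; apply: gdx; lra.
rewrite goursat; [|lra|lra|]; last by move=> u v ux vy; apply: gdx; lra.
rewrite [X in _ + (_ + X)]goursat; [|lra|lra|]; last first.
  by move=> u v ux vy; apply: gdx; lra.
rewrite add0r addr0 {}hE (@contour_splity g (a - t) y (t + t) (b - t - y));
  [|lra|lra|lra| |]; last 2 first.
- by move=> u ux; split; apply: gdx; lra.
- by move=> v vy; split; apply: gdy; lra.
rewrite yE (@contour_splity g (a - t) (b - t) (t + t) (t + t));
  [|lra|lra|lra| |]; last 2 first.
- by move=> u ux; split; apply: gdx; lra.
- by move=> v vy; split; apply: gdy; lra.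
rewrite goursat; [|lra|lra|]; last by move=> u v ux vy; apply: gdy; lra.
rewrite [X in _ + (_ + X)]goursat; [|lra|lra|]; last first.
  by move=> u v ux vy; apply: gdy; lra.
by rewrite add0r addr0.
Qed.

Lemma contour_bound g x y w h (M : R) : 0 <= w -> 0 <= h ->
  (forall u : R, x <= u <= x + w ->
     [/\ cderivable g (u +i* y), cderivable g (u +i* (y + h)),
         nm (g (u +i* y)) <= M & nm (g (u +i* (y + h))) <= M]) ->
  (forall v : R, y <= v <= y + h ->
     [/\ cderivable g (x +i* v), cderivable g ((x + w) +i* v),
         nm (g (x +i* v)) <= M & nm (g ((x + w) +i* v)) <= M]) ->
  nm (contour g x y w h) <= 4 * M * (w + h).
Proof.
move=> w0 h0 Hu Hv; rewrite contour.unlock (le_trans (nmD _ _))// nmM nm_i mul1r.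
have b1 : nm (cint (fun u => g (u +i* y) - g (u +i* (y + h))) x (x + w))
    <= 2 * (2 * M) * (x + w - x).
  have := @cint_bound R (fun u => g (u +i* y) - g (u +i* (y + h))) 0 (2 * M)
    x (x + w); rewrite mul0r subr0; apply; first lra.
    by apply: ccontB; apply: ccont_hline => u /Hu[].
  move=> u /Hu[_ _ m1 m2]; rewrite subr0 (le_trans (nmB _ _))//.
  by clear -m1 m2; lra.
have b2 : nm (cint (fun v => g ((x + w) +i* v) - g (x +i* v)) y (y + h))
    <= 2 * (2 * M) * (y + h - y).
  have := @cint_bound R (fun v => g ((x + w) +i* v) - g (x +i* v)) 0 (2 * M)
    y (y + h); rewrite mul0r subr0; apply; first lra.
    by apply: ccontB; apply: ccont_vline => u /Hv[].
  move=> u /Hv[_ _ m1 m2]; rewrite subr0 (le_trans (nmB _ _))//.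
  by clear -m1 m2; lra.
by clear -b1 b2; lra.
Qed.

(** After shrinking to a square of half-side t, the bound M near the puncture leaves at most 16 M t,
    which is arbitrarily small. *)
Lemma goursat_removable g x y w h (a b M r : R) :
  x < a < x + w -> y < b < y + h -> 0 < r ->
  (forall u v : R, x <= u <= x + w -> y <= v <= y + h ->
     u +i* v != a +i* b -> cderivable g (u +i* v)) ->
  (forall z, z != a +i* b -> nm (z - a +i* b) < r -> nm (g z) <= M) ->
  contour g x y w h = 0.
Proof.
move=> /andP[xa1 xa2] /andP[yb1 yb2] r0 gd gM.
apply/eqP; rewrite -nm_eq0 eq_le nm_ge0 andbT.
have M0 : 0 <= M.
  have := gM (a +i* b + (r / 2)%:C); rewrite [a +i* b + _ - _]addrAC subrr add0r.
  move=> H; apply: (le_trans (nm_ge0 _)); apply: H.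
    rewrite -subr_eq0 [a +i* b + _ - _]addrAC subrr add0r -nm_eq0 nmC.
    by rewrite gt_eqF// normr_gt0; lra.
  by rewrite nmC gtr0_norm; lra.
apply: le0_eps => e e0.
have M1 : 0 < 16 * (M + 1) by lra.
have [t [t0 tr te [tx1 tx2] [ty1 ty2]]] : exists t : R, [/\ 0 < t, t <= r / 4,
    t * (16 * (M + 1)) <= e, t < a - x /\ t < x + w - a & t < b - y /\ t < y + h - b].
  pose m : R := Num.min (Num.min (a - x) (x + w - a)) (Num.min (b - y) (y + h - b)).
  have m0 : 0 < m by rewrite !lt_min !subr_gt0 xa1 xa2 yb1.
  have : m <= m by [].
  rewrite {2}/m !le_min => /andP[/andP[m1 m2] /andP[m3 m4]].
  move: (m) m0 m1 m2 m3 m4 => {} m m0 m1 m2 m3 m4.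
  exists (Num.min (m / 2) (Num.min (r / 4) (e / (16 * (M + 1))))).
  set t : R := Num.min _ _.
  have t0 : 0 < t by rewrite !lt_min !divr_gt0.
  have tm : t <= m / 2 by rewrite ge_min lexx.
  split => //; [by rewrite !ge_min lexx orbT| |split..]; [|lra..].
  by rewrite -ler_pdivlMr// !ge_min lexx !orbT.
rewrite (@contour_shrink g x y w h a b t)//; [|lra..].
have neq (u v : R) : (u == a) && (v == b) = false -> u +i* v != a +i* b.
  by move=> uv; rewrite eq_complex /= uv.
have near (u v : R) : `|u - a| <= t -> `|v - b| <= t ->
    (u == a) && (v == b) = false ->
    cderivable g (u +i* v) /\ nm (g (u +i* v)) <= M.
  move=> ua vb uv; split.
    by apply: gd (neq _ _ uv); move: ua vb; clear -tx1 tx2 ty1 ty2;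
       rewrite !ler_norml; lra.
  apply: gM (neq _ _ uv) _.
  rewrite (le_lt_trans (nm_le_ReIm _))//=.
  by clear -ua vb tr r0; lra.
apply: le_trans (@contour_bound g (a - t) (b - t) (t + t) (t + t) M _ _ _ _) _.
- by lra.
- by lra.
- have -> : b - t + (t + t) = b + t by ring.
  move=> u ux; have ua : `|u - a| <= t by clear -ux; rewrite ler_norml; lra.
  have [] := near u (b - t) ua; rewrite ?[_ - t - _]addrAC ?subrr ?add0r ?normrN ?gtr0_norm//.
    by rewrite [X in _ && X]lt_eqF ?andbF//; lra.
  have [] := near u (b + t) ua; rewrite ?[_ + t - _]addrAC ?subrr ?add0r ?gtr0_norm//.
  by rewrite [X in _ && X]gt_eqF ?andbF//; lra.
- have -> : a - t + (t + t) = a + t by ring.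
  move=> u ux; have ua : `|u - b| <= t by clear -ux; rewrite ler_norml; lra.
  have [] := near (a - t) u _ ua; rewrite ?[_ - t - _]addrAC ?subrr ?add0r ?normrN ?gtr0_norm//.
    by rewrite [X in X && _]lt_eqF//; lra.
  have [] := near (a + t) u _ ua; rewrite ?[_ + t - _]addrAC ?subrr ?add0r ?gtr0_norm//.
  by rewrite [X in X && _]gt_eqF//; lra.
have -> : 4 * M * (t + t + (t + t)) = t * (16 * M) by ring.
by apply: le_trans te; rewrite ler_pM2l//; lra.
Qed.

(** Translation invariance by bisection of a flat rectangle: on short intervals both integrals are a
    common value of f times the length, up to a small multiple of the length. *)
Lemma cint_periodic (f : R -> C) (a b : R) : a <= b -> (forall u : R, f (u + 1) = f u) ->
  (forall c d : R, ccont f c d) -> cint f (a + 1) (b + 1) = cint f a b.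
Proof.
move=> ab fp fc; apply/eqP; rewrite -subr_eq0 -nm_eq0 eq_le nm_ge0 andbT.
apply: le0_eps => e e0.
pose D (x w : R) := cint f (x + 1) (x + 1 + w) - cint f x (x + w).
pose P (x _ t : R) := nm (D x (t * (b - a))) <= e * t.
suff : P a 0 1 by rewrite /P /D mul1r mulr1 subrKC -addrA [1 + _]addrC addrA subrKC.
apply: (@quad_bisection R P (b - a) 0); rewrite ?subr_ge0//.
- move=> x y t t0 h1 h2 _ _; rewrite /P.
  have t2 : 0 <= t / 2 * (b - a) by rewrite mulr_ge0//; lra.
  have -> : D x (t * (b - a)) =
    D x (t / 2 * (b - a)) + D (x + t / 2 * (b - a)) (t / 2 * (b - a)).
    rewrite /D; set w := t / 2 * (b - a) in t2 *.
    have -> : t * (b - a) = w + w by rewrite /w; field.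
    have -> : x + w + 1 = x + 1 + w by ring.
    rewrite !addrA (@cint_split _ _ (x + 1) (x + 1 + w) (x + 1 + w + w));
      [|by lra|by lra|by []].
    rewrite (@cint_split _ _ x (x + w) (x + w + w)); [|by lra|by lra|by []].
    by ring.
  apply: (le_trans (nmD _ _)).
  have -> : e * t = e * (t / 2) + e * (t / 2) by field.
  exact: lerD h1 h2.
- move=> X Y Xab _.
  have [d d0 Hd] : exists2 d : R, 0 < d &
      forall u : R, `|u - X| < d -> nm (f u - f X) < e / (4 * (b - a + 1)).
    have e1 : 0 < e / (4 * (b - a + 1)) by rewrite divr_gt0//; lra.
    have X1 : X - 1 <= X <= X + 1 by lra.
    have [d d0 Hd] := fc (X - 1) (X + 1) X X1 _ e1.
    exists (Num.min d 1); first by rewrite lt_min d0 ltr01.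
    move=> u; rewrite lt_min => /andP[ud u1]; apply: Hd => //.
    by move: u1; rewrite ltr_norml; lra.
  have ba1 : 0 < b - a + 1 by lra.
  exists (d / (b - a + 1)); first by rewrite divr_gt0.
  move=> x y t /andP[t0 td] Xt _ _ _ _ _; rewrite /P /D.
  have td' : t * (b - a + 1) < d by rewrite -ltr_pdivlMr.
  have t0' : 0 <= t * (b - a) by rewrite mulr_ge0 ?subr_ge0// ltW.
  have tba : t * (b - a) < d by move: td'; rewrite mulrDr; lra.
  set w := t * (b - a) in t0' tba Xt *; set k := e / (4 * (b - a + 1)) in Hd.
  have bd (u : R) : x <= u <= x + w -> nm (f u - f X) <= k.
    by move=> ux; apply/ltW/Hd; rewrite ltr_norml; lra.
  have b1 := @cint_bound R f (f X) k x (x + w) ltac:(lra) (@fc _ _) bd.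
  have b2 : nm (cint f (x + 1) (x + 1 + w) - f X * (x + 1 + w - (x + 1))%:C)
      <= 2 * k * (x + 1 + w - (x + 1)).
    apply: cint_bound => //; first by lra.
    by move=> u ux; rewrite -[u](subrK 1) fp; apply: bd; lra.
  have E1 : x + w - x = w by ring.
  have E2 : x + 1 + w - (x + 1) = w by ring.
  rewrite {}E1 in b1; rewrite {}E2 in b2.
  rewrite (le_trans (nm_triB _ _ (f X * w%:C)))// [X in _ + X <= _]nm_distC.
  have kw : 4 * (k * w) <= e * t.
    have -> : 4 * (k * w) = e * t * ((b - a) / (b - a + 1)).
      by rewrite /k /w; field; rewrite gt_eqF.
    rewrite -[leRHS]mulr1 ler_wpM2l//; first by rewrite mulr_ge0// ltW.
    by rewrite ler_pdivrMr//; lra.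
  by lra.
Qed.

Lemma cint_period (f : R -> C) (a : R) : (forall u : R, f (u + 1) = f u) ->
  (forall c d : R, ccont f c d) -> cint f a (a + 1) = cint f 0 1.
Proof.
move=> fp fc.
have key (c d : R) : c <= d -> cint f c (c + 1) = cint f d (d + 1).
  move=> cd; have := @cint_periodic f c d cd fp fc.
  have s1 := @cint_split R f c d (d + 1) cd ltac:(lra) (@fc _ _).
  have s2 := @cint_split R f c (c + 1) (d + 1) ltac:(lra) ltac:(lra) (@fc _ _).
  by move: s1; rewrite s2 => s1 s3; rewrite s3 in s1; move: s1; rewrite addrC => /addrI.
have [a0|a0] := leP a 0.
  by rewrite (key _ _ a0) add0r.
by rewrite -(key _ _ (ltW a0)) add0r.
Qed.

End Goursat.

Lemma is_derive_epsP (R : realType) (V W : normedModType R) (f : V -> W)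
    (a v : V) (df : W) :
  is_derive a v f df <-> forall e : R, 0 < e -> exists2 d : R, 0 < d &
    forall h : R, `|h| < d -> `|f (h *: v + a) - f a - h *: df| <= e * `|h|.
Proof.
split=> [[dfv dfE] e e0|H].
  have /cvgrPdist_le/(_ e e0) :
      (fun h => h^-1 *: ((f \o shift a) (h *: v) - f a)) @ 0^' --> df.
    by rewrite -dfE; exact: dfv.
  rewrite near_withinE => /nbhs_ballP[d d0 Hd]; exists d => // h hd.
  have [->|h0] := eqVneq h 0.
    by rewrite !scale0r add0r subrr subr0 !normr0 mulr0.
  have := Hd h; rewrite /ball /= sub0r normrN => /(_ hd h0) {}Hd.
  have -> : f (h *: v + a) - f a - h *: df =
      - (h *: (df - h^-1 *: (f (h *: v + a) - f a))).
    by rewrite scalerBr scalerA divff// scale1r opprB.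
  by rewrite normrN normrZ mulrC ler_wpM2r.
have cv : (fun h => h^-1 *: ((f \o shift a) (h *: v) - f a)) @ 0^' --> df.
  apply/cvgrPdist_le => e e0; have [d d0 Hd] := H e e0.
  rewrite near_withinE; apply/nbhs_ballP; exists d => //= h.
  rewrite /ball /= sub0r normrN => hd h0; have {}Hd := Hd h hd.
  have -> : df - h^-1 *: (f (h *: v + a) - f a) =
      - (h^-1 *: (f (h *: v + a) - f a - h *: df)).
    by rewrite [in RHS]scalerBr scalerA mulVf// scale1r opprB.
  by rewrite normrN normrZ normfV mulrC ler_pdivrMr// normr_gt0.
by apply: DeriveDef; [apply/cvg_ex; exists df|exact: cvg_lim].
Qed.

(** * Fourier series of holomorphic functions on a strip *)

HB.lock Definition tpi (R : realType) : R := pi *+ 2.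
Arguments tpi {R}.

Lemma tpi_gt0 (R : realType) : 0 < tpi :> R.
Proof. by rewrite tpi.unlock pmulrn_lgt0// pi_gt0. Qed.

(** The function e(w) = exp(2 i pi w), written with real functions of Re w and Im w. *)
HB.lock Definition ce (R : realType) (w : R[i]) : R[i] :=
  (expR (- (tpi * complex.Im w)))%:C *
  (cos (tpi * complex.Re w) +i* sin (tpi * complex.Re w)).
Arguments ce {R} w.

Section ComplexExponentialTheory.
Variable R : realType.
Local Notation C := R[i].
Implicit Types (w z : C) (k : int).

Lemma nm_unit (x : R) : nm (cos x +i* sin x) = 1.
Proof. by rewrite nm.unlock /= cos2Dsin2 sqrtr1. Qed.

Lemma nm_ce w : nm (ce w) = expR (- (tpi * complex.Im w)).
Proof. by rewrite ce.unlock nmM nm_unit mulr1 nmC ger0_norm ?expR_ge0. Qed.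

Lemma ceD w z : ce (w + z) = ce w * ce z.
Proof.
rewrite ce.unlock cReD cImD !mulrDr opprD expRD cosD sinD.
by apply: complex_eq => /=; ring.
Qed.

Lemma ce0 : ce 0 = 1 :> C.
Proof.
rewrite ce.unlock /= !mulr0 oppr0 expR0 cos0 sin0.
by apply: complex_eq => /=; ring.
Qed.

Lemma ce_neq0 w : ce w != 0.
Proof. by rewrite -nm_eq0 nm_ce gt_eqF// expR_gt0. Qed.

Lemma ceN w : ce (- w) = (ce w)^-1.
Proof.
by apply: (mulIf (ce_neq0 w)); rewrite mulVf ?ce_neq0// -ceD addNr ce0.
Qed.

Lemma ce1 : ce 1 = 1 :> C.
Proof.
rewrite ce.unlock /= mulr0 mulr1 oppr0 expR0 tpi.unlock cos2pi sin2pi.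
by apply: complex_eq => /=; ring.
Qed.

Lemma ceMn w n : ce (w *+ n) = ce w ^+ n.
Proof.
by elim: n => [|n IH]; rewrite ?mulr0n ?ce0 ?expr0// mulrS ceD IH exprS.
Qed.

Lemma ceMz w k : ce (k%:~R * w) = ce w ^ k.
Proof.
case: k => n; first by rewrite -[n%:~R]/(n%:R) mulr_natl ceMn.
by rewrite NegzE mulrNz mulNr ceN mulr_natl ceMn.
Qed.

Lemma ce_int k : ce k%:~R = 1 :> C.
Proof. by rewrite -[k%:~R]mulr1 ceMz ce1 exp1rz. Qed.

Lemma ce_period k w : ce (k%:~R * (w + 1)) = ce (k%:~R * w).
Proof. by rewrite mulrDr mulr1 ceD ce_int mulr1. Qed.

Lemma real_is_derive_eps (f : R -> R) (d : R) : is_derive (0 : R) (1 : R) f d ->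
  forall e : R, 0 < e -> exists2 r : R, 0 < r &
    forall h : R, `|h| < r -> `|f h - f 0 - d * h| <= e * `|h|.
Proof.
move=> /is_derive_epsP H e e0; have [r r0 Hr] := H e e0; exists r => // h /Hr.
by rewrite addr0 [h *: 1]mulr1 [h *: d]mulrC.
Qed.

Lemma cderiv_ce0 : cderiv (@ce R) 0 ('i * tpi%:C).
Proof.
move=> e e0; have t0 := tpi_gt0 R.
(* The final error is 2 k + 2 (e1 + 1) k <= 6 k with k = e1 tpi |h|, hence the 6. *)
have [e1 [e10 e11 e12]] : exists e1 : R, [/\ 0 < e1, e1 <= 1 & e1 * (6 * tpi) <= e].
  have t6 : 0 < 6 * (tpi : R) by lra.
  exists (Num.min 1 (e / (6 * tpi))); split; first by rewrite lt_min ltr01 divr_gt0.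
    by rewrite ge_min lexx.
  by rewrite -ler_pdivlMr// ge_min lexx orbT.
have [r1 r10 H1] := real_is_derive_eps (is_derive_expR 0) e10.
have [r2 r20 H2] := real_is_derive_eps (is_derive_sin 0) e10.
have [r3 r30 H3] := real_is_derive_eps (is_derive_cos 0) e10.
have [r [r0 rr1 rr2 rr3 [r4 r5]]] : exists r : R, [/\ 0 < r, tpi * r < r1,
    tpi * r < r2, tpi * r < r3 & tpi * r < 1 /\ tpi * r * (e1 + 1) < e1 ].
  pose m : R := Num.min (Num.min r1 r2) (Num.min r3 (Num.min 1 (e1 / (e1 + 1)))).
  have e13 : 0 < e1 + 1 by lra.
  have m0 : 0 < m by rewrite !lt_min r10 r20 r30 ltr01 divr_gt0.
  have : m <= m by [].
  rewrite {2}/m !le_min => /andP[/andP[m1 m2] /andP[m3 /andP[m4 m5]]].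
  move: (m) m0 m1 m2 m3 m4 m5 => {} m m0 m1 m2 m3 m4 m5.
  have E : tpi * (m / (2 * tpi)) = m / 2 by field; rewrite gt_eqF.
  exists (m / (2 * tpi)); rewrite E; split=> //; try lra.
    by rewrite divr_gt0// mulr_gt0.
  split; first lra.
  rewrite -ltr_pdivlMr//; lra.
exists r => // h hr; rewrite add0r ce0.
set a := complex.Re h; set b := complex.Im h.
have ha : `|a| <= nm h by exact: nm_Re.
have hb : `|b| <= nm h by exact: nm_Im.
have h0 := nm_ge0 h.
pose x := tpi * a; pose y := - (tpi * b).
have xh : `|x| <= tpi * nm h.
  by rewrite normrM gtr0_norm// ler_pM2l.
have yh : `|y| <= tpi * nm h.
  by rewrite normrN normrM gtr0_norm// ler_pM2l.
have hr' : tpi * nm h < tpi * r by rewrite ltr_pM2l.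
have E1 := H1 y (le_lt_trans yh (lt_trans hr' rr1)).
have E2 := H2 x (le_lt_trans xh (lt_trans hr' rr2)).
have E3 := H3 x (le_lt_trans xh (lt_trans hr' rr3)).
rewrite expR0 mul1r in E1; rewrite sin0 cos0 mul1r subr0 in E2.
rewrite cos0 sin0 oppr0 mul0r subr0 in E3.
rewrite ce.unlock -/a -/b -/x -/y.
have -> : (expR y)%:C * (cos x +i* sin x) - 1 - 'i * tpi%:C * h =
   (expR y - 1 - y)%:C + (expR y)%:C * (cos x - 1)%:C
   + 'i * ((expR y)%:C * (sin x - x)%:C + (expR y - 1)%:C * x%:C).
  move: (expR y) (cos x) (sin x); rewrite /y /x /a /b; case: (h) => a' b' E c' s'.
  by apply: complex_eq => /=; ring.
have k0 : e1 * (tpi * nm h) <= e1 by rewrite ger_pMr//; apply/ltW; lra.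
have ey : `|expR y - 1| <= (e1 + 1) * (tpi * nm h).
  have -> : expR y - 1 = (expR y - 1 - y) + y by ring.
  rewrite (le_trans (ler_normD _ _))// mulrDl mul1r lerD//.
  by rewrite (le_trans E1)// ler_pM2l.
have ey' : `|expR y - 1| <= e1.
  apply: (le_trans ey); apply: le_trans (ltW r5); rewrite mulrC ler_pM2r; last lra.
  exact: ltW.
have ey2 : `|expR y| <= e1 + 1.
  by rewrite -[expR y](subrK 1) (le_trans (ler_normD _ _))// normr1 lerD2r.
have t1 : `|expR y| * `|cos x - 1| <= (e1 + 1) * (e1 * (tpi * nm h)).
  by apply: ler_pM => //; rewrite (le_trans E3)// ler_pM2l.
have t2 : `|expR y| * `|sin x - x| <= (e1 + 1) * (e1 * (tpi * nm h)).
  by apply: ler_pM => //; rewrite (le_trans E2)// ler_pM2l.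
have t3 : `|expR y - 1| * `|x| <= e1 * (tpi * nm h).
  by apply: ler_pM.
have t4 : `|expR y - 1 - y| <= e1 * (tpi * nm h).
  by rewrite (le_trans E1)// ler_pM2l.
apply: (@le_trans _ _ (2 * (e1 * (tpi * nm h)) + 2 * ((e1 + 1) * (e1 * (tpi * nm h))))).
  apply: (le_trans (nmD _ _)); apply: (le_trans (lerD (nmD _ _) (lexx _))).
  rewrite [X in _ + X <= _]nmM nm_i mul1r.
  apply: (le_trans (lerD (lexx _) (nmD _ _))); rewrite !nmM !nmC.
  by clear -t1 t2 t3 t4; lra.
have q0 : 0 <= e1 * (tpi * nm h) by rewrite !mulr_ge0// ltW.
have : (e1 + 1) * (e1 * (tpi * nm h)) <= 2 * (e1 * (tpi * nm h)).
  by rewrite ler_wpM2r//; lra.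
have : e1 * (6 * tpi) * nm h <= e * nm h by rewrite ler_wpM2r.
by lra.
Qed.

Lemma cderiv_ce w : cderiv (@ce R) w ('i * tpi%:C * ce w).
Proof.
have : cderiv (@ce R) (w - w) ('i * tpi%:C) by rewrite subrr; exact: cderiv_ce0.
move/cderiv_shift/(cderivZ (ce w)).
rewrite [ce w * _]mulrC; apply: cderiv_ext => z.
by rewrite -ceD subrKC.
Qed.

Lemma cderiv_ceM c w : cderiv (fun z => ce (c * z)) w ('i * tpi%:C * c * ce (c * w)).
Proof.
have := cderiv_comp (cderivZ c (cderiv_id w)) (cderiv_ce (c * w)).
by rewrite mulr1 mulrAC.
Qed.

Lemma ce_eq1 (a b : R) : `|a| <= 1 / 2 -> ce (a +i* b) = 1 -> a = 0 /\ b = 0.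
Proof.
move=> a12 E; have := nm_ce (a +i* b); rewrite E nm1 /= => /esym e1.
have b0 : b = 0.
  have : - (tpi * b) = 0 by apply: expR_inj; rewrite e1 expR0.
  by move/eqP; rewrite oppr_eq0 mulf_eq0 gt_eqF ?tpi_gt0//= => /eqP.
split=> //; move: E; rewrite ce.unlock b0 /= mulr0 oppr0 expR0.
have -> : 1%:C * (cos (tpi * a) +i* sin (tpi * a)) = cos (tpi * a) +i* sin (tpi * a).
  by apply: complex_eq => /=; ring.
move=> [c1 _]; have p0 := pi_gt0 R.
have : tpi * `|a| = 0 :> R.
  have h1 : 0 <= tpi * `|a| by rewrite mulr_ge0// ltW// tpi_gt0.
  have h2 : tpi * `|a| <= pi.
    rewrite tpi.unlock; move: (pi : R) p0 => p p0.
    have : p * `|a| <= p * (1 / 2) by rewrite ler_pM2l.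
    by rewrite [p *+ 2]mulr2n; lra.
  apply: cos_inj; rewrite ?in_itv/= ?lexx ?pi_ge0// ?h1 ?h2//.
  rewrite cos0 -c1 -[in RHS]cos_norm normrM; congr (cos (_ * _)).
  by rewrite gtr0_norm// tpi_gt0.
by move/eqP; rewrite mulf_eq0 gt_eqF ?tpi_gt0//= normr_eq0 => /eqP.
Qed.

End ComplexExponentialTheory.

Section Fourier.
Variable R : realType.
Local Notation C := R[i].
Implicit Types (g q : C -> C) (w z : C) (k : int) (s y t M : R) (K : nat).

Lemma pointD1 (u y : R) : (u + 1) +i* y = u +i* y + 1 :> C.
Proof. by apply: complex_eq => /=; ring. Qed.

(** On a rectangle of width one the vertical sides cancel by periodicity, so a vanishing contour
    integral equates the means on the two horizontal sides. The abscissa a is left free in order to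
    place a singularity inside. *)
Lemma mean_eq_contour g (a y h : R) : 0 <= h -> contour g a y 1 h = 0 ->
  (forall u, cderivable g (u +i* y)) ->
  (forall u, cderivable g (u +i* (y + h))) ->
  (forall u v : R, y <= v <= y + h -> g ((u + 1) +i* v) = g (u +i* v)) ->
  cint (fun u => g (u +i* y)) 0 1 = cint (fun u => g (u +i* (y + h))) 0 1.
Proof.
move=> h0 ctr gd1 gd2 gp.
have c1 (c d : R) : ccont (fun u => g (u +i* y)) c d by exact: ccont_hline.
have c2 (c d : R) : ccont (fun u => g (u +i* (y + h))) c d by exact: ccont_hline.
rewrite -(@cint_period R (fun u => g (u +i* y)) a)//; last by move=> u; apply: gp; lra.
rewrite -(@cint_period R (fun u => g (u +i* (y + h))) a)//; last first.
  by move=> u; apply: gp; lra.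
apply/eqP; rewrite -subr_eq0 -cint_sub// -ctr contour.unlock.
have -> : cint (fun v => g ((a + 1) +i* v) - g (a +i* v)) y (y + h) = 0.
  have z0 v : y <= v <= y + h -> g ((a + 1) +i* v) - g (a +i* v) = 0.
    by move=> vy; rewrite gp// subrr.
  apply/eqP; rewrite -nm_eq0 eq_le nm_ge0 andbT.
  have := @cint_bound R (fun v => g ((a + 1) +i* v) - g (a +i* v)) 0 0 y (y + h).
  rewrite mul0r subr0 mulr0 mul0r; apply; first by lra.
    move=> v vy e e0; exists 1 => // v' vy' _.
    by rewrite !z0// subr0 nm0.
  by move=> v vy; rewrite z0// subr0 nm0.
by rewrite mulr0 addr0.
Qed.

Definition hstrip s g := (forall w, `|complex.Im w| < s -> cderivable g w) /\
  (forall w, `|complex.Im w| < s -> g (w + 1) = g w).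

(** The k-th Fourier coefficient read at height y. The mode is evaluated on the same line as g, so
    that the value does not depend on y; see [fcoef_shift]. *)
Definition fcoef g y k : C :=
  cint (fun u => g (u +i* y) * ce ((- k)%:~R * (u +i* y))) 0 1.

Lemma hstrip_mode s g k : hstrip s g ->
  hstrip s (fun w => g w * ce (k%:~R * w)).
Proof.
move=> [gd gp]; split=> w ws; last by rewrite gp// ce_period.
have [d gw] := gd w ws.
by eexists; apply: cderivM gw (cderiv_ceM _ _).
Qed.

Lemma hstrip_mean s g y1 y2 : hstrip s g -> `|y1| < s -> `|y2| < s ->
  cint (fun u => g (u +i* y1)) 0 1 = cint (fun u => g (u +i* y2)) 0 1.
Proof.
move=> [gd gp]; wlog y12 : y1 y2 / y1 <= y2.
  move=> H; have [|/ltW] := leP y1 y2; first exact: H.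
  by move=> h a b; apply/esym/H.
move=> y1s y2s; have -> : y2 = y1 + (y2 - y1) by ring.
have vs v : y1 <= v <= y1 + (y2 - y1) -> `|v| < s.
  by move: y1s y2s; rewrite !ltr_norml; lra.
apply: (@mean_eq_contour g 0).
- by rewrite subr_ge0.
- apply: goursat; rewrite ?subr_ge0// => u v _ vy.
  by apply: gd; exact: vs.
- by move=> u; apply: gd => /=.
- by move=> u; apply: gd => /=; rewrite subrKC.
- by move=> u v vy; rewrite pointD1 gp//; exact: vs.
Qed.

Lemma fcoef_shift s g y1 y2 k : hstrip s g -> `|y1| < s -> `|y2| < s ->
  fcoef g y1 k = fcoef g y2 k.
Proof. by move=> /(@hstrip_mode s g (- k))/hstrip_mean; apply. Qed.

Lemma nm_ce_mode k (u y : R) :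
  nm (ce ((- k)%:~R * (u +i* y))) = expR (tpi * k%:~R * y).
Proof.
rewrite nm_ce; congr expR.
have -> : (- k)%:~R = (- k%:~R : R)%:C :> C.
  by rewrite mulrNz rmorphN /= rmorph_int.
by rewrite cImM /= mul0r addr0; ring.
Qed.

Lemma fcoef_bound g y k M :
  (forall u, cderivable g (u +i* y)) -> (forall u, nm (g (u +i* y)) <= M) ->
  nm (fcoef g y k) <= 2 * M * expR (tpi * k%:~R * y).
Proof.
move=> gd gM; have := @cint_bound R
  (fun u => g (u +i* y) * ce ((- k)%:~R * (u +i* y))) 0
  (M * expR (tpi * k%:~R * y)) 0 1.
rewrite mul0r !subr0 mulr1 mulrA; apply; first lra.
  apply: (@ccont_hline R (fun w => g w * ce ((- k)%:~R * w))) => u _.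
  have [d gw] := gd u; eexists; apply: cderivM gw (cderiv_ceM _ _).
by move=> u _; rewrite subr0 nmM nm_ce_mode ler_wpM2r ?expR_ge0.
Qed.

(** Raising the line by one multiplies the mode by e(k i), whose modulus is not 1 when k is
    non-zero, yet leaves its mean unchanged: the mean vanishes. *)
Lemma cint_mode k y :
  cint (fun u => ce (k%:~R * (u +i* y)) : C) 0 1 = (k == 0)%:R.
Proof.
have [->|k0] := eqVneq k 0.
  have -> : (fun u : R => ce (0%:~R * (u +i* y))) = fun=> 1.
    by apply/funext => u; rewrite mul0r ce0.
  by rewrite cint_cst// mul1r subr0.
have h1 : hstrip (`|y| + 2) (fun w : C => ce (k%:~R * w)).
  split=> w _; last exact: ce_period.
  by eexists; exact: cderiv_ceM.
have E := hstrip_mean (y1 := y) (y2 := y + 1) h1 ltac:(lra)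
  ltac:(have := ler_normD y 1; rewrite normr1; lra).
have fE : (fun u : R => ce (k%:~R * (u +i* (y + 1)))) =
    (fun u => ce (k%:~R * 'i) * ce (k%:~R * (u +i* y))).
  apply/funext => u; rewrite -ceD -mulrDr; congr (ce (_ * _)).
  by apply: complex_eq => /=; ring.
rewrite fE cint_scale in E; last first.
  apply: (@ccont_hline R (fun w => ce (k%:~R * w))) => u _.
  by eexists; exact: cderiv_ceM.
apply/eqP; move/eqP: E; rewrite -subr_eq0 -[X in X - _]mul1r -mulrBl mulf_eq0.
move=> /orP[|//]; rewrite subr_eq0 => /eqP/(congr1 nm).
rewrite nm1 nm_ce => /esym e1.
have /eqP : - (tpi * complex.Im (k%:~R * 'i)) = 0 :> R by apply: expR_inj; rewrite e1 expR0.
have -> : k%:~R = (k%:~R : R)%:C :> C by rewrite rmorph_int.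
rewrite cImM /= mulr1 mul0r addr0 oppr_eq0 mulf_eq0 gt_eqF ?tpi_gt0//=.
by rewrite intr_eq0 (negbTE k0).
Qed.

Lemma nm_ce_sub1 (z : C) t : 0 <= t -> t <= `|complex.Im z| ->
  1 - expR (- (tpi * t)) <= nm (ce z - 1).
Proof.
move=> t0 tz; have p0 := tpi_gt0 R.
have h1 : nm (ce z) - 1 <= nm (ce z - 1).
  have := nmD (ce z - 1) 1; rewrite subrK nm1; lra.
have h2 : 1 - nm (ce z) <= nm (ce z - 1).
  by have := nmD (1 - ce z) (ce z); rewrite subrK nm1 nm_distC; lra.
rewrite nm_ce in h1 h2; set b := complex.Im z in tz h1 h2.
have [b0|b0] := leP 0 b.
  rewrite ger0_norm// in tz; apply: le_trans h2.
  by rewrite lerB// ler_expR lerN2 ler_pM2l.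
rewrite ltr0_norm// in tz; apply: le_trans h1.
have E1 : expR (tpi * t) <= expR (- (tpi * b)).
  by rewrite ler_expR -mulrN ler_pM2l.
have E2 : expR (- (tpi * t)) * expR (tpi * t) = 1 :> R.
  by rewrite -expRD addNr expR0.
have E3 := expR_gt0 (tpi * t : R).
have : 0 <= (expR (tpi * t) - 1) ^+ 2 :> R by exact: sqr_ge0.
have E4 := expR_gt0 (- (tpi * t : R)).
move: (expR (tpi * t)) (expR (- (tpi * t))) (expR (- (tpi * b))) E1 E2 E3 E4.
move=> A B D AD BA A0 B0 sq.
(* With A B = 1 this reads 1 - B <= A - 1, which reduces the lower half-plane to the bound of the
   upper one. *)
have : 0 <= B * (A - 1) ^+ 2 by rewrite mulr_ge0// ltW.
have -> : B * (A - 1) ^+ 2 = B * A * A - 2 * (B * A) + B by ring.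
by rewrite BA; lra.
Qed.

Section Kernel.
Variables (g : C -> C) (s : R) (w0 : C).
Hypotheses (hg : hstrip s g) (w0s : `|complex.Im w0| < s).

Let q w := (g w - g w0) / (ce (w - w0) - 1).

Lemma kernel_cderivable w : `|complex.Im w| < s -> ce (w - w0) != 1 ->
  cderivable q w.
Proof.
move=> ws w1; have [d gw] := hg.1 _ ws.
have D0 : ce (w - w0) - 1 != 0 by rewrite subr_eq0.
eexists; apply: cderivM; first by apply: cderivB gw (cderiv_cst _ _).
apply: (@cderiv_comp R (fun z => z^-1) (fun w => ce (w - w0) - 1)); last exact: cderivV.
apply: cderivB (cderiv_cst _ _); apply: cderiv_shift; exact: cderiv_ce.
Qed.

Lemma kernel_period w : `|complex.Im w| < s -> q (w + 1) = q w.
Proof.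
move=> ws; rewrite /q hg.2//; congr (_ / (_ - 1)).
by rewrite (_ : w + 1 - w0 = w - w0 + 1) ?ceD ?ce1 ?mulr1//; ring.
Qed.

(** The denominator has a simple zero at w0, of derivative 2 i pi, and the numerator is Lipschitz
    there. The singularity of q is thus removable for contour integrals. *)
Lemma kernel_bounded : exists r M : R, 0 < r /\
  forall w, w != w0 -> nm (w - w0) < r -> nm (q w) <= M.
Proof.
have [d gw] := hg.1 _ w0s; have [r1 r10 H1] := cderiv_lip gw.
have p0 := tpi_gt0 R; have p2 : 0 < (tpi : R) / 2 by lra.
have [r2 r20 H2] := cderiv_ce0 p2.
exists (Num.min r1 r2), ((nm d + 1) / (tpi / 2)); split.
  by rewrite lt_min r10.
move=> w ww; rewrite lt_min => /andP[wr1 wr2]; rewrite /q nmM nmV.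
have n0 : 0 < nm (w - w0) by rewrite nm_gt0 subr_eq0.
have lo : tpi / 2 * nm (w - w0) <= nm (ce (w - w0) - 1).
  have := H2 _ wr2; rewrite add0r ce0.
  have := nmB (ce (w - w0) - 1) (ce (w - w0) - 1 - 'i * tpi%:C * (w - w0)).
  rewrite opprB [X in nm X](_ : _ = 'i * tpi%:C * (w - w0)); last by ring.
  by rewrite !nmM nm_i mul1r nmC gtr0_norm//; lra.
have up : nm (g w - g w0) <= (nm d + 1) * nm (w - w0).
  by have := H1 _ wr1; rewrite subrKC.
have lo0 : 0 < tpi / 2 * nm (w - w0) by rewrite mulr_gt0.
rewrite ler_pdivrMr; last exact: lt_le_trans lo.
apply: (le_trans up).
apply: (@le_trans _ _ ((nm d + 1) / (tpi / 2) * (tpi / 2 * nm (w - w0)))).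
  by rewrite mulrA divfK ?gt_eqF.
by rewrite ler_wpM2l// divr_ge0 ?(ltW p2)// addr_ge0// nm_ge0.
Qed.

Lemma kernel_line_neq1 (u y : R) : y != complex.Im w0 -> ce (u +i* y - w0) != 1.
Proof.
move=> yw; apply/eqP => /(congr1 nm); rewrite nm1 nm_ce cImB /= => /esym e1.
have /eqP : - (tpi * (y - complex.Im w0)) = 0 by apply: expR_inj; rewrite -e1 expR0.
by rewrite oppr_eq0 mulf_eq0 gt_eqF ?tpi_gt0//= subr_eq0 (negbTE yw).
Qed.

(* As g - g(w0) = q (e(. - w0) - 1), the coefficients of g telescope in those of
   q, so that the remainder of the Fourier series of g at w0 is given by two
   coefficients of q of order about K.  These are small: q is bounded off the
   line Im w = Im w0, and its contours may be moved across w0. *)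
Lemma fcoef_tele y k : `|y| < s -> y != complex.Im w0 ->
  fcoef g y k = g w0 * (k == 0)%:R + ce (- w0) * fcoef q y (k - 1) - fcoef q y k.
Proof.
move=> ys yw; rewrite /fcoef.
have qc j : ccont (fun u => q (u +i* y) * ce ((- j)%:~R * (u +i* y))) 0 1.
  apply: (@ccont_hline R (fun w => q w * ce ((- j)%:~R * w))) => u _.
  have [d qd] := kernel_cderivable (w := u +i* y) ys (kernel_line_neq1 _ yw).
  by eexists; apply: cderivM qd (cderiv_ceM _ _).
have cc : ccont (fun u => ce ((- k)%:~R * (u +i* y)) : C) 0 1.
  apply: (@ccont_hline R (fun w => ce ((- k)%:~R * w))) => u _.
  by eexists; exact: cderiv_ceM.
rewrite -[X in _ + _ * X - _]/(fcoef q y (k - 1)).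
rewrite -oppr_eq0 -(cint_mode (- k) y) -cint_scale// -cint_scale//.
rewrite -cint_add; [|exact: ccontZ..].
rewrite -cint_sub//; last by apply: ccontD; exact: ccontZ.
congr cint; apply/funext => u; set w := u +i* y.
have w1 : ce (w - w0) - 1 != 0 by rewrite subr_eq0 kernel_line_neq1.
have -> : g w = g w0 + q w * (ce (w - w0) - 1) by rewrite /q divfK// subrKC.
have -> : ce ((- (k - 1))%:~R * w) = ce w * ce ((- k)%:~R * w).
  by rewrite -ceD opprB addrC rmorphD /= mulrDl mul1r addrC.
by rewrite ceD; ring.
Qed.

Lemma kernel_fcoef_shift y1 y2 k : `|y1| < s -> `|y2| < s ->
  y1 < complex.Im w0 < y2 -> fcoef q y1 k = fcoef q y2 k.
Proof.
move=> y1s y2s y12; rewrite /fcoef.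
pose G w := q w * ce ((- k)%:~R * w).
have Gd (u v : R) : `|v| < s -> v != complex.Im w0 -> cderivable G (u +i* v).
  move=> vs vw.
  have [d qd] := kernel_cderivable (w := u +i* v) vs (kernel_line_neq1 _ vw).
  by eexists; apply: cderivM qd (cderiv_ceM _ _).
have vs v : y1 <= v <= y1 + (y2 - y1) -> `|v| < s.
  by move: y1s y2s; rewrite !ltr_norml; lra.
have y2E : y2 = y1 + (y2 - y1) by ring.
have yy : 0 <= y2 - y1 by lra.
suff : cint (fun u => G (u +i* y1)) 0 1 = cint (fun u => G (u +i* y2)) 0 1 by [].
(* The rectangle of width one is centred at Re w0, so that w0 is the only zero of e(w - w0) - 1 in
   it. *)
rewrite y2E; apply: (@mean_eq_contour G (complex.Re w0 - 1 / 2)) => //.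
- have [r [M [r0 qM]]] := kernel_bounded.
  have /cderiv_cont/(_ 1 ltr01)[r' r'0 cM] := @cderiv_ceM R (- k)%:~R w0.
  apply: (@goursat_removable R G _ _ _ _ (complex.Re w0) (complex.Im w0)
    (M * (nm (ce ((- k)%:~R * w0)) + 1)) (Num.min r r')).
  + by lra.
  + by rewrite subrKC.
  + by rewrite lt_min r0.
  + move=> u v ux vy vw; rewrite /G.
    have c1 : ce (u +i* v - w0) != 1.
      apply/eqP => E1.
      have uw : `|u - complex.Re w0| <= 1 / 2 by rewrite ler_norml; lra.
      have E2 : u +i* v - w0 = (u - complex.Re w0) +i* (v - complex.Im w0).
        by apply: complex_eq; rewrite ?cReB ?cImB.
      rewrite E2 in E1; have [/eqP ua /eqP vb] := ce_eq1 uw E1.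
      by move: vw; rewrite eq_complex /= -subr_eq0 ua -(subr_eq0 v) vb.
    have [d qd] := kernel_cderivable (w := u +i* v) (vs _ vy) c1.
    by eexists; apply: cderivM qd (cderiv_ceM _ _).
  + have -> : complex.Re w0 +i* complex.Im w0 = w0 by case: (w0).
    move=> w ww; rewrite lt_min => /andP[wr wr']; rewrite /G nmM.
    have ba : nm (ce ((- k)%:~R * w)) <= nm (ce ((- k)%:~R * w0)) + 1.
      rewrite -{1}[ce (_ * w)](subrKC (ce ((- k)%:~R * w0))) (le_trans (nmD _ _))//.
      by rewrite lerD2l ltW//; have := cM _ wr'; rewrite subrKC.
    by apply: ler_pM => //; rewrite ?nm_ge0// qM.
- by move=> u; apply: Gd => //; lra.
- by move=> u; rewrite -y2E; apply: Gd => //; lra.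
- move=> u v vy; rewrite pointD1 /G kernel_period ?ce_period//; exact: vs.
Qed.

(** Two end terms of the telescoping sum survive. The one of index K is read on the line Im w = -
    s1, the one of index - K - 1 on Im w = s1; both lines are at distance at least t from w0, where
    |q| <= 2 M / D, and each term contributes 4 M / D. *)
Lemma fourier_inversion s1 t M K : 0 < t -> s1 < s ->
  `|complex.Im w0| <= s1 - t -> (forall w, `|complex.Im w| < s -> nm (g w) <= M) ->
  nm (g w0 - \sum_(j < K.*2.+1) fcoef g 0 (j%:Z - K%:Z) * ce ((j%:Z - K%:Z)%:~R * w0))
    <= 8 * M / (1 - expR (- (tpi * t))) * expR (- (tpi * K%:R * t)).
Proof.
move=> t0 s1s w0t gM.
have p0 := tpi_gt0 R.
have s10 : 0 < s1 by have := normr_ge0 (complex.Im w0); lra.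
have s1s' : `|s1| < s by rewrite gtr0_norm.
have Ns1s : `|- s1| < s by rewrite normrN.
have /andP[wl wr] : - (s1 - t) <= complex.Im w0 <= s1 - t by rewrite -ler_norml.
have M0 : 0 <= M by rewrite (le_trans (nm_ge0 _) (gM w0 w0s)).
have D0 : 0 < 1 - expR (- (tpi * t)) :> R.
  by rewrite subr_gt0 -expR0 ltr_expR oppr_lt0 mulr_gt0.
set D := 1 - _ in D0 *.
pose T (k : int) := fcoef q (- s1) k * ce (k%:~R * w0).
have term k : fcoef g 0 k * ce (k%:~R * w0) =
    g w0 * (k == 0)%:R + (T (k - 1) - T k).
  have s0 : 0 < s by lra.
  rewrite (@fcoef_shift s g 0 (- s1))// ?normr0// fcoef_tele//; last first.
    by rewrite lt_eqF//; lra.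
  rewrite mulrBl mulrDl /T addrA; congr (_ + _ - _).
    by have [->|_] := eqVneq k 0; rewrite ?mul0r ?ce0 ?mulr1// mulr0 mul0r.
  rewrite mulrAC mulrC -ceD; congr (_ * ce _); rewrite rmorphB /=; ring.
have -> : \sum_(j < K.*2.+1) fcoef g 0 (j%:Z - K%:Z) * ce ((j%:Z - K%:Z)%:~R * w0) =
    g w0 + T (- K%:Z - 1) - T K%:Z.
  under eq_bigr do rewrite term.
  rewrite big_split /= -addrA; congr (_ + _).
    have lt : (K < K.*2.+1)%N by rewrite ltnS -addnn leq_addr.
    rewrite (bigD1 (Ordinal lt))//= subrr eqxx mulr1 big1 ?addr0// => i iK.
    rewrite subr_eq0 [_ == _](_ : _ = false) ?mulr0//.
    by apply: contraNF iK => /eqP[iK]; apply/eqP/val_inj.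
  rewrite -(big_mkord xpredT (fun j => T (j%:Z - K%:Z - 1) - T (j%:Z - K%:Z))).
  rewrite (@telescope_sumr_eq _ 0 K.*2.+1 (fun j => - T (j%:Z - K%:Z - 1)))//.
    have -> : K.*2.+1%:Z - K%:Z - 1 = K%:Z by rewrite -addnn -addn1 !PoszD; ring.
    by rewrite sub0r opprK addrC.
  move=> i _; have -> : i.+1%:Z - K%:Z - 1 = i%:Z - K%:Z.
    by rewrite -addn1 PoszD; ring.
  by rewrite opprK addrC.
have -> : g w0 - (g w0 + T (- K%:Z - 1) - T K%:Z) = T K%:Z - T (- K%:Z - 1) by ring.
have qd y (u : R) : `|y| < s -> y != complex.Im w0 -> cderivable q (u +i* y).
  by move=> ys yw; apply: kernel_cderivable => //; exact: kernel_line_neq1.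
have qb y (u : R) : `|y| < s -> t <= `|y - complex.Im w0| ->
    nm (q (u +i* y)) <= 2 * M / D.
  move=> ys ty; rewrite /q nmM nmV.
  have lo : D <= nm (ce (u +i* y - w0) - 1).
    by apply: nm_ce_sub1; [exact: ltW|rewrite cImB].
  rewrite ler_pM ?nm_ge0// ?invr_ge0 ?nm_ge0//.
    by rewrite (le_trans (nmB _ _))//; have := gM w0 w0s; have := gM (u +i* y) ys; lra.
  by rewrite lef_pV2// posrE (lt_le_trans D0).
have nmc k : nm (ce (k%:~R * w0)) = expR (- (tpi * k%:~R * complex.Im w0)).
  rewrite nm_ce; have -> : k%:~R = (k%:~R : R)%:C :> C by rewrite rmorph_int.
  by rewrite cImM /= mul0r addr0 mulrA.
have E0 := expR_gt0 (- (tpi * K%:R * t) : R).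
have MD : 0 <= 2 * M / D by rewrite divr_ge0 ?(ltW D0)//; lra.
have b1 : nm (T K%:Z) <= 4 * M / D * expR (- (tpi * K%:R * t)).
  rewrite /T nmM nmc.
  apply: (@le_trans _ _ (2 * (2 * M / D) * expR (tpi * K%:Z%:~R * - s1) *
    expR (- (tpi * K%:Z%:~R * complex.Im w0)))).
    rewrite ler_pM2r ?expR_gt0//; apply: fcoef_bound => u.
      by apply: qd => //; rewrite lt_eqF//; lra.
    by apply: qb => //; rewrite ltr0_norm; lra.
  rewrite -mulrA -expRD [2 * (2 * M / D)](_ : _ = 4 * M / D); last by ring.
  rewrite ler_wpM2l ?ler_expR//; first by rewrite divr_ge0 ?(ltW D0)//; lra.
  rewrite -[K%:Z%:~R]/(K%:R) mulrN -opprD lerN2 -mulrDr ler_wpM2l//; last lra.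
  by rewrite mulr_ge0// ltW.
have b2 : nm (T (- K%:Z - 1)) <= 4 * M / D * expR (- (tpi * K%:R * t)).
  rewrite /T (@kernel_fcoef_shift (- s1) s1)//; last by lra.
  rewrite nmM nmc.
  set k1 := (- K%:Z - 1)%:~R.
  have k1E : k1 = - (K%:R + 1) :> R by rewrite /k1 rmorphB rmorphN /=; ring.
  apply: (@le_trans _ _ (2 * (2 * M / D) * expR (tpi * k1 * s1) *
    expR (- (tpi * k1 * complex.Im w0)))).
    rewrite ler_pM2r ?expR_gt0//; apply: fcoef_bound => u.
      by apply: qd => //; rewrite gt_eqF//; lra.
    by apply: qb => //; rewrite gtr0_norm; lra.
  rewrite -mulrA -expRD [2 * (2 * M / D)](_ : _ = 4 * M / D); last by ring.
  rewrite ler_wpM2l ?ler_expR//; first by rewrite divr_ge0 ?(ltW D0)//; lra.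
  rewrite k1E.
  have -> : tpi * - (K%:R + 1) * s1 - tpi * - (K%:R + 1) * complex.Im w0 =
    - (tpi * ((K%:R + 1) * (s1 - complex.Im w0))) by ring.
  rewrite lerN2 -mulrA ler_pM2l//.
  have K0 : 0 <= K%:R :> R by [].
  apply: (@le_trans _ _ ((K%:R + 1) * t)); first by rewrite mulrDl lerDl mul1r ltW.
  by rewrite ler_wpM2l//; lra.
apply: (le_trans (nmB _ _)); move: b1 b2; rewrite -!mulrA.
by move: (D^-1 * _) => Q; lra.
Qed.

End Kernel.

End Fourier.

(** * Derivatives and mean value inequalities for complex curves of a real parameter *)

Section RealDerivative.
Variable R : realType.
Local Notation C := R[i].
Implicit Types (phi : R -> C) (x a b : R) (d : C).

Definition rderiv phi x d := forall e : R, 0 < e -> exists2 r : R, 0 < r &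
  forall h : R, `|h| < r -> nm (phi (x + h) - phi x - d * h%:C) <= e * `|h|.

Lemma cderiv_rderiv (g : C -> C) (z v : C) x d : cderiv g (z + v * x%:C) d ->
  rderiv (fun u => g (z + v * u%:C)) x (d * v).
Proof.
move=> gd; have : cderiv (fun w => g (z + v * w)) x%:C (d * v).
  apply: (@cderiv_comp R g (fun w => z + v * w)) => //.
  have := cderivD (cderiv_cst z x%:C) (cderivZ v (cderiv_id x%:C)).
  by rewrite add0r mulr1.
move=> H e /H[r r0 Hr]; exists r => // h hr.
by have := Hr h%:C; rewrite nmC rmorphD /= => /(_ hr).
Qed.

Lemma real_derive_of_eps (f : R -> R) x (d : R) :
  (forall e : R, 0 < e -> exists2 r : R, 0 < r &
     forall h : R, `|h| < r -> `|f (x + h) - f x - d * h| <= e * `|h|) ->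
  is_derive x (1 : R) f d.
Proof.
move=> H; apply/is_derive_epsP => e /H[r r0 Hr]; exists r => // h /Hr.
by rewrite [h *: 1]mulr1 [h *: d]mulrC [h + x]addrC.
Qed.

Lemma rderiv_Re phi x d : rderiv phi x d ->
  is_derive x (1 : R) (fun u => complex.Re (phi u)) (complex.Re d).
Proof.
move=> H; apply: real_derive_of_eps => e /H[r r0 Hr]; exists r => // h /Hr.
apply: le_trans; have -> : complex.Re d * h = complex.Re (d * h%:C).
  by rewrite cReM /= mulr0 subr0.
by rewrite -!cReB nm_Re.
Qed.

Lemma rderiv_Im phi x d : rderiv phi x d ->
  is_derive x (1 : R) (fun u => complex.Im (phi u)) (complex.Im d).
Proof.
move=> H; apply: real_derive_of_eps => e /H[r r0 Hr]; exists r => // h /Hr.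
apply: le_trans; have -> : complex.Im d * h = complex.Im (d * h%:C).
  by rewrite cImM /= mulr0 add0r.
by rewrite -!cImB nm_Im.
Qed.

Lemma real_mvt (f df : R -> R) a b (B : R) : a <= b ->
  (forall x, a <= x <= b -> is_derive x (1 : R) f (df x)) ->
  (forall x, a <= x <= b -> `|df x| <= B) -> `|f b - f a| <= B * (b - a).
Proof.
move=> ab fd fB.
have fd' x : x \in `]a, b[ -> is_derive x (1 : R) f (df x).
  by rewrite in_itv/= => /andP[xa xb]; apply: fd; rewrite !ltW.
have fc : {within `[a, b], continuous f}.
  apply: derivable_within_continuous => x; rewrite in_itv/= => /fd[].
  by [].
have [c] := MVT_segment ab fd' fc; rewrite in_itv/= => cab ->.
by rewrite normrM [`|b - a|]ger0_norm ?subr_ge0// ler_wpM2r ?subr_ge0// fB.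
Qed.

Lemma complex_mvt phi a b (B : R) : a <= b ->
  (forall x, a <= x <= b -> exists2 d, rderiv phi x d & nm d <= B) ->
  nm (phi b - phi a) <= 2 * B * (b - a).
Proof.
move=> ab H; have /choice[df Hdf] : forall x, exists d,
    a <= x <= b -> rderiv phi x d /\ nm d <= B.
  move=> x; have [xab|nxab] := pselect (a <= x <= b); last by exists 0.
  by have [d h1 h2] := H x xab; exists d.
rewrite (le_trans (nm_le_ReIm _))// cReB cImB.
have h1 : `|complex.Re (phi b) - complex.Re (phi a)| <= B * (b - a).
  apply: (@real_mvt (fun u => complex.Re (phi u)) (fun u => complex.Re (df u))) => //.
    by move=> x /Hdf[/rderiv_Re].
  by move=> x /Hdf[_]; apply: le_trans; exact: nm_Re.
have h2 : `|complex.Im (phi b) - complex.Im (phi a)| <= B * (b - a).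
  apply: (@real_mvt (fun u => complex.Im (phi u)) (fun u => complex.Im (df u))) => //.
    by move=> x /Hdf[/rderiv_Im].
  by move=> x /Hdf[_]; apply: le_trans; exact: nm_Im.
by lra.
Qed.

(** Only real increments are tested: a complex derivative is determined by any one direction. *)
Lemma cderiv_le_lip (phi : C -> C) d (B r : R) : cderiv phi 0 d -> 0 < r ->
  (forall x, `|x| < r -> nm (phi x%:C - phi 0) <= B * `|x|) -> nm d <= B.
Proof.
move=> H r0 HB; rewrite -subr_le0; apply: le0_eps => e /H[r' r'0 Hr].
pose x := Num.min r r' / 2.
have m0 : 0 < Num.min r r' by rewrite lt_min r0.
have x0 : 0 < x by rewrite /x; lra.
have xr : `|x| < r.
  by rewrite gtr0_norm// (@lt_le_trans _ _ (Num.min r r')) ?ge_min ?lexx// /x; lra.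
have xr' : nm x%:C < r'.
  rewrite nmC gtr0_norm// (@lt_le_trans _ _ (Num.min r r')) ?ge_min ?lexx ?orbT//.
  by rewrite /x; lra.
have := HB x xr; have := Hr _ xr'; rewrite add0r nmC gtr0_norm// => h1 h2.
have := nmB (phi x%:C - phi 0) (phi x%:C - phi 0 - d * x%:C).
rewrite opprB subrKC nmM nmC gtr0_norm// => h3.
have : nm d * x <= (B + e) * x by rewrite mulrDl; lra.
by rewrite ler_pM2r//; lra.
Qed.

End RealDerivative.

(** * Discretised Fourier coefficients, Lipschitz and Cauchy estimates *)

Section SymmetricSums.
Variable R : realType.

Definition sidx (K : nat) (j : 'I_(K.*2.+1)) : int := (j : nat)%:Z - K%:Z.

Lemma sidx_le K (j : 'I_(K.*2.+1)) : (absz (sidx j) <= K)%N.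
Proof.
rewrite /sidx; have := ltn_ord j; rewrite ltnS => jK.
have [h|h] := leqP K j.
  by rewrite subzn// absz_nat leq_subLR addnn.
by rewrite distnC subzn ?(ltnW h)// absz_nat leq_subr.
Qed.

Lemma sum_sidx_geom K (q : R) :
  (\sum_(j < K.*2.+1) q ^+ absz (sidx j)) * (1 - q) = 1 + q - 2 * q ^+ K.+1.
Proof.
pose F K (j : nat) := q ^+ absz (j%:Z - K%:Z).
have -> : \sum_(j < K.*2.+1) q ^+ absz (sidx j) = \sum_(0 <= j < K.*2.+1) F K j.
  by rewrite big_mkord.
elim: K => [|K IH]; first by rewrite big_nat1 /F subr0 expr0 expr1; ring.
have FK j : F K.+1 j.+1 = F K j.
  by rewrite /F -[j.+1]addn1 -[K.+1]addn1 !PoszD opprD addrACA subrr addr0.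
have F0 : F K.+1 0%N = q ^+ K.+1 by rewrite /F sub0r abszN absz_nat.
have F2 : F K.+1 K.*2.+2 = q ^+ K.+1.
  have -> : K.*2.+2 = (K.+1 + K.+1)%N by rewrite addSnnS -addnn !addnS.
  by rewrite /F PoszD addrK absz_nat.
rewrite doubleS big_nat_recl// F0; under eq_bigr do rewrite FK.
rewrite big_nat_recr//= -FK F2 [q ^+ K.+2]exprS.
rewrite [(_ + (_ + _)) * _]mulrDl [(_ + _) * (1 - q)]mulrDl IH; ring.
Qed.

Lemma sum_sidx_le K (q : R) : 0 <= q < 1 ->
  \sum_(j < K.*2.+1) q ^+ absz (sidx j) <= 2 / (1 - q).
Proof.
move=> /andP[q0 q1]; rewrite ler_pdivlMr ?subr_gt0// sum_sidx_geom.
by have := exprn_ge0 K.+1 q0; lra.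
Qed.

End SymmetricSums.

(** Lipschitz constant on the real axis of a function bounded by 1 on the strip of half-width s. The
    32 is 2 (coefficients) times 2 ([ce_lip]) times 4 (from tpi n q^n <= 4 / s) times 2 (geometric
    sum). *)
HB.lock Definition lipc (R : realType) (s : R) : R :=
  32 / s / (1 - expR (- (tpi * (s / 4)))).
Arguments lipc {R} s.

(** The first term is the constant of [fourier_inversion] for t = s / 4; the 3 is 2 for a Fourier
    coefficient plus 1 for its discretisation. *)
HB.lock Definition apc (R : realType) (s : R) : R :=
  8 / (1 - expR (- (tpi * (s / 4)))) + 3.
Arguments apc {R} s.

(** Constant of the Cauchy inequality below, not optimised: ln 2 / tpi is the half-width of the
    strip where |e(w)| < 2, and 4 / tpi comes from the speed rho tpi / 4 along the circle. *)
HB.lock Definition cauchyc (R : realType) : R := 4 * lipc (ln 2 / tpi) / tpi.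
Arguments cauchyc {R}.

Section Discretization.
Variable R : realType.
Local Notation C := R[i].
Implicit Types (g : C -> C) (k : int) (s M x : R) (K N : nat).

Definition sbound s g M := forall w, `|complex.Im w| < s -> nm (g w) <= M.

(** The coefficient is read at height - s1 or s1 according to the sign of k. *)
Lemma fcoef_decay s s1 g M k : hstrip s g -> sbound s g M -> 0 <= s1 < s ->
  nm (fcoef g 0 k) <= 2 * M * expR (- (tpi * s1)) ^+ absz k.
Proof.
move=> hg gM /andP[s10 s1s].
have s0 : 0 < s by lra.
have key (y : R) : `|y| < s -> nm (fcoef g 0 k) <= 2 * M * expR (tpi * k%:~R * y).
  move=> ys; rewrite (fcoef_shift _ hg (y2 := y)) ?normr0//.
  by apply: fcoef_bound => u; [exact: hg.1|exact: gM].
rewrite -expRM_natl; case: k key => n key.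
  have := key (- s1); rewrite normrN ger0_norm// => /(_ s1s).
  rewrite absz_nat (_ : n%:R * - (tpi * s1) = tpi * n%:Z%:~R * - s1)//.
  by rewrite -[n%:Z%:~R]/(n%:R); ring.
have := key s1; rewrite ger0_norm// => /(_ s1s); rewrite NegzE abszN absz_nat.
rewrite (_ : n.+1%:R * - (tpi * s1) = tpi * (- n.+1%:Z)%:~R * s1)//.
by rewrite rmorphN /= -[n.+1%:Z%:~R]/(n.+1%:R); ring.
Qed.

Lemma expRN_lt1 (x : R) : 0 < x -> expR (- x) < 1.
Proof. by move=> x0; rewrite -expR0 ltr_expR oppr_lt0. Qed.

Lemma lipc_gt0 s : 0 < s -> 0 < lipc s.
Proof.
move=> s0; rewrite lipc.unlock divr_gt0 ?divr_gt0// subr_gt0 expRN_lt1//.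
by rewrite mulr_gt0 ?tpi_gt0//; lra.
Qed.

Lemma ce_lip k x x' :
  nm (ce (k%:~R * x%:C) - ce (k%:~R * x'%:C)) <=
  2 * (tpi * (absz k)%:R) * `|x - x'| :> R.
Proof.
wlog xx : x x' / x' <= x.
  move=> H; have [|/ltW] := leP x' x; first exact: H.
  by move=> /H; rewrite nm_distC distrC.
have := @complex_mvt R (fun u => ce (k%:~R * u%:C)) x' x (tpi * (absz k)%:R) xx.
rewrite [`|x - x'|]ger0_norm ?subr_ge0//; apply => u _.
have := @cderiv_rderiv R ce 0 k%:~R u _ (cderiv_ce _).
rewrite add0r => H; exists ('i * tpi%:C * ce (k%:~R * u%:C) * k%:~R).
  by move: H; under [X in rderiv X]eq_fun do rewrite add0r.
have kE : k%:~R = (k%:~R : R)%:C :> C by rewrite rmorph_int.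
rewrite !nmM nm_i mul1r nm_ce kE nmC gtr0_norm ?tpi_gt0// cImM /= mul0r mulr0 addr0.
rewrite mulr0 oppr0 expR0 mulr1 nmC.
by rewrite ler_wpM2l ?(ltW (tpi_gt0 R))// -intr_norm -abszE.
Qed.

(** The coefficients decay like q^(2 |k|) with q = exp(- tpi s / 4): one factor q^|k| absorbs the
    |k| of [ce_lip], the other makes the sum converge. The partial sums are then Lipschitz uniformly
    in K, and they converge to g. *)
Lemma strip_lipschitz s g M x x' : 0 < s -> hstrip s g -> sbound s g M ->
  nm (g x%:C - g x'%:C) <= lipc s * M * `|x - x'|.
Proof.
move=> s0 hg gM; have p0 := tpi_gt0 R.
have M0 : 0 <= M by apply: le_trans (nm_ge0 _) (gM 0 _); rewrite /= normr0.
pose s1 := s / 2; have s1s : 0 <= s1 < s by rewrite /s1; lra.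
pose q := expR (- (tpi * (s / 4))) : R.
have q0 : 0 < q by exact: expR_gt0.
have q1 : q < 1 by rewrite expRN_lt1// mulr_gt0//; lra.
pose D : R := 1 - expR (- (tpi * s1)).
pose S K w0 := \sum_(j < K.*2.+1) fcoef g 0 (sidx j) * ce ((sidx j)%:~R * w0).
have appr K (y : R) : nm (g y%:C - S K y%:C) <= 8 * M / D * expR (- (tpi * K%:R * s1)).
  apply: (@fourier_inversion R g s y%:C hg _ s1 s1) => //.
  - by rewrite /= normr0.
  - by rewrite /s1; lra.
  - by rewrite /s1; lra.
  - by rewrite /= subrr normr0.
have Slip K : nm (S K x%:C - S K x'%:C) <= lipc s * M * `|x - x'|.
  rewrite /S -sumrB (le_trans (nm_sum _ _ _))//.
  apply: (@le_trans _ _ (\sum_(j < K.*2.+1) (16 / s * M * `|x - x'|) * q ^+ absz (sidx j))).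
    apply: ler_sum => j _; rewrite -mulrBr nmM.
    have h1 := fcoef_decay (sidx j) hg gM s1s.
    have h2 := ce_lip (sidx j) x x'.
    apply: (le_trans (ler_pM (nm_ge0 _) (nm_ge0 _) h1 h2)).
    set n := absz _; have qq : expR (- (tpi * s1)) = q * q :> R.
      by rewrite /q -expRD; congr expR; rewrite /s1; field.
    rewrite qq exprMn.
    have h3 : tpi * n%:R * q ^+ n <= 4 / s.
      rewrite /q -expRM_natl mulrN expRN ler_pdivrMr ?expR_gt0//.
      have := expR_ge1Dx (n%:R * (tpi * (s / 4)) : R) => h4.
      apply: (@le_trans _ _ (4 / s * (n%:R * (tpi * (s / 4))))).
        by rewrite le_eqVlt; apply/orP; left; apply/eqP; field; rewrite gt_eqF.
      by rewrite ler_wpM2l ?divr_ge0 ?(ltW s0)//; lra.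
    have -> : 2 * M * (q ^+ n * q ^+ n) * (2 * (tpi * n%:R) * `|x - x'|) =
      (tpi * n%:R * q ^+ n) * (4 * M * `|x - x'| * q ^+ n) by ring.
    have -> : 16 / s * M * `|x - x'| * q ^+ n = 4 / s * (4 * M * `|x - x'| * q ^+ n).
      by ring.
    by rewrite ler_wpM2r// !mulr_ge0// exprn_ge0// ltW.
  rewrite -mulr_sumr.
  have h := @sum_sidx_le R K q ltac:(by rewrite ltW).
  apply: (le_trans (ler_wpM2l _ h)).
    by rewrite !mulr_ge0// invr_ge0 ltW.
  by rewrite le_eqVlt; apply/orP; left; apply/eqP; rewrite lipc.unlock -/q; ring.
rewrite -subr_le0; apply: le0_eps => e e0.
have D0 : 0 < D by rewrite subr_gt0 expRN_lt1// mulr_gt0// /s1; lra.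
have [K HK] : exists K, 8 * M / D * expR (- (tpi * K%:R * s1)) <= e / 2.
  have r1 : expR (- (tpi * s1)) < 1 :> R by rewrite expRN_lt1// mulr_gt0// /s1; lra.
  have A0 : 0 < 8 * M / D + 1.
    by have : 0 <= 8 * M / D; [rewrite divr_ge0 ?(ltW D0)// mulr_ge0|lra].
  have : (fun n => expR (- (tpi * s1)) ^+ n : R) @ \oo --> (0 : R).
    by apply: cvg_expr; rewrite gtr0_norm ?expR_gt0.
  have e2 : 0 < e / 2 / (8 * M / D + 1) by rewrite divr_gt0//; lra.
  move/cvgrPdist_lt => /(_ _ e2)[n _ /(_ n (leqnn _))] /=.
  rewrite sub0r normrN normrX gtr0_norm ?expR_gt0// ltr_pdivlMr// => h; exists n.
  have -> : expR (- (tpi * n%:R * s1)) = expR (- (tpi * s1)) ^+ n :> R.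
    by rewrite -expRM_natl; congr expR; ring.
  apply: le_trans (ltW h); rewrite mulrC ler_wpM2l// ?exprn_ge0 ?expR_ge0//; lra.
have := appr K x; have := appr K x'; have := Slip K => h1 h2 h3.
have : nm (g x%:C - g x'%:C) <= nm (g x%:C - S K x%:C) +
    (nm (S K x%:C - S K x'%:C) + nm (g x'%:C - S K x'%:C)).
  rewrite (le_trans (nm_triB _ _ (S K x%:C)))// lerD2l.
  by rewrite (le_trans (nm_triB _ _ (S K x'%:C)))// lerD2l nm_distC.
by lra.
Qed.

Lemma riemann_sum (phi : R -> C) (L : R) N : (0 < N)%N -> 0 <= L ->
  (forall x x', nm (phi x - phi x') <= L * `|x - x'|) ->
  nm (cint phi 0 1 - N%:R^-1 * \sum_(j < N) phi (j%:R / N%:R)) <= 2 * L / N%:R.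
Proof.
move=> N0 L0 lip; have N0' : 0 < N%:R :> R by rewrite ltr0n.
have phic a b : ccont phi a b.
  move=> x _ e e0; have L1 : 0 < L + 1 by lra.
  exists (e / (L + 1)); first by rewrite divr_gt0.
  move=> y _; rewrite ltr_pdivlMr// => h; apply: le_lt_trans (lip _ _) _.
  by apply: le_lt_trans h; rewrite mulrC ler_wpM2l//; lra.
have key n : nm (cint phi 0 (n%:R / N%:R) -
    N%:R^-1 * \sum_(j < n) phi (j%:R / N%:R)) <= n%:R * (2 * L / N%:R / N%:R).
  elim: n => [|n IH].
    rewrite !mul0r big_ord0 mulr0 subr0.
    have : cint phi 0 0 = 0.
      have := @cint_split R phi 0 0 0 (lexx _) (lexx _) (@phic _ _).
      by move/eqP; rewrite -{1}[cint phi 0 0]addr0 => /eqP/addrI ->.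
    by move=> ->; rewrite nm0.
  have E : n.+1%:R / N%:R = n%:R / N%:R + N%:R^-1 :> R.
    by rewrite -addn1 natrD mulrDl mul1r.
  have i0 : 0 <= N%:R^-1 :> R by rewrite invr_ge0 ltW.
  have n0 : 0 <= n%:R / N%:R :> R by rewrite divr_ge0// ltW.
  rewrite E (@cint_split R phi 0 (n%:R / N%:R))//; last by rewrite lerDl.
  have := @cint_bound R phi (phi (n%:R / N%:R)) (L / N%:R) (n%:R / N%:R)
    (n%:R / N%:R + N%:R^-1) ltac:(by rewrite lerDl) (@phic _ _).
  have -> : n%:R / N%:R + N%:R^-1 - n%:R / N%:R = N%:R^-1 :> R by ring.
  move=> h.
  have {}h := h ltac:(move=> x /andP[x1 x2]; apply: (le_trans (lip _ _));
     rewrite ler_wpM2l// ger0_norm; lra).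
  rewrite big_ord_recr /= mulrDr.
  set I1 := cint _ 0 _ in IH *; set I2 := cint _ _ _ in h *.
  set S1 := _ * \sum_(_ < _) _ in IH *.
  have -> : I1 + I2 - (S1 + N%:R^-1 * phi (n%:R / N%:R)) =
     (I1 - S1) + (I2 - phi (n%:R / N%:R) * (N%:R^-1)%:C).
    have -> : (N%:R^-1)%:C = N%:R^-1 :> C by rewrite fmorphV /= rmorph_nat.
    by ring.
  rewrite (le_trans (nmD _ _))// -[n.+1]addn1 natrD mulrDl mul1r lerD//.
  by rewrite (le_trans h)// !mulrA.
have := key N; rewrite divff ?gt_eqF// [_ * (_ / _ / _)]mulrC divfK ?gt_eqF//.
Qed.

(** Riemann sum of [fcoef] at height 0. As a finite combination of values of g it inherits
    holomorphy in parameters without differentiation under the integral sign. *)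
Definition dcoef N g k : C :=
  N%:R^-1 * \sum_(j < N) g (j%:R / N%:R : R)%:C * ce ((- k)%:~R * (j%:R / N%:R : R)%:C).

Lemma dcoef_fcoef s g M N k : 0 < s -> hstrip s g -> sbound s g M -> (0 < N)%N ->
  nm (fcoef g 0 k - dcoef N g k) <=
    2 * (lipc s * (M * expR (tpi * (absz k)%:R * s))) / N%:R.
Proof.
move=> s0 hg gM N0; have p0 := tpi_gt0 R.
have M0 : 0 <= M by apply: le_trans (nm_ge0 _) (gM 0 _); rewrite /= normr0.
have Gb : sbound s (fun w => g w * ce ((- k)%:~R * w)) (M * expR (tpi * (absz k)%:R * s)).
  case=> u y ys; rewrite nmM nm_ce_mode ler_pM ?nm_ge0 ?expR_ge0 ?gM//.
  rewrite ler_expR -!mulrA ler_pM2l// (le_trans (ler_norm _))// normrM.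
  rewrite -intr_norm -abszE ler_wpM2l ?ler0n//; exact: ltW.
have lip x x' := strip_lipschitz x x' s0 (hstrip_mode (- k) hg) Gb.
have L0 : 0 <= lipc s * (M * expR (tpi * (absz k)%:R * s)).
  exact: mulr_ge0 (ltW (lipc_gt0 s0)) (mulr_ge0 M0 (expR_ge0 _)).
exact: (@riemann_sum (fun x => g x%:C * ce ((- k)%:~R * x%:C)) _ N N0 L0 lip).
Qed.

Lemma apc_ge3 s : 0 < s -> 3 <= apc s.
Proof.
move=> s0; rewrite apc.unlock lerDr divr_ge0// subr_ge0 ltW// expRN_lt1//.
by rewrite mulr_gt0 ?tpi_gt0//; lra.
Qed.

(* The number of nodes is uniform in [g]: this is what makes the coefficients
   of a function of several variables holomorphic in the remaining ones. *)
Lemma discrete_fourier s K : 0 < s -> exists N, forall g M,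
  hstrip s g -> sbound s g M ->
  (forall k, (absz k <= K)%N ->
     nm (dcoef N g k) <= apc s * M * expR (- (tpi * (s / 2))) ^+ absz k) /\
  (forall w, `|complex.Im w| <= s / 4 ->
     nm (g w - \sum_(j < K.*2.+1) dcoef N g (sidx j) * ce ((sidx j)%:~R * w)) <=
       apc s * M * expR (- (tpi * (s / 4))) ^+ K).
Proof.
move=> s0; have p0 := tpi_gt0 R; have l0 := lipc_gt0 s0.
(* N > A leaves on each of the 2 K + 1 coefficients an error M exp(- tpi K s) / (2 K + 1), small
   enough to be multiplied by modes of size exp(tpi K s / 4) and summed. *)
pose A := 2 * lipc s * expR (tpi * K%:R * s) * (K.*2.+1%:R * expR (tpi * K%:R * s)).
have A0 : 0 < A by rewrite /A !mulr_gt0 ?expR_gt0 ?ltr0n.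
have [N AN] : exists N : nat, A < N%:R.
  by exists (Num.bound A); exact: archi_boundP (ltW A0).
have N0' : 0 < N%:R :> R := lt_trans A0 AN.
have N0 : (0 < N)%N by rewrite -(ltr0n R).
exists N => g M hg gM.
have M0 : 0 <= M by apply: le_trans (nm_ge0 _) (gM 0 _); rewrite /= normr0.
have err k : (absz k <= K)%N -> nm (fcoef g 0 k - dcoef N g k) <=
    M * expR (- (tpi * K%:R * s)) / K.*2.+1%:R.
  move=> kK; apply: (le_trans (dcoef_fcoef k s0 hg gM N0)).
  rewrite ler_pdivrMr// expRN.
  have eK : expR (tpi * (absz k)%:R * s) <= expR (tpi * K%:R * s) :> R.
    by rewrite ler_expR ler_pM2r// ler_pM2l// ler_nat.
  apply: (@le_trans _ _ (2 * (lipc s * (M * expR (tpi * K%:R * s))))).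
    by rewrite ler_pM2l// ler_pM2l// ler_wpM2l.
  have e0 := expR_gt0 (tpi * K%:R * s : R).
  have K0 : 0 < K.*2.+1%:R :> R by rewrite ltr0n.
  have -> : 2 * (lipc s * (M * expR (tpi * K%:R * s))) =
     M / expR (tpi * K%:R * s) / K.*2.+1%:R * A.
    by rewrite /A; field; rewrite !gt_eqF.
  by rewrite ler_wpM2l ?(ltW AN)// !divr_ge0// ltW.
have K0 : 0 < K.*2.+1%:R :> R by rewrite ltr0n.
split=> [k kK|w ws].
  have h1 := err k kK.
  have h2 : nm (fcoef g 0 k) <= 2 * M * expR (- (tpi * (s / 2))) ^+ absz k.
    by apply: fcoef_decay hg gM _; lra.
  have h3 : M * expR (- (tpi * K%:R * s)) / K.*2.+1%:R <=
      M * expR (- (tpi * (s / 2))) ^+ absz k.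
    apply: (@le_trans _ _ (M * expR (- (tpi * K%:R * s)))).
      by rewrite ler_pdivrMr// ler_peMr ?mulr_ge0 ?expR_ge0// ler1n.
    rewrite ler_wpM2l// -expRM_natl ler_expR mulrN lerN2.
    rewrite mulrCA -[leRHS]mulrA ler_pM2l// ler_pM ?ler0n//; first lra.
      by rewrite ler_nat.
    by lra.
  have h4 : nm (dcoef N g k) <= nm (fcoef g 0 k) + nm (fcoef g 0 k - dcoef N g k).
    by have := nmB (fcoef g 0 k) (fcoef g 0 k - dcoef N g k); rewrite opprB subrKC.
  have h5 := apc_ge3 s0.
  have h6 : 3 * (M * expR (- (tpi * (s / 2))) ^+ absz k) <=
      apc s * (M * expR (- (tpi * (s / 2))) ^+ absz k).
    by rewrite ler_wpM2r// mulr_ge0// exprn_ge0// expR_ge0.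
  rewrite -mulrA; apply: le_trans h6; apply: (le_trans h4).
  rewrite -mulrA in h2; have := le_trans h1 h3; move: h2.
  by move: (M * expR (- (tpi * (s / 2))) ^+ _) => z; lra.
have wlt : `|complex.Im w| < s by apply: (le_lt_trans ws); lra.
have h1 := @fourier_inversion R g s w hg wlt (s / 2) (s / 4) M K
  ltac:(lra) ltac:(lra) ltac:(by apply: (le_trans ws); lra) gM.
have eE : expR (- (tpi * K%:R * (s / 4))) = expR (- (tpi * (s / 4))) ^+ K :> R.
  by rewrite -expRM_natl; congr expR; ring.
rewrite eE in h1; set Q := expR _ ^+ K in h1 *.
have Q0 : 0 <= Q by rewrite exprn_ge0// expR_ge0.
pose S := \sum_(j < K.*2.+1) fcoef g 0 (sidx j) * ce ((sidx j)%:~R * w).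
pose S' := \sum_(j < K.*2.+1) dcoef N g (sidx j) * ce ((sidx j)%:~R * w).
have h2 : nm (S - S') <= M * Q.
  rewrite /S /S' -sumrB (le_trans (nm_sum _ _ _))//.
  apply: (@le_trans _ _ (\sum_(j < K.*2.+1) M * Q / K.*2.+1%:R)); last first.
    rewrite sumr_const card_ord -[_ *+ K.*2.+1]mulr_natr divfK// gt_eqF//.
  apply: ler_sum => j _; rewrite -mulrBl nmM.
  have b1 : nm (ce ((sidx j)%:~R * w)) <= expR (tpi * K%:R * (s / 4)).
    rewrite nm_ce; have -> : (sidx j)%:~R = ((sidx j)%:~R : R)%:C :> C by rewrite rmorph_int.
    rewrite cImM /= mul0r addr0 ler_expR (le_trans (ler_norm _))// normrN !normrM.
    rewrite gtr0_norm// -mulrA ler_pM2l// ler_pM//.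
    by rewrite -intr_norm -abszE ler_nat sidx_le.
  apply: (le_trans (ler_pM (nm_ge0 _) (nm_ge0 _) (err _ (sidx_le j)) b1)).
  have b2 : expR (- (tpi * K%:R * s)) * expR (tpi * K%:R * (s / 4)) <= Q.
    rewrite /Q -eE -expRD ler_expR.
    have : 0 <= tpi * K%:R * s :> R by rewrite !mulr_ge0// ltW.
    by rewrite !mulrA; move: (tpi * K%:R * s) => z; lra.
  have b3 : M * (expR (- (tpi * K%:R * s)) * expR (tpi * K%:R * (s / 4))) <= M * Q.
    by apply: ler_wpM2l.
  rewrite mulrAC; apply: ler_wpM2r; first by rewrite invr_ge0 ltW.
  by apply: le_trans b3; rewrite [leRHS]mulrA.
rewrite -/S'; have -> : g w - S' = (g w - S) + (S - S') by ring.
rewrite (le_trans (nmD _ _))//.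
have h3 : 0 <= M * Q by rewrite mulr_ge0.
rewrite apc.unlock; move: h1; rewrite -/S.
have -> : 8 * M / (1 - expR (- (tpi * (s / 4)))) * Q =
  8 / (1 - expR (- (tpi * (s / 4)))) * (M * Q) by ring.
have -> : (8 / (1 - expR (- (tpi * (s / 4)))) + 3) * M * Q =
  8 / (1 - expR (- (tpi * (s / 4)))) * (M * Q) + 3 * (M * Q) by ring.
by move: (_ / _ * (M * Q)) => z; lra.
Qed.

Lemma cauchyc_gt0 : 0 < cauchyc :> R.
Proof.
by rewrite cauchyc.unlock divr_gt0 ?tpi_gt0// mulr_gt0// lipc_gt0// divr_gt0 ?tpi_gt0// ln_gt0// ltr1n.
Qed.

(* On the circle z - rho/4 + (rho/4) e(w), w real, which passes through z, the
   derivative is read off the Lipschitz constant of a periodic function. *)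
Lemma cauchy_estimate g (z d : C) (rho M : R) : 0 < rho ->
  (forall w, nm (w - z) < rho -> cderivable g w) ->
  (forall w, nm (w - z) < rho -> nm (g w) <= M) ->
  cderiv g z d -> nm d <= cauchyc * M / rho.
Proof.
move=> rho0 gd gM gz; have p0 := tpi_gt0 R.
pose s := ln 2 / tpi : R; have l2 : 0 < ln 2 :> R by rewrite ln_gt0// ltr1n.
have s0 : 0 < s by rewrite divr_gt0.
pose a := (rho / 4)%:C : C.
pose phi w := g (z - a + a * ce w).
have dom w : `|complex.Im w| < s -> nm (z - a + a * ce w - z) < rho.
  move=> ws; have -> : z - a + a * ce w - z = a * (ce w - 1) by ring.
  rewrite nmM nmC gtr0_norm; last by lra.
  have h : nm (ce w - 1) <= nm (ce w) + 1 by have := nmB (ce w) 1; rewrite nm1.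
  have : nm (ce w) < 2.
    rewrite nm_ce -[ltRHS]lnK ?posrE// ltr_expR -mulrN mulrC -ltr_pdivlMr//.
    by rewrite (le_lt_trans (ler_norm _))// normrN.
  move=> h2; have : rho / 4 * nm (ce w - 1) <= rho / 4 * 3 by rewrite ler_pM2l; lra.
  lra.
have phid w d' : cderiv g (z - a + a * ce w) d' ->
    cderiv phi w (d' * (a * ('i * tpi%:C * ce w))).
  move=> gw; apply: (@cderiv_comp R g (fun w => z - a + a * ce w)) => //.
  have := cderivD (cderiv_cst (z - a) w) (cderivZ a (cderiv_ce w)).
  by rewrite add0r.
have hphi : hstrip s phi.
  split=> w ws; last by rewrite /phi ceD ce1 mulr1.
  by have [d' gd'] := gd _ (dom w ws); eexists; exact: phid gd'.
have bphi : sbound s phi M by move=> w ws; exact: gM (dom w ws).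
have z0 : z - a + a * ce 0 = z by rewrite ce0; ring.
have D0 : cderiv phi 0 (d * (a * ('i * tpi%:C * ce 0))) by apply: phid; rewrite z0.
have := cderiv_le_lip (B := lipc s * M) D0 (ltr01 : 0 < 1 :> R) (fun x _ =>
  ltac:(by have := strip_lipschitz x 0 s0 hphi bphi; rewrite subr0)).
rewrite ce0 mulr1 !nmM nm_i mul1r !nmC !gtr0_norm//; last by lra.
move=> h; rewrite ler_pdivlMr// cauchyc.unlock -/s.
rewrite [4 * _ / _ * M]mulrAC ler_pdivlMr//.
have -> : nm d * rho * tpi = 4 * (nm d * (rho / 4 * tpi)) by field.
by rewrite -[leRHS]mulrA ler_pM2l.
Qed.

End Discretization.

(** * Solvability of the homological equations *)

Section Leibniz.
Variables (K : numFieldType) (W : lmodType K) (B : W -> W -> W) (D : W -> W).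
Hypotheses (BDl : forall x y z, B (x + y) z = B x z + B y z)
  (BDr : forall x y z, B x (y + z) = B x y + B x z)
  (BZl : forall c x y, B (c *: x) y = c *: B x y)
  (BZr : forall c x y, B x (c *: y) = c *: B x y)
  (DD : forall x y, D (x + y) = D x + D y)
  (DZ : forall c x, D (c *: x) = c *: D x)
  (DB : forall x y, D (B x y) = B (D x) y + B x (D y)).

(** The terms D^k / k! of exp(D); in this normalisation the Leibniz rule has no binomial
    coefficients. *)
Definition divpow k x : W := (k`!%:R)^-1 *: iter k D x.

Lemma divpowS k x : D (divpow k x) = k.+1%:R *: divpow k.+1 x.
Proof.
rewrite /divpow DZ scalerA factS natrM invfM mulrA divff ?mul1r// pnatr_eq0.
Qed.

Lemma bilin_suml n (F : 'I_n -> W) y : B (\sum_(i < n) F i) y = \sum_(i < n) B (F i) y.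
Proof.
apply: (big_morph (fun x => B x y)); first by move=> *; exact: BDl.
by have := BZl 0 0 y; rewrite !scale0r.
Qed.

Lemma bilin_sumr n (F : 'I_n -> W) x : B x (\sum_(i < n) F i) = \sum_(i < n) B x (F i).
Proof.
apply: (big_morph (fun y => B x y)); first by move=> *; exact: BDr.
by have := BZr 0 x 0; rewrite !scale0r.
Qed.

Lemma lin_sum n (F : 'I_n -> W) : D (\sum_(i < n) F i) = \sum_(i < n) D (F i).
Proof. by apply: big_morph => //; have := DZ 0 0; rewrite !scale0r. Qed.

(** Applying D to the rule at order k gives the term (p, k + 1 - p) the coefficients p and k + 1 -
    p, whose sum k + 1 cancels the factor of [divpowS]. *)
Lemma leibniz k x y : divpow k (B x y) =
  \sum_(p < k.+1) B (divpow p x) (divpow (k - p) y).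
Proof.
elim: k => [|k IH].
  by rewrite big_ord_recl big_ord0 addr0 /divpow /= fact0 invr1 !scale1r.
have k0 : k.+1%:R != 0 :> K by rewrite pnatr_eq0.
apply: (scalerI k0); rewrite -divpowS IH lin_sum.
under eq_bigr do rewrite DB !divpowS BZl BZr.
rewrite big_split /=.
rewrite [X in X + _](_ : _ = \sum_(p < k.+2) p%:R *: B (divpow p x) (divpow (k.+1 - p) y)).
  rewrite [X in _ + X](_ : _ = \sum_(p < k.+2) (k.+1 - p)%:R *:
      B (divpow p x) (divpow (k.+1 - p) y)).
    rewrite -big_split /= scaler_sumr; apply: eq_bigr => p _.
    by rewrite -scalerDl -natrD subnKC// -ltnS.
  rewrite [RHS]big_ord_recr /= subnn scale0r addr0; apply: eq_bigr => p _.
  by rewrite subSn// -ltnS.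
rewrite [RHS]big_ord_recl /= scale0r add0r; apply: eq_bigr => p _.
by rewrite /bump /= add1n subSS.
Qed.

Lemma triangular_sum (X : nat -> nat -> W) S :
  \sum_(k < S) \sum_(p < k.+1) X p (k - p)%N = \sum_(p < S) \sum_(q < S - p) X p q.
Proof.
elim: S => [|S IH]; first by rewrite !big_ord0.
rewrite big_ord_recr /= IH [RHS]big_ord_recr /= subSnn big_ord1.
rewrite [X in _ + X]big_ord_recr /= subnn addrA; congr (_ + _).
rewrite -big_split /=; apply: eq_bigr => p _.
by rewrite [in RHS]subSn ?(ltnW (ltn_ord p))// big_ord_recr.
Qed.

End Leibniz.

Section FormalSolvability.
Variables (K : numFieldType) (V : lmodType K) (br : V -> V -> V).
Hypotheses (brDl : forall x y z, br (x + y) z = br x z + br y z)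
  (brDr : forall x y z, br x (y + z) = br x y + br x z)
  (brZl : forall c x y, br (c *: x) y = c *: br x y)
  (brZr : forall c x y, br x (c *: y) = c *: br x y)
  (jacobi : forall x y z, br x (br y z) = br (br x y) z + br y (br x z)).

Local Notation W := (nat -> V).
Implicit Types (F G : W).

Let br0l y : br 0 y = 0. Proof. by have := brZl 0 0 y; rewrite !scale0r. Qed.
Let br0r x : br x 0 = 0. Proof. by have := brZr 0 x 0; rewrite !scale0r. Qed.

(** Elements of W are formal power series in one parameter with coefficients in V, and this is the
    bracket extended to them. *)
Definition conv F G : W := fun s => \sum_(j < s.+1) br (F (s - j)%N) (G j).

Lemma convDl F F' G : conv (F + F') G = conv F G + conv F' G.
Proof.
apply/funext => s; rewrite /conv [RHS]/GRing.add /= -big_split /=.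
by apply: eq_bigr => j _; rewrite -brDl.
Qed.

Lemma convDr F G G' : conv F (G + G') = conv F G + conv F G'.
Proof.
apply/funext => s; rewrite /conv [RHS]/GRing.add /= -big_split /=.
by apply: eq_bigr => j _; rewrite -brDr.
Qed.

Lemma convZl c F G : conv (c *: F) G = c *: conv F G.
Proof.
apply/funext => s; rewrite /conv [RHS]/GRing.scale /= scaler_sumr.
by apply: eq_bigr => j _; rewrite -brZl.
Qed.

Lemma convZr c F G : conv F (c *: G) = c *: conv F G.
Proof.
apply/funext => s; rewrite /conv [RHS]/GRing.scale /= scaler_sumr.
by apply: eq_bigr => j _; rewrite -brZr.
Qed.

Definition vanish n F := forall i, (i < n)%N -> F i = 0.

Lemma vanish_conv p q F G : vanish p F -> vanish q G -> vanish (p + q) (conv F G).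
Proof.
move=> Fp Gq i ipq; rewrite /conv big1// => j _.
have [jq|qj] := ltnP j q; first by rewrite Gq.
by rewrite Fp// ltn_subLR; [rewrite addnC (leq_trans ipq)// leq_add2l|rewrite -ltnS].
Qed.

Section Flow.
Variables (chi : V) (r : nat).
Hypothesis r0 : (0 < r)%N.

(** The bracket with lambda^r chi, lambda being the formal parameter: a derivation of the bracket of
    series, which raises the order by r. *)
Definition shiftad F : W := fun i => if (r <= i)%N then br chi (F (i - r)%N) else 0.

Lemma shiftadD F G : shiftad (F + G) = shiftad F + shiftad G.
Proof.
apply/funext => i; rewrite /shiftad [RHS]/GRing.add /=.
by case: ifP => _; rewrite ?addr0// -brDr.
Qed.

Lemma shiftadZ c F : shiftad (c *: F) = c *: shiftad F.
Proof.
apply/funext => i; rewrite /shiftad [RHS]/GRing.scale /=.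
by case: ifP => _; rewrite ?scaler0// -brZr.
Qed.

Lemma shiftad_conv F G :
  shiftad (conv F G) = conv (shiftad F) G + conv F (shiftad G).
Proof.
apply/funext => s; rewrite [RHS]/GRing.add /= /shiftad /conv.
case: ifPn => rs; last first.
  rewrite !big1 ?addr0// => j _.
    case: ifPn => // rj; exfalso; move: rs; rewrite (leq_trans rj)//.
    by rewrite -ltnS.
  case: ifPn => // rj; exfalso; move: rs; rewrite (leq_trans rj)//.
  exact: leq_subr.
rewrite (big_morph (br chi) (brDr chi) (br0r chi)).
under eq_bigr do rewrite jacobi; rewrite big_split /=; congr (_ + _).
  rewrite (big_ord_widen_cond s.+1 xpredT (fun j => br (br chi (F (s - r - j)%N)) (G j)));
    last by rewrite ltnS leq_subr.
  rewrite big_mkcond /=; apply: eq_bigr => j _.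
  rewrite ltnS leq_subRL// leq_subRL -1?ltnS// [(r + j)%N]addnC.
  by rewrite ltnS; case: ifP => _; rewrite ?br0l// subnAC.
rewrite -(big_mkord xpredT (fun j => br (F (s - r - j)%N) (br chi (G j)))).
rewrite -(big_mkord xpredT (fun j => br (F (s - j)%N)
  (if (r <= j)%N then br chi (G (j - r)%N) else 0))).
rewrite [RHS](@big_cat_nat _ _ _ r 0 s.+1)//=; last exact: leqW.
rewrite [X in _ = X + _]big_nat [X in _ = X + _]big1 ?add0r; last first.
  by move=> j /andP[_ jr]; rewrite leqNgt jr br0r.
rewrite -[r in RHS]add0n big_addn subSn//; apply: eq_bigr => j _.
by rewrite leq_addl addnK -subnDA addnC.
Qed.

Lemma vanish_shiftad n F : vanish n F -> vanish n.+1 (shiftad F).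
Proof.
move=> Fn i ni; rewrite /shiftad; case: ifP => // ri; rewrite Fn ?br0r//.
by rewrite ltn_subLR// (leq_trans ni)// -add1n leq_add2r.
Qed.

Local Notation dp := (divpow shiftad).

Lemma divpowE k F i : dp k F i = (k`!%:R)^-1 *: iter k shiftad F i.
Proof. by []. Qed.

Lemma vanish_divpow n k F : vanish n F -> vanish (n + k) (dp k F).
Proof.
move=> Fn i ik; rewrite divpowE.
have : vanish (n + k) (iter k shiftad F).
  elim: k {i ik} => [|k IH]; first by rewrite addn0.
  by rewrite addnS; exact: vanish_shiftad.
by move=> /(_ i ik) ->; rewrite scaler0.
Qed.

(** The exponential of [shiftad] cut at S terms. As r > 0, the discarded terms vanish at orders
    below S, the only ones that are used. *)
Definition flow (S : nat) F : W := \sum_(k < S) dp k F.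

Lemma sum_fctE n (X : 'I_n -> W) i : (\sum_(k < n) X k) i = \sum_(k < n) X k i.
Proof. by apply: (big_morph (fun F : W => F i)). Qed.

(** The exponential of a derivation is an automorphism. Truncation is harmless at orders below S,
    where products of terms with p + q >= S vanish. *)
Lemma flow_conv S F G i : (i < S)%N ->
  conv (flow S F) (flow S G) i = flow S (conv F G) i.
Proof.
move=> iS; rewrite /flow.
rewrite (bilin_suml convDl convZl); under eq_bigr do rewrite (bilin_sumr convDr convZr).
under [in RHS]eq_bigr do rewrite (leibniz convZl convZr shiftadD shiftadZ shiftad_conv).
rewrite (triangular_sum (W := nat -> V) (fun p q => conv (dp p F) (dp q G))).
rewrite !sum_fctE; apply: eq_bigr => p _; rewrite !sum_fctE.
rewrite -(big_mkord xpredT (fun q => conv (dp p F) (dp q G) i)).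
rewrite -(big_mkord xpredT (fun q => conv (dp p F) (dp q G) i)).
rewrite (@big_cat_nat _ _ _ (S - p) 0 S)//= ?leq_subr// [X in _ + X]big_nat.
rewrite [X in _ + X]big1 ?addr0// => q /andP[Spq _].
have v0 H : vanish 0 H by [].
apply: (vanish_conv (vanish_divpow (k := p) (v0 F)) (vanish_divpow (k := q) (v0 G))).
by rewrite !add0n (leq_trans iS)// -leq_subLR.
Qed.

(** The leading coefficient of a series is invariant under the flow. Applied to the bracket of P and
    f, it says that an obstruction may be computed after the change of variables. *)
Lemma flow_vanish s F : vanish s F -> flow s.+1 F s = F s.
Proof.
move=> Fs; rewrite /flow sum_fctE big_ord_recl /= big1 ?addr0.
  by rewrite divpowE /= fact0 invr1 scale1r.
by move=> k _; apply: (vanish_divpow Fs); rewrite /bump /= add1n addnS ltnS leq_addr.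
Qed.

Lemma flow_vanish_lt s F i : vanish s F -> (i < s)%N -> flow s.+1 F i = 0.
Proof.
move=> Fs si; rewrite /flow sum_fctE big1// => k _.
by apply: (vanish_divpow Fs); rewrite (leq_trans si)// leq_addr.
Qed.

Lemma iter_shiftad_lt k F i : (i < r * k)%N -> iter k shiftad F i = 0.
Proof.
elim: k i => [|k IH] i; first by rewrite muln0.
rewrite mulnS /= /shiftad => irk; case: ifP => // ri.
by rewrite IH ?br0r// ltn_subLR.
Qed.

Lemma flow_low S F i : (0 < S)%N -> (i < r)%N -> flow S F i = F i.
Proof.
case: S => // S _ ir; rewrite /flow sum_fctE big_ord_recl /= big1 ?addr0.
  by rewrite divpowE /= fact0 invr1 scale1r.
move=> k _; rewrite divpowE iter_shiftad_lt ?scaler0//.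
by rewrite (leq_trans ir)// leq_pmulr.
Qed.

Lemma flow_at S F : (1 < S)%N -> flow S F r = F r + br chi (F 0%N).
Proof.
case: S => [//|[//|S]] _; rewrite /flow sum_fctE !big_ord_recl /= big1 ?addr0.
  rewrite -[bump 0 0]/1%N !divpowE /= fact0 (_ : 1`! = 1)%N// invr1 !scale1r.
  by rewrite /shiftad leqnn subnn.
move=> k _; rewrite divpowE iter_shiftad_lt ?scaler0//.
by rewrite /bump /= !add1n -[X in (X < _)%N]muln1 ltn_pmul2l.
Qed.

End Flow.

Variable l : V.
Hypotheses (Zabelian : forall x y, br x l = 0 -> br y l = 0 -> br x y = 0)
  (Zsplit : forall x, exists chi, br (x + br chi l) l = 0).

(* The obstruction vanishes: after a formal change of variables bringing [f]
   to normal form modulo order s, a truncated first integral is a function of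
   the actions, which commutes with the normal form. *)
Lemma formal_solvability (f P : nat -> V) s : f 0%N = l ->
  (forall i, (i < s)%N -> conv P f i = 0) -> exists y, conv P f s = br y l.
Proof.
move: f P.
(* When f is in normal form through order s, every P_j with j < s commutes with l by induction,
   hence with the f_i, and the bracket at order s reduces to br (P s) l. *)
have base (r : nat) (f P : nat -> V) : (s < r)%N -> f 0%N = l ->
    (forall j, (0 < j < r)%N -> br (f j) l = 0) ->
    (forall i, (i < s)%N -> conv P f i = 0) -> exists y, conv P f s = br y l.
  move=> rn f0 fZ Pf.
  have convE i : (i <= s)%N -> (forall j, (j < i)%N -> br (P j) l = 0) ->
      conv P f i = br (P i) l.
    move=> is' PZ; rewrite /conv big_ord_recl /= subn0 f0 big1 ?addr0// => j _.
    apply: Zabelian.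
      by apply: PZ; rewrite /bump /= add1n ltn_subrL /= (leq_trans _ (ltn_ord j)).
    apply: fZ; rewrite /bump /= add1n (leq_trans _ rn)//= ltnS.
    by rewrite (leq_trans _ is')// ltn_ord.
  have PZ i : (i <= s)%N -> forall j, (j < i)%N -> br (P j) l = 0.
    elim: i => [//|i IHi] is' j; rewrite ltnS leq_eqVlt => /orP[/eqP ->|].
      by rewrite -convE ?Pf ?(ltnW is')//; apply: IHi; exact: ltnW.
    by apply: IHi; exact: ltnW.
  by exists (P s); apply: convE => //; exact: PZ.
suff key n r : (0 < r)%N -> (s < r + n)%N -> forall f P, f 0%N = l ->
    (forall j, (0 < j < r)%N -> br (f j) l = 0) ->
    (forall i, (i < s)%N -> conv P f i = 0) -> exists y, conv P f s = br y l.
  move=> f P f0 Pf; apply: (key s 1%N) => //.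
  by move=> [|[|j]].
elim: n r => [|n IH] r r0 rn f P f0 fZ Pf.
  by apply: (@base r) => //; rewrite -[r]addn0.
have [sr|rs] := ltnP s r; first exact: (@base r).
(* The flow of chi brings order r to normal form, keeps the lower orders and preserves both the
   equations and the obstruction at order s, so the y found after it serves before it. *)
have [chi chiZ] := Zsplit (f r).
have [] := IH r.+1 isT _ (flow chi r s.+1 f) (flow chi r s.+1 P).
- by rewrite addSnnS.
- by rewrite flow_low.
- move=> j /andP[j0]; rewrite ltnS leq_eqVlt => /orP[/eqP ->|jr].
    by rewrite flow_at ?f0// ltnS (leq_trans r0).
  by rewrite flow_low// fZ// j0.
- move=> i is'; rewrite (flow_conv chi r0 P f (leqW is')).
  exact: (flow_vanish_lt chi r0 Pf).
by move=> y; rewrite (flow_conv chi r0 P f (leqnn _)) (flow_vanish chi r0 Pf); exists y.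
Qed.

End FormalSolvability.

(** * The Poisson algebra of Laurent polynomials *)

Section LinearExtension.
Variables (K : choiceType) (F : fieldType) (W : lmodType F).
Implicit Types (h : K -> W) (p : malg K F).

(** The linear map that sends the monomial of exponent k to h k. The bracket, evaluation,
    projections and the inverse of the homological operator are all of this form. *)
Definition mext h p : W := \sum_(k <- msupp p) mcoeff k p *: h k.

Lemma mextEw (d : finSet K) h p : fsubset (msupp p) d ->
  mext h p = \sum_(k <- d) mcoeff k p *: h k.
Proof.
move=> le; rewrite /mext (big_fset_incl _ le)// => x xd /mcoeff_outdom ->.
by rewrite scale0r.
Qed.

Lemma mextD h p p' : mext h (p + p') = mext h p + mext h p'.
Proof.
pose d := fsetU (msupp p) (msupp p').
rewrite (mextEw _ (msuppD_le p p')) (mextEw _ (fsubsetUl (msupp p) (msupp p'))).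
rewrite (mextEw _ (fsubsetUr (msupp p) (msupp p'))) -big_split /=.
by apply: eq_bigr => k _; rewrite mcoeffD scalerDl.
Qed.

Lemma mextZ h c p : mext h (c *: p) = c *: mext h p.
Proof.
rewrite (mextEw _ (msuppZ_le c p)) scaler_sumr.
by apply: eq_bigr => k _; rewrite mcoeffZ scalerA.
Qed.

Lemma mextU h c k : mext h (mkmalgU k c) = c *: h k.
Proof. by rewrite (mextEw _ (@msuppU_le _ _ k c)) big_seq_fset1 mcoeffUU. Qed.

Lemma mext_eq h h' p : {in msupp p, h =1 h'} -> mext h p = mext h' p.
Proof.
by move=> hh; rewrite /mext big_seq [RHS]big_seq; apply: eq_bigr => k kp; rewrite hh.
Qed.

End LinearExtension.

Section LinearExtensionMore.
Variables (K : choiceType) (F : fieldType).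

Lemma mext0 (W : lmodType F) (h : K -> W) : mext h 0 = 0.
Proof. by have := mextZ h 0 0; rewrite !scale0r. Qed.

Lemma mext_sum (W : lmodType F) (h : K -> W) I (r : seq I) (p : I -> malg K F) :
  mext h (\sum_(i <- r) p i) = \sum_(i <- r) mext h (p i).
Proof. exact: (big_morph (mext h) (mextD h) (mext0 h)). Qed.

Lemma mext_id (p : malg K F) : mext (fun k => mkmalgU k 1) p = p.
Proof.
rewrite [RHS]monalgE /mext; apply: eq_bigr => k _.
by apply/malgP => k'; rewrite mcoeffZ !mcoeffU; case: eqP => _; rewrite ?mulr1// mulr0.
Qed.

Lemma lin_mext (W : lmodType F) (f : malg K F -> W) :
  (forall p q, f (p + q) = f p + f q) -> (forall c p, f (c *: p) = c *: f p) ->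
  forall p, f p = mext (fun k => f (mkmalgU k 1)) p.
Proof.
move=> fD fZ p; have f0 : f 0 = 0 by have := fZ 0 0; rewrite !scale0r.
rewrite -[in LHS](mext_id p) /mext (big_morph f fD f0).
by apply: eq_bigr => k _; rewrite fZ.
Qed.

Lemma lin_eq_mext (W : lmodType F) (f g : malg K F -> W) :
  (forall p q, f (p + q) = f p + f q) -> (forall c p, f (c *: p) = c *: f p) ->
  (forall p q, g (p + q) = g p + g q) -> (forall c p, g (c *: p) = c *: g p) ->
  (forall k, f (mkmalgU k 1) = g (mkmalgU k 1)) -> f =1 g.
Proof.
move=> fD fZ gD gZ fg p; rewrite (lin_mext fD fZ) (lin_mext gD gZ).
by apply: mext_eq => k _.
Qed.

Lemma mcoeff_sum I (r : seq I) (p : I -> malg K F) k :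
  mcoeff k (\sum_(i <- r) p i) = \sum_(i <- r) mcoeff k (p i).
Proof. by apply: big_morph => [x y|]; rewrite ?mcoeffD ?mcoeff0. Qed.

Lemma mcoeff_mext_diag (phi : K -> F) (p : malg K F) k :
  mcoeff k (mext (fun k => phi k *: mkmalgU k 1) p) = phi k * mcoeff k p.
Proof.
rewrite -[in RHS](mext_id p) /mext !mcoeff_sum big_distrr /=.
apply: eq_bigr => j _; rewrite !mcoeffZ mcoeffU.
by case: eqP => [->|_]; rewrite ?mulr1 ?mulr0// mulrC.
Qed.

End LinearExtensionMore.

Lemma subrACA3 (V : zmodType) (a b c d e f : V) :
  a + b - (c + d) - (e + f) = (a - c - e) + (b - d - f).
Proof. by rewrite !opprD (addrACA a b) (addrACA (a - c)). Qed.

(** Against the symmetric U only the symmetric part of a - b - c matters, and it vanishes: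
    exchanging the sums gives S = - S. *)
Lemma antisym_double_sum (F : numFieldType) (W : lmodType F) n
    (a b c : 'I_n -> 'I_n -> int) (U : 'I_n -> 'I_n -> W) :
  (forall i j, U i j = U j i) ->
  (forall i j, a i j - (b i j + c i j) = - (a j i - (b j i + c j i))) ->
  \sum_(i < n) \sum_(j < n) (a i j)%:~R *: U i j =
  \sum_(i < n) \sum_(j < n) (b i j)%:~R *: U i j +
  \sum_(i < n) \sum_(j < n) (c i j)%:~R *: U i j.
Proof.
move=> UC anti; apply/eqP; rewrite -subr_eq0 -big_split -sumrB /=.
pose X i j := a i j - (b i j + c i j).
set S := \sum_(i < n) _; have SE : S = \sum_(i < n) \sum_(j < n) (X i j)%:~R *: U i j.
  apply: eq_bigr => i _; rewrite -big_split -sumrB /=; apply: eq_bigr => j _.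
  by rewrite -scalerDl -scalerBl -rmorphD -rmorphB.
have SN : S = - S.
  rewrite {1}SE exchange_big SE -sumrN; apply: eq_bigr => i _.
  rewrite -sumrN; apply: eq_bigr => j _.
  by rewrite UC (_ : X j i = - X i j) ?rmorphN ?scaleNr ?/X ?(anti j i)// UC.
have : 2%:R *: S = 0 by rewrite scaler_nat mulr2n {1}SN addNr.
by move/eqP; rewrite scaler_eq0 pnatr_eq0.
Qed.

(** The Jacobi defect is linear in each argument, so that testing it on monomials is enough. *)
Lemma jacobi_ext (K : choiceType) (F : fieldType) (br : malg K F -> malg K F -> malg K F)
  (brDl : forall x y z, br (x + y) z = br x z + br y z)
  (brDr : forall x y z, br x (y + z) = br x y + br x z)
  (brZl : forall c x y, br (c *: x) y = c *: br x y)
  (brZr : forall c x y, br x (c *: y) = c *: br x y) (U := fun k => mkmalgU k 1) :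
  (forall k l m, br (U k) (br (U l) (U m)) =
     br (br (U k) (U l)) (U m) + br (U l) (br (U k) (U m))) ->
  forall p q g, br p (br q g) = br (br p q) g + br q (br p g).
Proof.
move=> jac p q g.
pose L p q g := br p (br q g) - br (br p q) g - br q (br p g).
suff : L p q g = 0 by rewrite /L => /eqP; rewrite -addrA -opprD subr_eq0 => /eqP.
have z0 (c : F) : 0 = c *: (0 : malg K F) by rewrite scaler0.
have a0 : 0 = 0 + 0 :> malg K F by rewrite addr0.
apply: (@lin_eq_mext _ _ _ (fun p => L p q g) (fun=> 0)) => //; rewrite /L {p}.
- by move=> p p'; rewrite (brDl p p') brDl (brDl p p') brDl brDr subrACA3.
- by move=> c p; rewrite !(brZl, brZr) !scalerBr.
move=> k.
apply: (@lin_eq_mext _ _ _ (fun q => L (U k) q g) (fun=> 0)) => //; rewrite /L {q}.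
- by move=> p p'; rewrite (brDl p p') brDr (brDr _ p p') brDl brDl subrACA3.
- by move=> c p; rewrite !(brZl, brZr) !scalerBr.
move=> l.
apply: (@lin_eq_mext _ _ _ (fun g => L (U k) (U l) g) (fun=> 0)) => //; rewrite /L {g}.
- by move=> p p'; rewrite !brDr subrACA3.
- by move=> c p; rewrite !(brZl, brZr) !scalerBr.
by move=> m; rewrite jac addrAC addrK subrr.
Qed.

(* The monomial of exponent k is e(k . w) where (w_1, ..., w_n) are the angles and
   x_{n+i} = e(w_{n+i}) are the rescaled actions.  Up to a constant factor,
   {x^k, x^l} = \sum_i (k_i l_{n+i} - k_{n+i} l_i) x^(k + l - e_{n+i}). *)
Section PoissonAlgebra.
Variables (R : realType) (n : nat).
Local Notation C := R[i].
Local Notation Z2 := 'rV[int]_(n + n).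
Local Notation A := (malg Z2 C).
Implicit Types (k l : Z2) (p : A) (i : 'I_n).

Definition mono k : A := mkmalgU k 1.
Definition ang k i : int := k 0 (lshift n i).
Definition act k i : int := k 0 (rshift n i).
Definition unit_act i : Z2 := delta_mx 0 (rshift n i).
Definition symp i k l : int := ang k i * act l i - act k i * ang l i.

Lemma monoE (a b : int) k l : a = b -> k = l -> a%:~R *: mono k = b%:~R *: mono l.
Proof. by move=> -> ->. Qed.

Definition pbr0 k l : A :=
  \sum_(i < n) (symp i k l)%:~R *: mono (k + l - unit_act i).

Definition pbr p q : A := mext (fun k => mext (fun l => pbr0 k l) q) p.

Lemma pbrDl p p' q : pbr (p + p') q = pbr p q + pbr p' q.
Proof. exact: mextD. Qed.

Lemma pbrZl c p q : pbr (c *: p) q = c *: pbr p q.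
Proof. exact: mextZ. Qed.

Lemma pbrDr p q q' : pbr p (q + q') = pbr p q + pbr p q'.
Proof.
rewrite /pbr /mext -big_split /=; apply: eq_bigr => k _.
by rewrite -/(mext _ _) mextD scalerDr.
Qed.

Lemma pbrZr c p q : pbr p (c *: q) = c *: pbr p q.
Proof.
rewrite /pbr /mext scaler_sumr; apply: eq_bigr => k _.
by rewrite -/(mext _ _) mextZ !scalerA mulrC.
Qed.

Lemma pbrU k l : pbr (mono k) (mono l) = pbr0 k l.
Proof. by rewrite /pbr !mextU !scale1r. Qed.

Lemma pbr_sumr I (r : seq I) (p : A) (q : I -> A) :
  pbr p (\sum_(i <- r) q i) = \sum_(i <- r) pbr p (q i).
Proof.
apply: (big_morph (pbr p)); first exact: pbrDr.
by have := pbrZr 0 p 0; rewrite !scale0r.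
Qed.

Lemma pbr_suml I (r : seq I) (q : A) (p : I -> A) :
  pbr (\sum_(i <- r) p i) q = \sum_(i <- r) pbr (p i) q.
Proof.
apply: (big_morph (pbr^~ q)) => [x y|]; first exact: pbrDl.
by have := pbrZl 0 0 q; rewrite !scale0r.
Qed.

Lemma angD k l i : ang (k + l) i = ang k i + ang l i.
Proof. by rewrite /ang mxE. Qed.
Lemma actD k l i : act (k + l) i = act k i + act l i.
Proof. by rewrite /act mxE. Qed.
Lemma angN k i : ang (- k) i = - ang k i.
Proof. by rewrite /ang mxE. Qed.
Lemma actN k i : act (- k) i = - act k i.
Proof. by rewrite /act mxE. Qed.
Lemma ang_unit i j : ang (unit_act j) i = 0.
Proof. by rewrite /ang mxE /= eq_lrshift. Qed.
Lemma act_unit i j : act (unit_act j) i = (i == j)%:R.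
Proof. by rewrite /act mxE /= eq_rshift. Qed.

Lemma sympDr i k l m : symp i k (l + m) = symp i k l + symp i k m.
Proof. by rewrite /symp angD actD; ring. Qed.
Lemma sympDl i k l m : symp i (k + l) m = symp i k m + symp i l m.
Proof. by rewrite /symp angD actD; ring. Qed.
Lemma sympNr i k l : symp i k (- l) = - symp i k l.
Proof. by rewrite /symp angN actN; ring. Qed.
Lemma sympNl i k l : symp i (- k) l = - symp i k l.
Proof. by rewrite /symp angN actN; ring. Qed.
Lemma sympC i k l : symp i l k = - symp i k l.
Proof. by rewrite /symp; ring. Qed.
Lemma symp_unitr i j k : symp i k (unit_act j) = ang k i * (i == j)%:R.
Proof. by rewrite /symp ang_unit act_unit mulr0 subr0. Qed.
Lemma symp_unitl i j k : symp i (unit_act j) k = - (ang k i * (i == j)%:R).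
Proof. by rewrite sympC symp_unitr. Qed.

(** All three double brackets are combinations of the monomials x^(k + l + m - e_{n+i} - e_{n+j}),
    symmetric in i and j; only symmetrised coefficients have to agree. The Kronecker terms come from
    the exponent removed by the inner bracket. *)
Lemma pbr_jacobi0 k l m : pbr (mono k) (pbr (mono l) (mono m)) =
  pbr (pbr (mono k) (mono l)) (mono m) + pbr (mono l) (pbr (mono k) (mono m)).
Proof.
pose U i j : A := mono (k + l + m - unit_act i - unit_act j).
have UC i j : U i j = U j i by rewrite /U addrAC.
have E1 : pbr (mono k) (pbr (mono l) (mono m)) = \sum_(i < n) \sum_(j < n)
   (symp i l m * (symp j k l + symp j k m - ang k j * (j == i)%:R))%:~R *: U i j.
  rewrite pbrU pbr_sumr; apply: eq_bigr => i _; rewrite pbrZr pbrU scaler_sumr.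
  apply: eq_bigr => j _; rewrite scalerA -intrM; apply: monoE.
    by rewrite !sympDr sympNr symp_unitr.
  by rewrite !addrA.
have E2 : pbr (pbr (mono k) (mono l)) (mono m) = \sum_(i < n) \sum_(j < n)
   (symp i k l * (symp j k m + symp j l m + ang m j * (j == i)%:R))%:~R *: U i j.
  rewrite pbrU pbr_suml; apply: eq_bigr => i _; rewrite pbrZl pbrU scaler_sumr.
  apply: eq_bigr => j _; rewrite scalerA -intrM; apply: monoE.
    by rewrite !sympDl sympNl symp_unitl opprK.
  by rewrite [RHS]addrAC [in RHS]addrAC [k + l - _ + m]addrAC.
have E3 : pbr (mono l) (pbr (mono k) (mono m)) = \sum_(i < n) \sum_(j < n)
   (symp i k m * (- symp j k l + symp j l m - ang l j * (j == i)%:R))%:~R *: U i j.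
  rewrite pbrU pbr_sumr; apply: eq_bigr => i _; rewrite pbrZr pbrU scaler_sumr.
  apply: eq_bigr => j _; rewrite scalerA -intrM; apply: monoE.
    by rewrite !sympDr sympNr symp_unitr (sympC j k l).
  by rewrite !addrA [l + k]addrC.
rewrite {}E1 {}E2 {}E3; apply: antisym_double_sum => // i j.
by case: eqVneq => [->|_]; rewrite ?eqxx /symp ?mulr1 ?mulr0; ring.
Qed.

Lemma pbr_jacobi p q g : pbr p (pbr q g) = pbr (pbr p q) g + pbr q (pbr p g).
Proof.
by apply: (jacobi_ext pbrDl pbrDr pbrZl pbrZr) => k l m; exact: pbr_jacobi0.
Qed.

End PoissonAlgebra.

Section ConvLemmas.
Variables (K : numFieldType) (V : lmodType K) (br : V -> V -> V).
Implicit Types F G : nat -> V.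

Lemma conv_rev F G k : conv br F G k = \sum_(p < k.+1) br (F p) (G (k - p)%N).
Proof.
rewrite /conv (reindex_inj rev_ord_inj) /=; apply: eq_bigr => j _.
by rewrite subSS subKn// -ltnS.
Qed.

Lemma conv_head F G s : conv br F G s.+1 =
  br (F s.+1) (G 0%N) + \sum_(j < s.+1) br (F (s - j)%N) (G j.+1).
Proof. by rewrite /conv big_ord_recl /= subn0. Qed.

Lemma conv_upd_lt F G x s i : (i <= s)%N ->
  conv br (fun i => if i == s.+1 then x else F i) G i = conv br F G i.
Proof.
move=> is'; rewrite /conv; apply: eq_bigr => j _.
by rewrite ltn_eqF// ltnS (leq_trans (leq_subr _ _)).
Qed.

Lemma conv_upd F G x s :
  conv br (fun i => if i == s.+1 then x else F i) G s.+1 =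
  br x (G 0%N) + \sum_(j < s.+1) br (F (s - j)%N) (G j.+1).
Proof.
rewrite conv_head eqxx; congr (_ + _); apply: eq_bigr => j _.
by rewrite ltn_eqF// ltnS leq_subr.
Qed.

End ConvLemmas.

(** * Exponentially weighted norms of Laurent polynomials *)

Lemma abszD (x y : int) : (absz (x + y)%R <= absz x + absz y)%N.
Proof. by lia. Qed.

Section WeightedNorm.
Variables (R : realType) (d : nat).
Local Notation C := R[i].
Local Notation Z2 := 'rV[int]_d.
Local Notation A := (malg Z2 C).
Implicit Types (k l : Z2) (p q : A) (a : R).

Definition l1 k : nat := \sum_(i < d) absz (k ord0 i).

Lemma l1D k l : (l1 (k + l)%R <= l1 k + l1 l)%N.
Proof.
rewrite /l1 -big_split /=; apply: leq_sum => i _; rewrite mxE; exact: abszD.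
Qed.

Lemma l1N k : l1 (- k) = l1 k.
Proof. by apply: eq_bigr => i _; rewrite mxE abszN. Qed.

Lemma l1B k l : (l1 (k - l)%R <= l1 k + l1 l)%N.
Proof. by rewrite -(l1N l) l1D. Qed.

Lemma absz_le_l1 k i : (absz (k ord0 i) <= l1 k)%N.
Proof. by rewrite /l1 (bigD1 i)//= leq_addr. Qed.

(** Controls the supremum of p on the strip tpi |Im w_j| <= a, by [nm_ev]. *)
Definition wnorm a p : R := \sum_(k <- msupp p) nm (mcoeff k p) * expR (a * (l1 k)%:R).

Lemma wnormEw (D : finSet Z2) a p : fsubset (msupp p) D ->
  wnorm a p = \sum_(k <- D) nm (mcoeff k p) * expR (a * (l1 k)%:R).
Proof.
move=> le; rewrite /wnorm (big_fset_incl _ le)// => x xd /mcoeff_outdom ->.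
by rewrite nm0 mul0r.
Qed.

Lemma wnorm_ge0 a p : 0 <= wnorm a p.
Proof. by apply: sumr_ge0 => k _; rewrite mulr_ge0 ?nm_ge0 ?expR_ge0. Qed.

Lemma wnorm_le_scale (c a b : R) p q :
  (forall k, nm (mcoeff k q) * expR (b * (l1 k)%:R) <=
     c * (nm (mcoeff k p) * expR (a * (l1 k)%:R))) -> wnorm b q <= c * wnorm a p.
Proof.
move=> qp.
rewrite (wnormEw _ (fsubsetUr (msupp p) (msupp q))).
rewrite (wnormEw _ (fsubsetUl (msupp p) (msupp q))).
by rewrite mulr_sumr; apply: ler_sum => k _.
Qed.

Lemma wnormD a p q : wnorm a (p + q) <= wnorm a p + wnorm a q.
Proof.
rewrite (wnormEw _ (msuppD_le p q)) (wnormEw _ (fsubsetUl (msupp p) (msupp q))).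
rewrite (wnormEw _ (fsubsetUr (msupp p) (msupp q))) -big_split /=.
apply: ler_sum => k _; rewrite -mulrDl ler_wpM2r ?expR_ge0// mcoeffD.
exact: nmD.
Qed.

Lemma wnormZ a c p : wnorm a (c *: p) = nm c * wnorm a p.
Proof.
rewrite (wnormEw _ (msuppZ_le c p)) mulr_sumr.
by apply: eq_bigr => k _; rewrite mcoeffZ nmM mulrA.
Qed.

Lemma wnorm0 a : wnorm a 0 = 0.
Proof. by rewrite -(scale0r (0 : A)) wnormZ nm0 mul0r. Qed.

Lemma wnormN a p : wnorm a (- p) = wnorm a p.
Proof. by rewrite -scaleN1r wnormZ nmN nm1 mul1r. Qed.

Lemma wnormU a k c : wnorm a (mkmalgU k c) = nm c * expR (a * (l1 k)%:R).
Proof. by rewrite (wnormEw _ (@msuppU_le _ _ k c)) big_seq_fset1 mcoeffUU. Qed.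

Lemma wnorm_sum a I (r : seq I) (p : I -> A) (P : pred I) :
  wnorm a (\sum_(i <- r | P i) p i) <= \sum_(i <- r | P i) wnorm a (p i).
Proof.
apply: (big_rec2 (fun x y => wnorm a x <= y)); first by rewrite wnorm0.
by move=> i x y _ xy; rewrite (le_trans (wnormD _ _ _))// lerD2l.
Qed.

Lemma wnorm_mext a (c : R) (h : Z2 -> A) p :
  (forall k, mcoeff k p != 0 -> wnorm a (h k) <= c * expR (a * (l1 k)%:R)) ->
  wnorm a (mext h p) <= c * wnorm a p.
Proof.
move=> hc; rewrite /mext (le_trans (wnorm_sum _ _ _ _))// [wnorm _ _ in leRHS]/wnorm mulr_sumr.
apply: ler_sum => k _; rewrite wnormZ mulrCA.
have [->|pk] := eqVneq (mcoeff k p) 0; first by rewrite nm0 !mul0r.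
by rewrite ler_wpM2l ?nm_ge0// hc.
Qed.

Definition suppin (Q : Z2 -> Prop) p := forall k, mcoeff k p != 0 -> Q k.

Lemma suppin0 Q : suppin Q 0.
Proof. by move=> k; rewrite mcoeff0 eqxx. Qed.

Lemma suppinD Q p q : suppin Q p -> suppin Q q -> suppin Q (p + q).
Proof.
move=> pQ qQ k; rewrite mcoeffD; have [->|pk _] := eqVneq (mcoeff k p) 0.
  by rewrite add0r; exact: qQ.
exact: pQ.
Qed.

Lemma suppinZ Q c p : suppin Q p -> suppin Q (c *: p).
Proof. by move=> pQ k; rewrite mcoeffZ mulf_eq0 negb_or => /andP[_]; exact: pQ. Qed.

Lemma suppin_sum Q I (r : seq I) (P : pred I) (p : I -> A) :
  (forall i, P i -> suppin Q (p i)) -> suppin Q (\sum_(i <- r | P i) p i).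
Proof.
by move=> pQ; apply: (big_ind (suppin Q)); [exact: suppin0|exact: suppinD|].
Qed.

Lemma suppinU (Q : Z2 -> Prop) k c : Q k -> suppin Q (mkmalgU k c).
Proof. by move=> Qk l; rewrite mcoeffU; case: (eqVneq k l) => [<-//|_]; rewrite eqxx. Qed.

Lemma suppin_mext Q (h : Z2 -> A) p :
  (forall k, mcoeff k p != 0 -> suppin Q (h k)) -> suppin Q (mext h p).
Proof.
move=> hQ; apply: suppin_sum => k _.
have [->|pk] := eqVneq (mcoeff k p) 0; first by rewrite scale0r; exact: suppin0.
by apply: suppinZ; exact: hQ.
Qed.

Lemma suppin_impl (Q Q' : Z2 -> Prop) p : (forall k, Q k -> Q' k) -> suppin Q p -> suppin Q' p.
Proof. by move=> QQ pQ k /pQ/QQ. Qed.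

Definition homcomp j p : A := mext (fun k => (l1 k == j)%:R *: mkmalgU k 1) p.

Lemma mcoeff_homcomp j p k : mcoeff k (homcomp j p) = (l1 k == j)%:R * mcoeff k p.
Proof. exact: mcoeff_mext_diag. Qed.

Lemma suppin_homcomp j p : suppin (fun k => l1 k = j) (homcomp j p).
Proof. by move=> k; rewrite mcoeff_homcomp; case: (eqVneq (l1 k) j) => // _; rewrite mul0r eqxx. Qed.

Lemma wnorm_homcomp j a b p :
  wnorm b (homcomp j p) <= expR ((b - a) * j%:R) * wnorm a p.
Proof.
apply: wnorm_le_scale => k; rewrite mcoeff_homcomp.
have [<-|_] := eqVneq (l1 k) j; last first.
  by rewrite mul0r nm0 mul0r !mulr_ge0 ?nm_ge0 ?expR_ge0.
rewrite mul1r mulrCA -expRD -mulrDl subrK//.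
Qed.

Lemma homcomp_sum N p : suppin (fun k => (l1 k <= N)%N) p ->
  p = \sum_(j < N.+1) homcomp j p.
Proof.
move=> pN; apply/malgP => k; rewrite mcoeff_sum.
under eq_bigr do rewrite mcoeff_homcomp.
have [->|/pN kN] := eqVneq (mcoeff k p) 0; first by rewrite big1// => j _; rewrite mulr0.
rewrite (bigD1 (Ordinal (kN : (l1 k < N.+1)%N)))//= eqxx mul1r big1 ?addr0// => j.
by move=> jk; case: eqP => [e|]; rewrite ?mul0r//; move: jk; rewrite -val_eqE /= e eqxx.
Qed.

End WeightedNorm.

Section BracketEstimate.
Variables (R : realType) (n : nat).
Local Notation C := R[i].
Local Notation Z2 := 'rV[int]_(n + n).
Local Notation A := (malg Z2 C).
Implicit Types (k l : Z2) (p q : A) (a : R).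

Lemma nm_int (z : int) : nm (z%:~R : C) = (absz z)%:R.
Proof.
have nmn (m : nat) : nm (m%:R : C) = m%:R.
  elim: m => [|m IH]; first by rewrite nm0.
  by rewrite -(rmorph_nat (real_complex R)) nmC ger0_norm// ler0n.
by case: z => m; rewrite ?NegzE ?mulrNz ?nmN -pmulrn ?abszN nmn.
Qed.

Lemma l1_unit i : l1 (unit_act i : Z2) = 1%N.
Proof.
rewrite /l1 (bigD1 (rshift n i))//= /unit_act mxE !eqxx big1// => j jn.
by rewrite mxE (negPf jn) andbF.
Qed.

Lemma sum_symp k l : (\sum_(i < n) absz (symp i k l) <= l1 k * l1 l)%N.
Proof.
pose b (m : Z2) i := (absz (ang m i) + absz (act m i))%N.
have bE m : l1 m = \sum_(i < n) b m i by rewrite /l1 big_split_ord big_split.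
rewrite !bE big_distrl; apply: leq_sum => i _.
apply: (@leq_trans (b k i * b l i)); last by rewrite leq_mul2l (bigD1 i)//= leq_addr orbT.
rewrite /symp /b (leq_trans (leqD_dist _ 0 _))// sub0r abszN subr0 !abszM; nia.
Qed.

(** The exponent k + l - e_{n+i} has length at most |k| + |l| + 1; the 1 gives the factor exp a. *)
Lemma wnorm_pbr0 a k l : 0 <= a -> wnorm a (pbr0 R k l) <=
  (l1 k)%:R * (l1 l)%:R * expR a * (expR (a * (l1 k)%:R) * expR (a * (l1 l)%:R)).
Proof.
move=> a0; rewrite /pbr0 (le_trans (wnorm_sum _ _ _ _))//.
apply: (@le_trans _ _ (\sum_(i < n) (absz (symp i k l))%:R *
  (expR a * (expR (a * (l1 k)%:R) * expR (a * (l1 l)%:R))))).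
  apply: ler_sum => i _; rewrite wnormZ nm_int wnormU nm1 mul1r ler_wpM2l//.
  rewrite -!expRD ler_expR -[X in _ <= X + _]mulr1 -!mulrDr ler_wpM2l//.
  rewrite -natrD nat1r ler_nat.
  by rewrite (leq_trans (l1B _ _))// l1_unit addn1 ltnS l1D.
rewrite -mulr_suml -[leRHS]mulrA ler_wpM2r ?mulr_ge0 ?expR_ge0//.
by rewrite -natr_sum -natrM ler_nat sum_symp.
Qed.

(** The derivatives are paid for by the degrees S and T and the weight a is the same on both sides:
    no width is lost, and the estimate can be iterated N times. *)
Lemma wnorm_pbr a (S T : nat) p q : 0 <= a ->
  suppin (fun k => (l1 k <= S)%N) p -> suppin (fun k => (l1 k <= T)%N) q ->
  wnorm a (pbr p q) <= S%:R * T%:R * expR a * wnorm a q * wnorm a p.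
Proof.
move=> a0 pS qT; apply: wnorm_mext => k /pS kS.
apply: (@le_trans _ _ (S%:R * T%:R * expR a * expR (a * (l1 k)%:R) * wnorm a q));
  last by rewrite mulrAC.
apply: wnorm_mext => l /qT lT.
rewrite (le_trans (wnorm_pbr0 k l a0))// mulrA ler_wpM2r ?expR_ge0// ler_wpM2r ?expR_ge0//.
by rewrite ler_wpM2r ?expR_ge0// -!natrM ler_nat leq_mul.
Qed.

Lemma suppin_pbr (Q Q1 Q2 : Z2 -> Prop) p q :
  (forall k l i, Q1 k -> Q2 l -> Q (k + l - unit_act i)) ->
  suppin Q1 p -> suppin Q2 q -> suppin Q (pbr p q).
Proof.
move=> QQ pQ qQ; apply: suppin_mext => k /pQ kQ; apply: suppin_mext => l /qQ lQ.
by apply: suppin_sum => i _; apply: suppinZ; apply: suppinU; exact: QQ.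
Qed.

Lemma pbr_const p q : suppin (fun l => l1 l = 0%N) q -> pbr p q = 0.
Proof.
move=> q0; rewrite /pbr /mext big1// => k _; rewrite big1 ?scaler0// => l _.
have [->|/q0 l0] := eqVneq (mcoeff l q) 0; first by rewrite scale0r.
have lz i : l ord0 i = 0 by have := absz_le_l1 l i; rewrite l0 leqn0 absz_eq0 => /eqP.
rewrite /pbr0 big1 ?scaler0// => i _.
by rewrite /symp /ang /act !lz !mulr0 subr0 scale0r.
Qed.

End BracketEstimate.

Section LinearPart.
Variables (R : realType) (n : nat) (om : 'I_n -> R).
Local Notation C := R[i].
Local Notation Z2 := 'rV[int]_(n + n).
Local Notation A := (malg Z2 C).
Implicit Types (k l : Z2) (p q : A) (a : R).
Hypothesis nonres : forall k, \sum_(i < n) om i * (ang k i)%:~R = 0 -> forall i, ang k i = 0.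

Definition divisor k : C := (\sum_(i < n) om i * (ang k i)%:~R)%:C.
(** In exponential coordinates, omega . I divided by rho, up to a constant. Bracketing with it
    multiplies the monomial of exponent k by k . omega. *)
Definition linpart : A := \sum_(i < n) (om i)%:C *: mono R (unit_act i).

Lemma pbr_linpart p : pbr p linpart = mext (fun k => divisor k *: mkmalgU k 1) p.
Proof.
apply: mext_eq => k _; rewrite /linpart mext_sum /divisor rmorph_sum scaler_suml.
apply: eq_bigr => i _; rewrite mextZ mextU scale1r rmorphM -scalerA; congr (_ *: _).
rewrite /pbr0 (bigD1 i)//= big1 ?addr0.
  by rewrite symp_unitr eqxx mulr1 addrK rmorph_int.
by move=> j ji; rewrite symp_unitr (negPf ji) mulr0 scale0r.
Qed.

Lemma mcoeff_pbr_linpart p k : mcoeff k (pbr p linpart) = divisor k * mcoeff k p.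
Proof. by rewrite pbr_linpart mcoeff_mext_diag. Qed.

Lemma divisor_eq0 k : divisor k = 0 -> forall i, ang k i = 0.
Proof. by move=> /(congr1 (@complex.Re R)) /=; exact: nonres. Qed.

(** By non-resonance, what commutes with l has no angular exponent, and two functions of the actions
    commute. *)
Lemma linpart_abelian p q : pbr p linpart = 0 -> pbr q linpart = 0 -> pbr p q = 0.
Proof.
have sup r : pbr r linpart = 0 -> suppin (fun k => forall i, ang k i = 0) r.
  move=> r0 k rk; apply: divisor_eq0; apply/eqP; move: (congr1 (mcoeff k) r0).
  by rewrite mcoeff_pbr_linpart mcoeff0 => /eqP; rewrite mulf_eq0 (negPf rk) orbF.
move=> /sup p0 /sup q0; apply/malgP => k; rewrite mcoeff0; apply/eqP/negPn/negP.
apply: (@suppin_mext R _ (fun=> False)) => l /p0 l0.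
apply: suppin_mext => m /q0 m0; rewrite /pbr0 big1; first exact: suppin0.
by move=> i _; rewrite /symp l0 m0 mul0r mulr0 subr0 scale0r.
Qed.

(* The modes of zero divisor are killed, since 0^-1 = 0. *)
Definition hominv p : A := mext (fun k => (divisor k)^-1 *: mkmalgU k 1) p.

Lemma mcoeff_hominv p k : mcoeff k (hominv p) = (divisor k)^-1 * mcoeff k p.
Proof. exact: mcoeff_mext_diag. Qed.

Opaque pbr hominv.

Lemma pbr_hominv y : pbr (hominv (pbr y linpart)) linpart = pbr y linpart.
Proof.
apply/malgP => k.
have E := mcoeff_pbr_linpart y k.
apply: (etrans (mcoeff_pbr_linpart _ k)); apply: (etrans _ (esym E)).
rewrite mcoeff_hominv; apply: (etrans (congr1 (fun x => _ * (_ * x)) E)).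
have [->|dk] := eqVneq (divisor k) 0; first by rewrite !mul0r.
by rewrite mulVKf.
Qed.

Lemma linpart_split p : exists chi, pbr (p + pbr chi linpart) linpart = 0.
Proof.
exists (- hominv p); apply/malgP => k; rewrite mcoeff_pbr_linpart mcoeffD.
rewrite mcoeff_pbr_linpart mcoeffN mcoeff_hominv mcoeff0.
have [->|dk] := eqVneq (divisor k) 0; first by rewrite !mul0r.
by rewrite mulrN mulVKf// subrr mulr0.
Qed.

Lemma linpart_solvable (f P : nat -> A) s : f 0%N = linpart ->
  (forall i, (i < s)%N -> conv (@pbr R n) P f i = 0) ->
  exists y, conv (@pbr R n) P f s = pbr y linpart.
Proof.
apply: formal_solvability; [exact: pbrDl|exact: pbrDr|exact: pbrZl|exact: pbrZr|
  exact: pbr_jacobi|exact: linpart_abelian|exact: linpart_split].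
Qed.

Lemma suppin_hominv Q p : suppin Q p -> suppin Q (hominv p).
Proof. by move=> pQ k; rewrite mcoeff_hominv mulf_eq0 negb_or => /andP[_]; exact: pQ. Qed.

Lemma wnorm_hominv a (Y : R) p : 0 <= Y ->
  suppin (fun k => divisor k = 0 \/ (nm (divisor k))^-1 <= Y) p ->
  wnorm a (hominv p) <= Y * wnorm a p.
Proof.
move=> Y0 pY; apply: wnorm_le_scale => k; rewrite mcoeff_hominv nmM mulrA.
rewrite ler_wpM2r ?expR_ge0//.
have [->|/pY kY] := eqVneq (mcoeff k p) 0; first by rewrite nm0 !mulr0.
rewrite ler_wpM2r ?nm_ge0// nmV; case: kY => // ->; first by rewrite nm0 invr0.
Qed.

End LinearPart.

Opaque pbr hominv linpart.

(** * Approximate first integrals *)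

Section NormalForm.
Variables (R : realType) (n : nat) (om : 'I_n -> R).
Local Notation C := R[i].
Local Notation Z2 := 'rV[int]_(n + n).
Local Notation A := (malg Z2 C).
Implicit Types (k l : Z2) (p q : A).
Hypothesis nonres : forall k, \sum_(i < n) om i * (ang k i)%:~R = 0 -> forall i, ang k i = 0.
Variables (a Y E : R) (N : nat) (F : A) (j0 : 'I_n).
Hypotheses (a_gt0 : 0 < a) (Y_ge0 : 0 <= Y) (E_ge0 : 0 <= E)
  (FE : wnorm (a + a) F <= E)
  (divY : forall k, (forall i, (absz (ang k i) <= N)%N) ->
     divisor om k = 0 \/ (nm (divisor om k))^-1 <= Y).

Local Notation l0 := (linpart om).

(** The formal order is the degree. Hence order s of the recursion involves angular exponents at
    most s, and the parts decay geometrically by the weight. The component of degree 0 is replaced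
    by l: it is a constant, central for the bracket. *)
Definition hampart (j : nat) : A := if j is 0 then l0 else homcomp j F.

(** For the weight a, the part of degree j is smaller by exp(- a j) than for the weight 2 a; half of
    this pays for the factor j of the bracket and q ^+ j is left. E1 bounds a bracket followed by a
    division, per unit of degree of the other factor, and eta allows degrees up to 2 N + 1. *)
Let q : R := expR (- (a / 2)).
Let E1 : R := Y * (expR a * (2 / a * E)).
Let eta : R := (N.*2.+1)%:R * E1.

Lemma hampart_norm j : (0 < j)%N -> j%:R * wnorm a (hampart j) <= 2 / a * E * q ^+ j.
Proof.
case: j => // j _; set J := j.+1.
rewrite /hampart (le_trans (ler_wpM2l _ (wnorm_homcomp J (a + a) a F)))//.
rewrite opprD addNKr mulrA [leRHS]mulrAC.
apply: (@le_trans _ _ (J%:R * expR (- a * J%:R) * E)); first by rewrite ler_wpM2l// mulr_ge0 ?expR_ge0.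
rewrite ler_wpM2r// /q -expRM_natl.
rewrite (_ : - a * J%:R = - (a / 2 * J%:R) + J%:R * - (a / 2)); last by field.
rewrite expRD mulrA ler_wpM2r ?expR_ge0// expRN ler_pdivrMr ?expR_gt0//.
rewrite -[2 / a]invf_div ler_pdivlMl ?divr_gt0//.
by rewrite (le_trans _ (expR_ge1Dx _))// lerDr.
Qed.

Lemma pbr_hampart_norm S p j : (0 < j)%N -> suppin (fun k => (l1 k <= S)%N) p ->
  wnorm a (pbr p (hampart j)) <= S%:R * (expR a * (2 / a * E)) * q ^+ j * wnorm a p.
Proof.
move=> j0' pS.
have fj : suppin (fun k => (l1 k <= j)%N) (hampart j).
  by case: j j0' => // j _; apply: (suppin_impl _ (@suppin_homcomp _ _ j.+1 F)) => k ->.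
rewrite (le_trans (wnorm_pbr (ltW a_gt0) pS fj))// ler_wpM2r ?wnorm_ge0//.
rewrite -!mulrA ler_wpM2l// mulrCA ler_wpM2l ?expR_ge0// !mulrA.
by rewrite (le_trans (hampart_norm j0'))// !mulrA.
Qed.

(** The bound 2 s + 1 arises because P_0 has degree 1 and a bracket with the part of degree j >= 1
    adds j + 1 <= 2 j. Angular exponents grow by j only, since the exponent removed by the bracket
    is an action. *)
Let deg s k := (l1 k <= s.*2.+1)%N /\ forall i, (absz (ang k i) <= s)%N.

Lemma deg_pbr_hampart s j p : (0 < j)%N -> suppin (deg s) p ->
  suppin (deg (s + j)) (pbr p (hampart j)).
Proof.
case: j => // j _ ps.
apply: (suppin_pbr _ ps (@suppin_homcomp _ _ j.+1 F)) => k l i [k1 k2] lj; split.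
  rewrite (leq_trans (l1B _ _))// l1_unit addn1 ltnS (leq_trans (l1D _ _))//.
  by rewrite lj; move: k1; lia.
move=> i'; rewrite angD angD angN ang_unit oppr0 addr0 (leq_trans (abszD _ _))//.
by rewrite leq_add// -lj absz_le_l1.
Qed.

(** P_{s+1} is minus [hominv] of the defect g at order s + 1, which [linpart_solvable] places in the
    image of the bracket with l. As g has angular exponents at most s + 1 <= N, its inverse divisors
    are bounded by Y. The majorant is a discrete Gronwall bound. *)
Lemma first_integral s : (s <= N)%N -> exists P : nat -> A,
  [/\ P 0%N = mono R (unit_act j0),
      (forall i, (i <= s)%N -> conv (@pbr R n) P hampart i = 0),
      (forall i, (s < i)%N -> P i = 0),
      (forall i, suppin (deg i) (P i)) &
      (forall i, (0 < i)%N -> wnorm a (P i) <= expR a * E1 * q ^+ i * (1 + eta) ^+ i.-1)].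
Proof.
have E1_ge0 : 0 <= E1 by rewrite !mulr_ge0 ?expR_ge0// ?invr_ge0 ltW.
have eta_ge0 : 0 <= eta by rewrite mulr_ge0.
have q_ge0 : 0 <= q by exact: expR_ge0.
have P0deg : suppin (deg 0) (mono R (unit_act j0 : Z2)).
  by apply: suppinU; split; [rewrite l1_unit|move=> i; rewrite ang_unit].
elim: s => [_|s IH sN].
  exists (fun i => if i == 0%N then mono R (unit_act j0 : Z2) else (0 : A)); split => //.
  - case=> // _; rewrite /conv big_ord1 subnn /=; apply/malgP => k.
    rewrite mcoeff_pbr_linpart mcoeff0 mcoeffU; case: eqP => [<-|_]; last by rewrite mulr0.
    by rewrite /divisor big1 ?mul0r// => i _; rewrite ang_unit mulr0.
  - by case.
  - by case=> // i; exact: suppin0.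
  - case=> // i _; rewrite wnorm0 !mulr_ge0 ?expR_ge0 ?exprn_ge0//.
      by rewrite invr_ge0 ltW.
    by rewrite addr_ge0.
have [P [P0 Pconv Pbig Pdeg Pnorm]] := IH (ltnW sN).
(* P vanishes beyond s, so g gathers only brackets of terms already constructed. *)
set g := conv (@pbr R n) P hampart s.+1.
have [y gy] : exists y, g = pbr y l0 by apply: (linpart_solvable nonres).
have gE : g = \sum_(j < s.+1) pbr (P (s - j)%N) (hampart j.+1).
  rewrite /g conv_head Pbig//.
  by rewrite -(scale0r (0 : A)) pbrZl scale0r add0r.
have gdeg : suppin (deg s.+1) g.
  rewrite gE; apply: suppin_sum => j _.
  have := deg_pbr_hampart (j := j.+1) isT (Pdeg (s - j)%N).
  by rewrite addnS subnK// -ltnS.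
have gnorm : Y * wnorm a g <= expR a * E1 * q ^+ s.+1 * (1 + eta) ^+ s.
  rewrite gE (le_trans (ler_wpM2l Y_ge0 (wnorm_sum _ _ _ _)))// big_ord_recr /= subnn P0.
  rewrite mulrDr.
  (* P_0 has degree 1 and yields the isolated 1; the other P_i have degree at most 2 N + 1 and yield
     eta times the geometric sum. *)
  have -> : (1 + eta) ^+ s = eta * (\sum_(j < s) (1 + eta) ^+ (s - j.+1)) + 1.
    rewrite -[X in X = _](subrK 1) subrX1 [1 + eta - 1]addrAC subrr add0r.
    congr (eta * _ + 1); rewrite (reindex_inj rev_ord_inj) /=.
    by apply: eq_bigr => j _.
  rewrite mulrDr mulr1 lerD//; last first.
    have := @pbr_hampart_norm 1%N (mono R (unit_act j0)) s.+1 isT.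
    rewrite wnormU nm1 mul1r l1_unit mulr1 mul1r => /(_ _)/(ler_wpM2l Y_ge0) H.
    rewrite (le_trans (H _))//; first by apply: suppinU; rewrite l1_unit.
    by rewrite /E1 !mulrA mulrC !mulrA.
  rewrite mulrA !mulr_sumr; apply: ler_sum => j _.
  have sj : (0 < s - j)%N by rewrite subn_gt0.
  have PS : suppin (fun k => (l1 k <= N.*2.+1)%N) (P (s - j)%N).
    by apply: suppin_impl (Pdeg _) => k [k1 _]; move: k1 sN; lia.
  rewrite (le_trans (ler_wpM2l Y_ge0 (pbr_hampart_norm (j := j.+1) isT PS)))//.
  have H := Pnorm _ sj; rewrite -subnS in H.
  rewrite [Y * _]mulrA; apply: (le_trans (ler_wpM2l _ H)).
    by rewrite !mulr_ge0 ?expR_ge0 ?exprn_ge0// ?invr_ge0 ltW.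
  have -> : q ^+ s.+1 = q ^+ j.+1 * q ^+ (s - j) by rewrite -exprD addSn subnKC// ltnW.
  move: ((1 + eta) ^+ (s - j.+1)) => e1; rewrite /eta /E1.
  by move: (q ^+ j.+1) (q ^+ (s - j)) => q1 q2; rewrite le_eqVlt; apply/orP; left; apply/eqP; ring.
exists (fun i => if i == s.+1 then - hominv om g else P i); split.
- by [].
- move=> i; rewrite leq_eqVlt => /orP[/eqP ->|is'].
    rewrite conv_upd -gE -scaleN1r pbrZl gy pbr_hominv// -gy.
    by rewrite (scaleN1r g) addNr.
  by rewrite conv_upd_lt// Pconv.
- by move=> i si; rewrite gtn_eqF// Pbig// ltnW.
- by move=> i; case: eqP => [->|_ //]; rewrite -scaleN1r; apply: suppinZ; exact: suppin_hominv.
move=> i i0; case: eqP => [->|_]; last exact: Pnorm.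
rewrite wnormN (le_trans _ gnorm)//; apply: wnorm_hominv => //.
apply: suppin_impl gdeg => k [_ kd]; apply: divY => i'.
exact: leq_trans (kd i') sN.
Qed.

Hypotheses (eta_small : eta <= a / 4) (FN : suppin (fun k => (l1 k <= N)%N) F).

(** In the bracket of the truncated sum, the pairs (i, j) with i + j <= N cancel by the formal
    equation. At most (N + 1)^2 pairs remain, all with i + j > N, each carrying Q^(N + 1). Smallness
    of eta serves to bound q (1 + eta) by Q. *)
Lemma normal_form (Q := expR (- (a / 4))) : exists P : A,
  wnorm a (P - mono R (unit_act j0)) <= expR a * E1 * (Q / (1 - Q)) /\
  wnorm a (pbr P (l0 + F)) <=
    (N.+1)%:R ^+ 2 * ((N.*2.+1)%:R * (expR a * (2 / a * E))) * (expR a * E1) * Q ^+ N.+1.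
Proof.
have E1_ge0 : 0 <= E1 by rewrite !mulr_ge0 ?expR_ge0// ?invr_ge0 ltW.
have eta_ge0 : 0 <= eta by rewrite mulr_ge0.
have q_ge0 : 0 <= q by exact: expR_ge0.
have Q_ge0 : 0 <= Q by exact: expR_ge0.
have Q_lt1 : Q < 1 by rewrite expR_lt1 oppr_lt0 divr_gt0.
have qQ : q <= Q by rewrite ler_expR lerN2 ler_pM2l// lef_pV2 ?posrE// ler_nat.
have qeta : q * (1 + eta) <= Q.
  rewrite (le_trans (ler_wpM2l q_ge0 (lerD (lexx 1) eta_small)))//.
  rewrite (le_trans (ler_wpM2l q_ge0 (expR_ge1Dx _)))// -expRD ler_expR.
  by rewrite le_eqVlt; apply/orP; left; apply/eqP; field.
have [P [P0 Pconv Pbig Pdeg Pnorm]] := first_integral (leqnn N).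
have Pnorm' i : (0 < i)%N -> wnorm a (P i) <= expR a * E1 * Q ^+ i.
  case: i => // i _; rewrite (le_trans (Pnorm i.+1 isT))// -(mulrA (expR a * E1)).
  rewrite ler_wpM2l ?(mulr_ge0 (expR_ge0 _))// exprS exprS -mulrA -exprMn ler_pM ?exprn_ge0//.
    by rewrite mulr_ge0// addr_ge0.
  by apply: lerXn2r => //; rewrite nnegrE mulr_ge0// addr_ge0.
exists (\sum_(i < N.+1) P i); split.
  rewrite big_ord_recl /= P0 addrAC subrr add0r (le_trans (wnorm_sum _ _ _ _))//.
  apply: (@le_trans _ _ (\sum_(i < N) expR a * E1 * Q * Q ^+ i)).
    by apply: ler_sum => i _; rewrite -mulrA -exprS; exact: Pnorm'.
  rewrite -mulr_sumr -(mulrA (expR a * E1)) ler_wpM2l ?(mulr_ge0 (expR_ge0 _))//.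
  rewrite ler_wpM2l//.
  rewrite -[leRHS]mul1r ler_pdivlMr ?subr_gt0// mulrC.
  rewrite -opprB mulNr -subrX1 opprB lerBlDr lerDl exprn_ge0//.
have -> : pbr (\sum_(i < N.+1) P i) (l0 + F) =
    \sum_(i < N.+1) \sum_(N.+1 - i <= j < N.+1) pbr (P i) (hampart j).
  have -> : l0 + F = \sum_(j < N.+1) hampart j + homcomp 0 F.
    by rewrite {1}(homcomp_sum FN) !big_ord_recl /= addrCA addrC.
  rewrite pbrDr [X in _ + X](_ : _ = 0) ?addr0; last first.
    exact: (pbr_const _ (@suppin_homcomp _ _ 0%N F)).
  rewrite pbr_suml.
  transitivity (\sum_(i < N.+1) (\sum_(j < N.+1 - i) pbr (P i) (hampart j) +
    \sum_(N.+1 - i <= j < N.+1) pbr (P i) (hampart j))).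
    apply: eq_bigr => i _; rewrite pbr_sumr.
    rewrite -(big_mkord xpredT (fun j => pbr (P i) (hampart j))).
    rewrite -(big_mkord xpredT (fun j => pbr (P i) (hampart j))).
    by rewrite -big_cat_nat ?leq_subr.
  rewrite big_split /= -(triangular_sum (fun i j => pbr (P i) (hampart j))).
  rewrite big1 ?add0r// => k _; rewrite -conv_rev Pconv//.
  by rewrite -ltnS.
rewrite (le_trans (wnorm_sum _ _ _ _))//.
set X := (N.*2.+1)%:R * _; set Z := expR a * E1.
have X_ge0 : 0 <= X by rewrite !mulr_ge0 ?expR_ge0// ?invr_ge0 ltW.
have Z_ge0 : 0 <= Z by rewrite mulr_ge0 ?expR_ge0.
have XZ_ge0 : 0 <= X * Z * Q ^+ N.+1.
  by apply: mulr_ge0; [exact: mulr_ge0|exact: exprn_ge0].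
apply: (@le_trans _ _ (\sum_(i < N.+1) N.+1%:R * (X * Z * Q ^+ N.+1))); last first.
  rewrite sumr_const card_ord -[leLHS]mulr_natl.
  by move: (X) (Z) (Q ^+ N.+1) => x z w; rewrite expr2 !mulrA.
apply: ler_sum => i _; rewrite (le_trans (wnorm_sum _ _ _ _))//.
have [i0|i0] := posnP i.
  by rewrite big_geq ?i0 ?subn0// mulr_ge0.
apply: (@le_trans _ _ (\sum_(N.+1 - i <= j < N.+1) X * Z * Q ^+ N.+1)); last first.
  rewrite sumr_const_nat -[leLHS]mulr_natl ler_wpM2r// ler_nat.
  by rewrite subKn// ltnW.
rewrite big_nat [leRHS]big_nat; apply: ler_sum => j /andP[ij jN].
have j0' : (0 < j)%N by rewrite (leq_trans _ ij)// subn_gt0.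
have PS : suppin (fun k => (l1 k <= N.*2.+1)%N) (P i).
  apply: suppin_impl (Pdeg _) => k [k1 _]; rewrite (leq_trans k1)// ltnS leq_double.
  by rewrite -ltnS.
rewrite (le_trans (pbr_hampart_norm j0' PS))// -/X -!(mulrA X) ler_wpM2l//.
rewrite mulrC; apply: (@le_trans _ _ (Z * Q ^+ i * Q ^+ j)).
  rewrite ler_pM ?wnorm_ge0 ?exprn_ge0 ?Pnorm'//.
  by apply: lerXn2r; rewrite ?nnegrE.
rewrite -mulrA ler_wpM2l// -exprD ler_wiXn2l// ?(ltW Q_lt1)//.
by rewrite -leq_subLR.
Qed.

End NormalForm.

Transparent pbr hominv linpart.

(** * Evaluation of Laurent polynomials and Fourier approximation in several variables *)

Section Evaluation.
Variables (R : realType) (d : nat).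
Local Notation C := R[i].
Local Notation Z2 := 'rV[int]_d.
Local Notation A := (malg Z2 C).
Implicit Types (k l : Z2) (p q : A) (w : 'I_d -> C).

Definition kdot k w : C := \sum_(i < d) (k 0 i)%:~R * w i.

Lemma kdotD k l w : kdot (k + l) w = kdot k w + kdot l w.
Proof. by rewrite /kdot -big_split; apply: eq_bigr => i _; rewrite mxE rmorphD mulrDl. Qed.

Lemma kdotN k w : kdot (- k) w = - kdot k w.
Proof. by rewrite /kdot -sumrN; apply: eq_bigr => i _; rewrite mxE rmorphN mulNr. Qed.

Lemma kdot0 w : kdot 0 w = 0.
Proof. by rewrite /kdot big1// => i _; rewrite mxE mul0r. Qed.

Lemma kdot_delta i w : kdot (delta_mx 0 i) w = w i.
Proof.
rewrite /kdot (bigD1 i)//= mxE !eqxx mul1r big1 ?addr0// => j ji.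
by rewrite mxE (negPf ji) andbF mul0r.
Qed.

Lemma kdot_scale_delta z i w : kdot (z *: delta_mx 0 i) w = z%:~R * w i.
Proof.
rewrite /kdot (bigD1 i)//= !mxE !eqxx mulr1 big1 ?addr0// => j ji.
by rewrite !mxE (negPf ji) andbF mulr0 mul0r.
Qed.

Definition ev p w : C := mext (W := R[i]^o) (fun k => ce (kdot k w)) p.

Lemma evD p q w : ev (p + q) w = ev p w + ev q w.
Proof. exact: mextD. Qed.

Lemma evZ c p w : ev (c *: p) w = c * ev p w.
Proof. exact: mextZ. Qed.

Lemma evB p q w : ev (p - q) w = ev p w - ev q w.
Proof. by rewrite -scaleN1r evD evZ mulN1r. Qed.

Lemma evU k c w : ev (mkmalgU k c) w = c * ce (kdot k w).
Proof. exact: mextU. Qed.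

Lemma ev_sum I (r : seq I) (p : I -> A) w :
  ev (\sum_(i <- r) p i) w = \sum_(i <- r) ev (p i) w.
Proof. exact: mext_sum. Qed.

Lemma evE p w : ev p w = \sum_(k <- msupp p) mcoeff k p * ce (kdot k w).
Proof. by []. Qed.

Lemma Im_intM (z : int) (x : C) : complex.Im (z%:~R * x) = z%:~R * complex.Im x.
Proof.
have -> : (z%:~R : C) = (z%:~R : R)%:C by rewrite rmorph_int.
by case: x => u v; rewrite /= mul0r addr0.
Qed.

Lemma absz_intr (z : int) : `|z%:~R| = (absz z)%:R :> R.
Proof. by case: z => n; rewrite ?NegzE ?mulrNz ?normrN -pmulrn ?abszN normr_nat. Qed.

Lemma nm_ce_kdot (b : R) k w : (forall i, tpi * `|complex.Im (w i)| <= b) ->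
  nm (ce (kdot k w)) <= expR (b * (l1 k)%:R).
Proof.
move=> wb; rewrite nm_ce ler_expR.
have ImD (x y : C) : complex.Im (x + y) = complex.Im x + complex.Im y by case: x; case: y.
have -> : complex.Im (kdot k w) = \sum_(i < d) (k 0 i)%:~R * complex.Im (w i).
  rewrite /kdot (big_morph (@complex.Im R) ImD erefl).
  by apply: eq_bigr => i _; rewrite Im_intM.
rewrite -mulrN -sumrN mulr_sumr /l1 natr_sum mulr_sumr; apply: ler_sum => i _.
rewrite (le_trans (ler_norm _))// normrM normrN normrM (ger0_norm (ltW (tpi_gt0 R))).
by rewrite -absz_intr mulrCA mulrC ler_wpM2r.
Qed.

Lemma nm_ev (b : R) p w : (forall i, tpi * `|complex.Im (w i)| <= b) ->
  nm (ev p w) <= wnorm b p.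
Proof.
move=> wb; rewrite evE (le_trans (nm_sum _ _ _))// /wnorm; apply: ler_sum => k _.
by rewrite nmM ler_wpM2l ?nm_ge0// nm_ce_kdot.
Qed.

Definition shiftm (i : 'I_d) (z : int) p : A :=
  mext (fun k => mkmalgU (k + z *: delta_mx 0 i) 1) p.

Lemma ev_shiftm i z p w : ev (shiftm i z p) w = ce (z%:~R * w i) * ev p w.
Proof.
rewrite /shiftm /mext ev_sum evE mulr_sumr; apply: eq_bigr => k _.
by rewrite evZ evU mul1r kdotD ceD kdot_scale_delta [LHS]mulrA [LHS]mulrC.
Qed.

Lemma l1_scale_delta z i : l1 (z *: delta_mx 0 i : Z2) = absz z.
Proof.
rewrite /l1 (bigD1 i)//= !mxE !eqxx mulr1 big1 ?addn0// => j ji.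
by rewrite !mxE (negPf ji) andbF mulr0.
Qed.

Lemma wnorm_shiftm (b : R) i z p : 0 <= b ->
  wnorm b (shiftm i z p) <= expR (b * (absz z)%:R) * wnorm b p.
Proof.
move=> b0; apply: wnorm_mext => k _; rewrite wnormU nm1 mul1r -expRD ler_expR.
by rewrite -mulrDr ler_wpM2l// -natrD ler_nat addnC -(l1_scale_delta z i) l1D.
Qed.

End Evaluation.

Section MultiFourier.
Variables (R : realType) (d : nat).
Local Notation C := R[i].
Local Notation A := (malg 'rV[int]_d C).
Local Notation pt := ('I_d -> C).
Implicit Types (w : pt) (G : pt -> C) (s M : R).

Definition upd w i x : pt := fun j => if j == i then x else w j.

Lemma updK w i : upd w i (w i) = w.
Proof. by apply/funext => j; rewrite /upd; case: eqP => // ->. Qed.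

Lemma upd_same w i x y : upd (upd w i x) i y = upd w i y.
Proof. by apply/funext => j; rewrite /upd; case: eqP. Qed.

Lemma upd_swap w i j x y : i != j -> upd (upd w i x) j y = upd (upd w j y) i x.
Proof.
move=> ij; apply/funext => l; rewrite /upd; case: eqP => // ->.
by rewrite eq_sym (negPf ij).
Qed.

Lemma upd_eq w i x : upd w i x i = x.
Proof. by rewrite /upd eqxx. Qed.

Definition instrip s w := forall j, `|complex.Im (w j)| < s.

(** Holomorphy and periodicity in each variable separately: Fourier expansion and Cauchy's estimate
    are applied one variable at a time. *)
Definition pstrip s G := forall w i, instrip s w -> hstrip s (fun x => G (upd w i x)).

Lemma instrip_upd s w i x : instrip s w -> `|complex.Im x| < s -> instrip s (upd w i x).
Proof. by move=> ws xs j; rewrite /upd; case: eqP. Qed.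

Lemma hstrip_sum s n (g : 'I_n -> C -> C) :
  (forall j, hstrip s (g j)) -> hstrip s (fun x => \sum_(j < n) g j x).
Proof.
elim: n g => [|n IH] g hg.
  split=> w _; last by rewrite !big_ord0.
  exists 0; apply: cderiv_ext (cderiv_cst 0 w) => x; by rewrite big_ord0.
have [IH1 IH2] := IH (fun j => g (lift ord0 j)) (fun j => hg (lift ord0 j)).
have [g1 g2] := hg ord0; split=> w ws; last first.
  by rewrite !big_ord_recl g2// IH2.
have [d1 H1] := g1 w ws; have [d2 H2] := IH1 w ws; exists (d1 + d2).
by apply: cderiv_ext (cderivD H1 H2) => x; rewrite big_ord_recl.
Qed.

Lemma hstrip_scale s c g : hstrip s g -> hstrip s (fun x => c * g x).
Proof.
move=> [g1 g2]; split=> w ws; last by rewrite g2.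
by have [d1 H1] := g1 w ws; exists (c * d1); exact: cderivZ.
Qed.

Lemma hstrip_cst s c : hstrip s (fun=> c).
Proof. by split=> // w _; exists 0; exact: cderiv_cst. Qed.

Definition pcoef N i k G : pt -> C := fun w => dcoef N (fun x => G (upd w i x)) k.

Lemma pstrip_pcoef s N i k G : 0 < s -> pstrip s G -> pstrip s (pcoef N i k G).
Proof.
move=> s0 Gs w i' ws; apply: hstrip_scale; apply: hstrip_sum => j.
have [<-|ii] := eqVneq i i'.
  rewrite [X in hstrip _ X](_ : _ = fun=> G (upd w i (j%:R / N%:R : R)%:C) *
      ce ((- k)%:~R * (j%:R / N%:R : R)%:C)); first exact: hstrip_cst.
  by apply/funext => x; rewrite upd_same.
rewrite [X in hstrip _ X](_ : _ = fun x => ce ((- k)%:~R * (j%:R / N%:R : R)%:C) *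
   G (upd (upd w i (j%:R / N%:R : R)%:C) i' x)).
  by apply/hstrip_scale/Gs/instrip_upd => //=; rewrite normr0.
by apply/funext => x; rewrite mulrC upd_swap// eq_sym.
Qed.

Definition deponly (r : seq 'I_d) G :=
  forall w w', (forall j, j \in r -> w j = w' j) -> G w = G w'.

Lemma deponly_pcoef i r N k G : deponly (i :: r) G -> deponly r (pcoef N i k G).
Proof.
move=> Gr w w' ww; congr (_ * _); apply: eq_bigr => j _; congr (_ * _).
apply: Gr => l; rewrite in_cons /upd => /orP[/eqP ->|lr]; first by rewrite eqxx.
by case: eqP => // _; exact: ww.
Qed.

(** The cost of one variable: [apc] times a bound for the sum of exp(- tpi s |k| / 4) over the
    integers k. *)
Definition mfc s : R := apc s * (2 / (1 - expR (- (tpi * (s / 4))))).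

Lemma mfc_ge s : 0 < s -> apc s <= mfc s /\ 1 <= mfc s.
Proof.
move=> s0; have a3 := apc_ge3 s0.
have t0 : 0 < tpi * (s / 4) by rewrite mulr_gt0 ?tpi_gt0// divr_gt0.
have e1 := expRN_lt1 t0; have e0 := expR_gt0 (- (tpi * (s / 4))).
have : 1 <= 2 / (1 - expR (- (tpi * (s / 4)))).
  by rewrite ler_pdivlMr ?subr_gt0// mul1r; move: e0 e1; clear; lra.
rewrite /mfc => h; have h' : apc s <= apc s * (2 / (1 - expR (- (tpi * (s / 4))))).
  by rewrite ler_peMr//; move: a3; clear; lra.
by split => //; move: a3 h'; clear; lra.
Qed.

(** One variable is expanded at a time. Its discretised coefficients are again separately
    holomorphic and depend on the remaining variables only; norms and errors are summed over the
    modes, at the price of one factor [mfc]. *)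
Lemma fourier_induction s K r G M : 0 < s -> 0 <= M -> pstrip s G -> deponly r G ->
  (forall w, instrip s w -> nm (G w) <= M) -> exists p : A,
  wnorm (tpi * (s / 4)) p <= mfc s ^+ size r * M /\
  forall w, (forall i, `|complex.Im (w i)| <= s / 4) ->
    nm (G w - ev p w) <= (size r)%:R * mfc s ^+ size r * M * expR (- (tpi * (s / 4))) ^+ K.
Proof.
move=> s0; set b := tpi * (s / 4); set q := expR (- b).
have b0 : 0 < b by rewrite mulr_gt0 ?tpi_gt0// divr_gt0.
have [apm m1] := mfc_ge s0; have ap3 := apc_ge3 s0.
have [N HN] := discrete_fourier K s0.
elim: r G M => [|i r IH] G M M0 Gs Gr GM.
  exists (mkmalgU 0 (G (fun=> 0))); split.
    rewrite wnormU /l1 big1 ?mulr0 ?expR0 ?mulr1 ?expr0 ?mul1r; last by move=> i _; rewrite mxE.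
    by apply: GM => j /=; rewrite normr0.
  by move=> w _; rewrite evU kdot0 ce0 mulr1 (Gr w (fun=> 0))// subrr nm0 !mul0r.
have ap0 : 0 <= apc s by rewrite (le_trans _ ap3).
have q0 : 0 <= q by exact: expR_ge0.
(* The coefficients decay at the rate tpi s / 2: half of it pays for the weight b, half makes the
   sum over modes converge. *)
have qk (j : 'I_(K.*2.+1)) : expR (b * (absz (sidx j))%:R) * expR (- (tpi * (s / 2))) ^+ absz (sidx j)
    = q ^+ absz (sidx j).
  rewrite -!expRM_natl -expRD; congr expR; rewrite /b; by field.
have sb w : instrip s w -> sbound s (fun x => G (upd w i x)) M.
  by move=> ws x xs; apply/GM/instrip_upd.
pose Mk (j : 'I_(K.*2.+1)) := apc s * M * expR (- (tpi * (s / 2))) ^+ absz (sidx j).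
have Mk0 j : 0 <= Mk j by rewrite !mulr_ge0 ?exprn_ge0 ?expR_ge0.
have /choice[p Hp] (j : 'I_(K.*2.+1)) : exists p : A,
    wnorm b p <= mfc s ^+ size r * Mk j /\
    forall w, (forall i, `|complex.Im (w i)| <= s / 4) ->
      nm (pcoef N i (sidx j) G w - ev p w) <= (size r)%:R * mfc s ^+ size r * Mk j * q ^+ K.
  apply: IH => //; [exact: pstrip_pcoef|exact: deponly_pcoef|].
  by move=> w ws; apply: (HN _ _ (Gs w i ws) (sb w ws)).1; exact: sidx_le.
have mr0 : 0 <= mfc s ^+ size r by rewrite exprn_ge0// (le_trans _ m1).
have sumq : apc s * (\sum_(j < K.*2.+1) q ^+ absz (sidx j)) <= mfc s.
  by rewrite ler_wpM2l// sum_sidx_le// expR_ge0 expRN_lt1.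
exists (\sum_(j < K.*2.+1) shiftm i (sidx j) (p j)); split.
  rewrite (le_trans (wnorm_sum _ _ _ _))//.
  apply: (@le_trans _ _ (\sum_(j < K.*2.+1) mfc s ^+ size r * M * (apc s * q ^+ absz (sidx j)))).
    apply: ler_sum => j _; rewrite (le_trans (wnorm_shiftm _ _ _ (ltW b0)))//.
    rewrite (le_trans (ler_wpM2l (expR_ge0 _) (Hp j).1))// -qk /Mk.
    by move: (expR _) (_ ^+ absz _) (apc s) => x y z; rewrite le_eqVlt; apply/orP; left; apply/eqP; ring.
  rewrite -mulr_sumr -mulr_sumr exprS mulrC -[leRHS]mulrA ler_wpM2r//.
  by rewrite mulr_ge0.
move=> w ws; have ws' : instrip s w.
  by move=> j; rewrite (le_lt_trans (ws j))// ltr_pdivrMr// ltr_pMr// ltr1n.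
have := (HN _ _ (Gs w i ws') (sb w ws')).2 _ (ws i); rewrite updK -/b -/q => H1.
set S := \sum_(j < _) _ in H1.
have H2 : nm (S - ev (\sum_(j < K.*2.+1) shiftm i (sidx j) (p j)) w) <=
    (size r)%:R * mfc s ^+ size r * M * q ^+ K * mfc s.
  rewrite ev_sum /S -sumrB (le_trans (nm_sum _ _ _))//.
  apply: (@le_trans _ _ (\sum_(j < K.*2.+1) (size r)%:R * mfc s ^+ size r * M * q ^+ K *
      (apc s * q ^+ absz (sidx j)))); last first.
    by rewrite -mulr_sumr -mulr_sumr ler_wpM2l// !mulr_ge0 ?mr0 ?exprn_ge0.
  apply: ler_sum => j _; rewrite ev_shiftm [ce _ * ev _ _]mulrC -mulrBl nmM.
  have H3 : nm (ce ((sidx j)%:~R * w i)) <= expR (b * (absz (sidx j))%:R).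
    rewrite -kdot_scale_delta -(l1_scale_delta (sidx j) i); apply: nm_ce_kdot => l.
    by rewrite ler_pM2l ?tpi_gt0.
  rewrite (le_trans (ler_pM (nm_ge0 _) (nm_ge0 _) ((Hp j).2 w ws) H3))// -qk /Mk.
  by move: (expR _) (_ ^+ absz _) (apc s) => x y z; rewrite le_eqVlt; apply/orP; left; apply/eqP; ring.
have -> : G w - ev (\sum_(j < K.*2.+1) shiftm i (sidx j) (p j)) w =
  (G w - S) + (S - ev (\sum_(j < K.*2.+1) shiftm i (sidx j) (p j)) w) by rewrite addrA subrK.
rewrite (le_trans (nmD _ _))// (le_trans (lerD H1 H2))//.
rewrite /= -natr1 exprSr !mulrDl !mul1r addrC; apply: lerD; last first.
  rewrite ler_wpM2r ?exprn_ge0// ler_wpM2r// (le_trans apm)// ler_peMl ?(le_trans _ m1)//.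
  by rewrite exprn_ege1.
by rewrite le_eqVlt; apply/orP; left; apply/eqP; move: (mfc s) (q ^+ K) => x y; ring.
Qed.

(** [fourier_induction] truncates each variable by itself; here the terms of total degree above K
    are removed as well. Measured with weight tpi s / 4 but evaluated on the strip s / 8, they are
    smaller by exp(- tpi s K / 8), and turn the factor d into d + 1. *)
Lemma multi_fourier s K G M : 0 < s -> 0 <= M -> pstrip s G ->
  (forall w, instrip s w -> nm (G w) <= M) -> exists p : A,
  [/\ suppin (fun k => (l1 k <= K)%N) p,
      wnorm (tpi * (s / 4)) p <= mfc s ^+ d * M &
      forall w, (forall i, `|complex.Im (w i)| <= s / 8) ->
    nm (G w - ev p w) <= (d.+1)%:R * mfc s ^+ d * M * expR (- (tpi * (s / 8))) ^+ K].
Proof.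
move=> s0 M0 Gs GM; have [apm m1] := mfc_ge s0.
have [||p [p1 p2]] := @fourier_induction s K (enum 'I_d) G M s0 M0 Gs.
- by move=> w w' ww; congr G; apply/funext => j; apply: ww; rewrite mem_enum.
- exact: GM.
rewrite -cardE card_ord in p1 p2.
pose p' : A := mext (fun k => (l1 k <= K)%N%:R *: mkmalgU k 1) p.
have p'E k : mcoeff k p' = (l1 k <= K)%N%:R * mcoeff k p by exact: mcoeff_mext_diag.
exists p'; split.
- by move=> k; rewrite p'E; case: (leqP (l1 k) K) => // _; rewrite mul0r eqxx.
- apply: le_trans p1; rewrite -[leRHS]mul1r; apply: wnorm_le_scale => k; rewrite p'E mul1r.
  case: leqP => _; first by rewrite mul1r.
  by rewrite mul0r nm0 mul0r mulr_ge0 ?nm_ge0 ?expR_ge0.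
move=> w ws; set q := expR (- (tpi * (s / 8))).
have t0 := tpi_gt0 R.
have q1 : q < 1 by apply: expRN_lt1; rewrite mulr_gt0// divr_gt0.
have H1 : nm (G w - ev p w) <= d%:R * mfc s ^+ d * M * q ^+ K.
  rewrite (le_trans (p2 _ _))//.
    by move=> i; rewrite (le_trans (ws i))// ler_pM2l// lef_pV2 ?posrE// ler_nat.
  rewrite ler_wpM2l ?mulr_ge0 ?exprn_ge0 ?(le_trans _ m1)//.
  apply: lerXn2r; rewrite ?nnegrE ?expR_ge0// ler_expR lerN2 ler_pM2l// ler_pM2l//.
  by rewrite lef_pV2 ?posrE// ler_nat.
have H2 : nm (ev (p - p') w) <= mfc s ^+ d * M * q ^+ K.
  apply: (le_trans (@nm_ev R d (tpi * (s / 8)) (p - p') w _)).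
    by move=> i; rewrite ler_pM2l.
  apply: (@le_trans _ _ (q ^+ K * wnorm (tpi * (s / 4)) p)); last first.
    by rewrite mulrC ler_wpM2r ?exprn_ge0 ?expR_ge0.
  apply: wnorm_le_scale => k; rewrite mcoeffB p'E; case: leqP => lk.
    by rewrite mul1r subrr nm0 mul0r !mulr_ge0 ?exprn_ge0 ?nm_ge0 ?expR_ge0.
  rewrite [_%:R * _]mul0r subr0 [leRHS]mulrCA ler_wpM2l ?nm_ge0// -expRM_natl -expRD ler_expR.
  have : (K%:R : R) <= (l1 k)%:R by rewrite ler_nat ltnW.
  have : 0 <= tpi * s by rewrite mulr_ge0 ?ltW.
  have -> : tpi * (s / 8) = tpi * s / 8 by rewrite mulrA.
  have -> : tpi * (s / 4) = tpi * s / 4 by rewrite mulrA.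
  by move: (tpi * s) (K%:R) ((l1 k)%:R) => u x y; clear; nra.
have -> : G w - ev p' w = (G w - ev p w) + ev (p - p') w by rewrite evB addrA subrK.
rewrite (le_trans (nmD _ _))// (le_trans (lerD H1 H2))// -natr1 !mulrDl !mul1r.
exact: lexx.
Qed.

End MultiFourier.

(** * Derivative of a Laurent polynomial along a solution *)

Section ComplexCurves.
Variable R : realType.
Local Notation C := R[i].
Implicit Types (phi psi : R -> C) (t : R) (d : C).

Lemma rderiv_comp (f : C -> C) phi t d d' : rderiv phi t d -> cderiv f (phi t) d' ->
  rderiv (fun u => f (phi u)) t (d' * d).
Proof.
move=> gz fz e e0.
set A := nm d + 1 + nm d'.
have A0 : 0 < A by rewrite /A; have := nm_ge0 d; have := nm_ge0 d'; lra.
have e10 : 0 < e / A by rewrite divr_gt0.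
have [r r0 H] := fz _ e10; have [s s0 H'] := gz _ e10.
have [s1 s10 H1] := gz _ ltr01.
have D0 : 0 < nm d + 1 by have := nm_ge0 d; lra.
exists (Num.min s (Num.min s1 (r / (nm d + 1)))).
  by rewrite !lt_min s0 s10 divr_gt0.
move=> h; rewrite !lt_min => /and3P[hs ht hu].
have hg := H' _ hs.
set k := phi (t + h) - phi t.
have hk : nm k <= (nm d + 1) * `|h|.
  have -> : k = (k - d * h%:C) + d * h%:C by rewrite subrK.
  rewrite (le_trans (nmD _ _))// nmM nmC mulrDl mul1r addrC lerD2l.
  by have := H1 _ ht; rewrite mul1r.
have hr : nm k < r by rewrite (le_lt_trans hk)// mulrC -ltr_pdivlMr.
have := H _ hr; have -> : phi t + k = phi (t + h) by rewrite /k addrC subrK.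
move=> hf.
have -> : f (phi (t + h)) - f (phi t) - d' * d * h%:C =
  (f (phi (t + h)) - f (phi t) - d' * k) + d' * (phi (t + h) - phi t - d * h%:C).
  by rewrite /k; ring.
rewrite (le_trans (nmD _ _))// nmM.
have b1 : e / A * nm k <= e / A * ((nm d + 1) * `|h|) by rewrite ler_pM2l.
have b2 := ler_wpM2l (nm_ge0 d') hg.
apply: (le_trans (lerD (le_trans hf b1) b2)).
have -> : e / A * ((nm d + 1) * `|h|) + nm d' * (e / A * `|h|) =
  e / A * A * `|h| by rewrite /A; ring.
by rewrite divfK// gt_eqF.
Qed.

Lemma rderiv_cst (c : C) t : rderiv (fun=> c) t 0.
Proof.
move=> e e0; exists 1 => // h _.
by rewrite subrr mul0r subrr nm0 mulr_ge0// ltW.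
Qed.

Lemma rderivD phi psi t d d' : rderiv phi t d -> rderiv psi t d' ->
  rderiv (fun u => phi u + psi u) t (d + d').
Proof.
move=> Hf Hg e e0; have e2 : 0 < e / 2 by rewrite divr_gt0.
have [r r0 H] := Hf _ e2; have [s s0 H'] := Hg _ e2.
exists (Num.min r s); first by rewrite lt_min r0.
move=> h; rewrite lt_min => /andP[hr hs].
have -> : phi (t + h) + psi (t + h) - (phi t + psi t) - (d + d') * h%:C =
  (phi (t + h) - phi t - d * h%:C) + (psi (t + h) - psi t - d' * h%:C) by ring.
rewrite (le_trans (nmD _ _))// (le_trans (lerD (H _ hr) (H' _ hs)))//.
by rewrite -mulrDl -splitr.
Qed.

Lemma rderivZ c phi t d : rderiv phi t d -> rderiv (fun u => c * phi u) t (c * d).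
Proof.
move=> Hf; apply: (rderiv_comp (f := fun x => c * x) Hf).
by have := cderivZ c (cderiv_id (phi t)); rewrite mulr1.
Qed.

Lemma rderiv_sum I (r : seq I) (phi : I -> R -> C) (d : I -> C) t :
  (forall i, rderiv (phi i) t (d i)) ->
  rderiv (fun u => \sum_(i <- r) phi i u) t (\sum_(i <- r) d i).
Proof.
move=> H; elim: r => [|i r IH].
  rewrite big_nil (_ : (fun u => _) = fun=> 0); first exact: rderiv_cst.
  by apply/funext => u; rewrite big_nil.
rewrite big_cons (_ : (fun u => _) = fun u => phi i u + \sum_(j <- r) phi j u).
  exact: rderivD.
by apply/funext => u; rewrite big_cons.
Qed.

Lemma rderiv_real (f : R -> R) t (df : R) : is_derive t (1 : R) f df ->
  rderiv (fun u => (f u)%:C) t df%:C.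
Proof.
move=> /is_derive_epsP H e /H[r r0 Hr]; exists r => // h /Hr.
rewrite [h *: 1]mulr1 [h *: df]mulrC [h + t]addrC -rmorphM -!rmorphB nmC.
by [].
Qed.

Lemma rderiv_near phi psi t d (r : R) : 0 < r ->
  (forall u, `|u - t| < r -> phi u = psi u) -> rderiv phi t d -> rderiv psi t d.
Proof.
move=> r0 E H e /H[s s0 Hs]; exists (Num.min r s); first by rewrite lt_min r0.
move=> h; rewrite lt_min => /andP[hr hs].
by rewrite -!E ?subrr ?normr0// ?Hs// addrC addKr.
Qed.

End ComplexCurves.

HB.lock Definition ipi (R : realType) : R[i] := 'i * tpi%:C.
Arguments ipi {R}.

Lemma sum_combine (F : fieldType) I (r : seq I) (m dv c S1 S2 kd : I -> F) (ii rho : F) :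
  (forall k, ii * kd k = ii * dv k + rho * (S1 k + S2 k)) ->
  ii * (\sum_(k <- r) m k * (dv k * c k)) + rho * (\sum_(k <- r) m k * (c k * S1 k)) +
    rho * (\sum_(k <- r) m k * (c k * S2 k)) = \sum_(k <- r) m k * (ii * c k * kd k).
Proof.
move=> E; rewrite !mulr_sumr -!big_split /=; apply: eq_bigr => k _.
rewrite [ii * c k * _]mulrAC E; ring.
Qed.

Section CurveDerivative.
Variables (R : realType) (n : nat) (om : 'I_n -> R).
Local Notation C := R[i].
Local Notation Z2 := 'rV[int]_(n + n).
Local Notation A := (malg Z2 C).
Local Notation pt := ('I_(n + n) -> C).
Implicit Types (k l : Z2) (p : A) (w : pt).

Local Notation ii := (@ipi R).

Lemma ii_neq0 : ii != 0.
Proof.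
rewrite ipi.unlock mulf_neq0 ?neq0Ci//.
by apply/negP => /eqP/(congr1 (@complex.Re R)) /= /eqP; rewrite gt_eqF ?tpi_gt0.
Qed.

Definition evd p (j : 'I_(n + n)) w : C :=
  mext (W := R[i]^o) (fun l => ii * (l 0 j)%:~R * ce (kdot l w)) p.

Lemma evdE p j w : evd p j w =
  \sum_(l <- msupp p) mcoeff l p * (ii * (l 0 j)%:~R * ce (kdot l w)).
Proof. by []. Qed.

Lemma kdot_upd k w j x : kdot k (upd w j x) = (kdot k w - (k 0 j)%:~R * w j) + (k 0 j)%:~R * x.
Proof.
rewrite /kdot (bigD1 j)//= upd_eq [\sum_i _ * w i](bigD1 j)//= addrC [_ + \sum_(i | _) _]addrC addrK.
by congr (_ + _); apply: eq_bigr => i ij; rewrite /upd (negPf ij).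
Qed.

Lemma cderiv_sum I (r : seq I) (f : I -> C -> C) (d : I -> C) z :
  (forall i, cderiv (f i) z (d i)) ->
  cderiv (fun u => \sum_(i <- r) f i u) z (\sum_(i <- r) d i).
Proof.
move=> H; elim: r => [|i r IH].
  rewrite big_nil (_ : (fun u => _) = fun=> 0); first exact: cderiv_cst.
  by apply/funext => u; rewrite big_nil.
rewrite big_cons (_ : (fun u => _) = fun u => f i u + \sum_(j <- r) f j u).
  exact: cderivD.
by apply/funext => u; rewrite big_cons.
Qed.

Lemma cderiv_ev p w j x : cderiv (fun x => ev p (upd w j x)) x (evd p j (upd w j x)).
Proof.
rewrite evdE; have : cderiv (fun x => \sum_(l <- msupp p) mcoeff l p * ce (kdot l (upd w j x))) x
    (\sum_(l <- msupp p) mcoeff l p * (ii * (l 0 j)%:~R * ce (kdot l (upd w j x)))).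
  apply: cderiv_sum => l; apply: cderivZ.
  set c := kdot l w - (l 0 j)%:~R * w j.
  have H := @cderivZ R (ce c) _ _ _ (cderiv_ceM (l 0 j)%:~R x).
  rewrite ipi.unlock.
  rewrite kdot_upd -/c ceD mulrCA.
  by apply: cderiv_ext H => u; rewrite kdot_upd -/c ceD.
by apply: cderiv_ext.
Qed.

(** Hamilton's equations in the coordinates w. Since dI_i = 2 i pi rho X_i dw_{n+i}, the derivative
    of the perturbation in I_i is Gam_{n+i} / (2 i pi rho X_i), where Gam is its gradient in w. *)
Variables (w : R -> pt) (t : R) (dw Gam : pt) (rho : R) (P p : A).
Let X i : C := ce (w t (rshift n i)).
Hypotheses (rho0 : 0 < rho) (wd : forall j, rderiv (fun u => w u j) t (dw j))
  (dwl : forall i, dw (lshift n i) = (om i)%:C + Gam (rshift n i) / (ii * rho%:C * X i))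
  (dwr : forall i, dw (rshift n i) = - (Gam (lshift n i) / (ii * rho%:C * X i))).

Let err j : C := Gam j - evd p j (w t).

Lemma rderiv_kdot k : rderiv (fun u => kdot k (w u)) t (kdot k dw).
Proof. by apply: rderiv_sum => i; exact: rderivZ. Qed.

Lemma rderiv_ev_aux : rderiv (fun u => ev P (w u)) t
  (\sum_(k <- msupp P) mcoeff k P * (ii * ce (kdot k (w t)) * kdot k dw)).
Proof.
have : rderiv (fun u => \sum_(k <- msupp P) mcoeff k P * ce (kdot k (w u))) t
   (\sum_(k <- msupp P) mcoeff k P * (ii * ce (kdot k (w t)) * kdot k dw)).
  apply: rderiv_sum => k; apply: rderivZ; apply: rderiv_comp; first exact: rderiv_kdot.
  by rewrite ipi.unlock; exact: cderiv_ce.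
by [].
Qed.

Lemma kdot_dw k : ii * kdot k dw = ii * divisor om k + rho%:C^-1 *
  \sum_(i < n) (X i)^-1 * ((ang k i)%:~R * Gam (rshift n i) - (act k i)%:~R * Gam (lshift n i)).
Proof.
have r0 : rho%:C != 0 :> C.
  by apply/negP => /eqP/(congr1 (@complex.Re R)) /= /eqP; rewrite gt_eqF.
rewrite /kdot big_split_ord /= mulrDr !mulr_sumr /divisor rmorph_sum mulr_sumr -!big_split /=.
apply: eq_bigr => i _; have -> : (om i * (ang k i)%:~R)%:C = (om i)%:C * (ang k i)%:~R by rewrite rmorphM rmorph_int.
rewrite dwl dwr -/(ang k i) -/(act k i).
have := ii_neq0; have : X i != 0 by exact: ce_neq0.
move: (X i) ((ang k i)%:~R : C) ((act k i)%:~R : C) (Gam _) (Gam _) ((om i)%:C : C) => x a b g h o x0 i0.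
by field; rewrite x0 r0 i0.
Qed.

Lemma ev_pbr_linpart : ev (pbr P (linpart om)) (w t) =
  \sum_(k <- msupp P) mcoeff k P * (divisor om k * ce (kdot k (w t))).
Proof.
rewrite pbr_linpart /mext ev_sum; apply: eq_bigr => k _.
by rewrite !evZ evU mul1r.
Qed.

Lemma ev_pbr : ii * ev (pbr P p) (w t) =
  \sum_(k <- msupp P) mcoeff k P * (ce (kdot k (w t)) * \sum_(i < n)
    (X i)^-1 * ((ang k i)%:~R * evd p (rshift n i) (w t) - (act k i)%:~R * evd p (lshift n i) (w t))).
Proof.
rewrite /pbr /mext ev_sum mulr_sumr; apply: eq_bigr => k _.
rewrite evZ mulrCA; congr (_ * _); rewrite ev_sum !mulr_sumr.
under [RHS]eq_bigr do rewrite !evdE !mulr_sumr -sumrB !mulr_sumr.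
rewrite exchange_big /=; apply: eq_bigr => l _.
rewrite evZ /pbr0 ev_sum !mulr_sumr; apply: eq_bigr => i _.
have -> : (symp i k l)%:~R = (ang k i)%:~R * (act l i)%:~R - (act k i)%:~R * (ang l i)%:~R :> C.
  by rewrite /symp rmorphB !rmorphM.
rewrite evZ evU mul1r !kdotD kdotN kdot_delta !ceD ceN -/(X i).
rewrite -/(ang l i) -/(act l i).
by move: ((ang k i)%:~R : C) ((ang l i)%:~R : C) ((act k i)%:~R : C) ((act l i)%:~R : C) ((X i)^-1) (ce _) (ce _) (mcoeff _ _) => a b c d e f g h; ring.
Qed.

Let T (h : pt) k : C := \sum_(i < n)
  (X i)^-1 * ((ang k i)%:~R * h (rshift n i) - (act k i)%:~R * h (lshift n i)).

Lemma curve_rderiv_aux (a b e : C) :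
  a = \sum_(k <- msupp P) mcoeff k P * (divisor om k * ce (kdot k (w t))) ->
  ii * b = \sum_(k <- msupp P) mcoeff k P * (ce (kdot k (w t)) * T (fun j => evd p j (w t)) k) ->
  e = a + rho%:C^-1 * b -> rderiv (fun u => ev P (w u)) t (ii * e + rho%:C^-1 *
    \sum_(k <- msupp P) mcoeff k P * (ce (kdot k (w t)) * T err k)).
Proof.
move=> -> E2 ->; rewrite mulrDr [ii * (_ * b)]mulrCA E2.
rewrite (@sum_combine _ _ _ _ _ _ _ _ (fun k => kdot k dw)); first exact: rderiv_ev_aux.
move=> k; rewrite kdot_dw -big_split /=; congr (_ + _ * _); apply: eq_bigr => i _.
rewrite -mulrDr; congr (_ * _); rewrite /err.
by move: (Gam _) (Gam _) (evd _ _ _) (evd _ _ _) => a' b' c d; ring.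
Qed.

(** If Gam were the gradient of p, the derivative of P would be 2 i pi times its bracket with l + p
    / rho; the second term is the correction, linear in the difference [err] of the two
    gradients. *)
Lemma curve_rderiv : rderiv (fun u => ev P (w u)) t
  (ii * ev (pbr P (linpart om + rho%:C^-1 *: p)) (w t) + rho%:C^-1 *
    \sum_(k <- msupp P) mcoeff k P * (ce (kdot k (w t)) * T err k)).
Proof.
apply: (curve_rderiv_aux ev_pbr_linpart ev_pbr).
by rewrite pbrDr pbrZr evD evZ.
Qed.

Hypothesis X_lb : forall i, 1 / 2 <= nm (X i).

(** The lower bound on X gives a factor 2, and the length of the exponent is absorbed by the
    additional weight a, since a l <= exp(a l). *)
Lemma curve_rderiv_bound (a b H : R) : 0 <= b -> 0 < a -> 0 <= H ->
  (forall j, tpi * `|complex.Im (w t j)| <= b) -> (forall j, nm (err j) <= H) ->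
  exists2 d, rderiv (fun u => ev P (w u)) t d &
    nm d <= tpi * wnorm b (pbr P (linpart om + rho%:C^-1 *: p)) +
      rho^-1 * (2 * H / a * wnorm (a + b) P).
Proof.
move=> b0 a0 H0 wb eH; exists (ii * ev (pbr P (linpart om + rho%:C^-1 *: p)) (w t) + rho%:C^-1 *
    \sum_(k <- msupp P) mcoeff k P * (ce (kdot k (w t)) * T err k)); first exact: curve_rderiv.
rewrite (le_trans (nmD _ _))// lerD//.
  rewrite nmM ipi.unlock nmM nm_i mul1r nmC gtr0_norm ?tpi_gt0//.
  by rewrite ler_pM2l ?tpi_gt0// nm_ev.
rewrite nmM nmV nmC (gtr0_norm rho0) ler_pM2l ?invr_gt0//.
rewrite (le_trans (nm_sum _ _ _))// /wnorm mulr_sumr; apply: ler_sum => k _.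
rewrite nmM [leRHS]mulrCA ler_wpM2l ?nm_ge0// nmM.
have XI i : nm (X i)^-1 <= 2.
  have Xi := X_lb i; rewrite nmV -[leRHS]invrK lef_pV2 ?posrE ?invr_gt0//.
    by rewrite -div1r.
  by rewrite (lt_le_trans _ Xi).
have Tk : nm (T err k) <= 2 * H * (l1 k)%:R.
  rewrite /T (le_trans (nm_sum _ _ _))// /l1 natr_sum mulr_sumr big_split_ord /= -big_split /=.
  apply: ler_sum => i _; rewrite nmM -mulrDr -mulrA ler_pM ?nm_ge0//.
  rewrite (le_trans (nmB _ _))// !nmM !nm_int mulrDr ![H * _]mulrC.
  by rewrite lerD// ler_wpM2l.
rewrite (le_trans (ler_pM (nm_ge0 _) (nm_ge0 _) (nm_ce_kdot k wb) Tk))//.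
have -> : (a + b) * (l1 k)%:R = a * (l1 k)%:R + b * (l1 k)%:R by rewrite mulrDl.
rewrite expRD mulrC mulrA ler_wpM2r ?expR_ge0// -!(mulrA (2 * H)) ler_wpM2l ?mulr_ge0//.
rewrite -ler_pdivrMl ?invr_gt0// invrK.
by rewrite (le_trans _ (expR_ge1Dx _))// lerDr.
Qed.

End CurveDerivative.

Lemma wnorm_mono (R : realType) d (a b : R) (p : malg 'rV[int]_d R[i]) :
  a <= b -> wnorm a p <= wnorm b p.
Proof.
move=> ab; rewrite -[leRHS]mul1r; apply: wnorm_le_scale => k.
by rewrite mul1r ler_wpM2l ?nm_ge0// ler_expR ler_wpM2r.
Qed.

(** A cubic factor costs half of the rate: u <= (24 / a) exp(a u / 24), and the cube of this
    exponential is exp(a u / 8). *)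
Lemma cube_expR_le (R : realType) (a : R) (u : nat) : 0 < a ->
  u%:R ^+ 3 * expR (- (a / 4)) ^+ u <= (24 / a) ^+ 3 * expR (- (a / 8)) ^+ u.
Proof.
move=> a0; have ux : u%:R <= 24 / a * expR (a / 24 * u%:R).
  rewrite -[24 / a]invf_div ler_pdivlMl ?divr_gt0//.
  by rewrite (le_trans _ (expR_ge1Dx _))// lerDr.
have -> : expR (- (a / 8)) ^+ u = expR (a / 24 * u%:R) ^+ 3 * expR (- (a / 4)) ^+ u.
  by rewrite -!expRM_natl -expRD; congr expR; field.
rewrite mulrA -exprMn ler_wpM2r ?exprn_ge0 ?expR_ge0//.
by apply: lerXn2r; rewrite ?nnegrE// mulr_ge0 ?expR_ge0// divr_ge0// ltW.
Qed.

Section ApproximateIntegral.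
Variables (R : realType) (n : nat) (om : 'I_n -> R) (s rho : R).
Local Notation C := R[i].
Local Notation Z2 := 'rV[int]_(n + n).
Local Notation A := (malg Z2 C).
Local Notation pt := ('I_(n + n) -> C).
Hypothesis nonres : forall k : Z2, \sum_(i < n) om i * (ang k i)%:~R = 0 -> forall i, ang k i = 0.
Hypotheses (s0 : 0 < s) (rho0 : 0 < rho).

Definition curve_ode (w : R -> pt) (t : R) (dw Gam : pt) :=
  [/\ forall j, rderiv (fun u => w u j) t (dw j),
      forall i, dw (lshift n i) = (om i)%:C + Gam (rshift n i) / (ipi * rho%:C * ce (w t (rshift n i))) &
      forall i, dw (rshift n i) = - (Gam (lshift n i) / (ipi * rho%:C * ce (w t (rshift n i))))].

Lemma approximate_integral : exists B c4 : R, [/\ 0 < B, 0 < c4 &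
  forall (N : nat) (Y eps : R) (G : pt -> C), (0 < N)%N -> 1 <= Y -> 0 < eps -> B * (N%:R * Y) * eps <= 1 ->
  (forall k : Z2, (forall i, (absz (ang k i) <= N)%N) ->
     divisor om k = 0 \/ (nm (divisor om k))^-1 <= Y) ->
  pstrip s G -> (forall w, instrip s w -> nm (G w) <= eps) -> forall j0 : 'I_n,
  exists P : A,
   (forall w, (forall j, tpi * `|complex.Im (w j)| <= tpi * (s / 16)) ->
      nm (ev P w - ce (w (rshift n j0))) <= B * Y * eps) /\
   (forall w t dw Gam, curve_ode w t dw Gam ->
      (forall j, tpi * `|complex.Im (w t j)| <= tpi * (s / 16)) ->
      (forall i, 1 / 2 <= nm (ce (w t (rshift n i)))) ->
      (forall j, cderiv (fun x => G (upd (w t) j x)) (w t j) (Gam j)) ->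
      exists2 d, rderiv (fun u => ev P (w u)) t d &
        nm d <= B * eps * expR (- (c4 * N%:R)))].
Proof.
have t0 := tpi_gt0 R.
(* The weight tpi s / 4 of [multi_fourier] is 2 a, and the curve lives in the strip of weight tpi s
   / 16 = a / 2, which leaves a / 2 to absorb a derivative. *)
pose a : R := tpi * (s / 8); have a0 : 0 < a by rewrite mulr_gt0// divr_gt0.
pose M0 := mfc s ^+ (n + n); have [_ m1] := mfc_ge s0.
have M00 : 0 < M0 by rewrite exprn_gt0// (lt_le_trans _ m1).
have M0E : M0 = mfc s ^+ (n + n) by [].
have aE : a = tpi * (s / 8) by [].
clearbody M0 a.
pose A1 := expR a * (2 / a * (rho^-1 * M0)).
have A1E : A1 = expR a * (2 / a * (rho^-1 * M0)) by [].
have A10 : 0 < A1 by rewrite !mulr_gt0 ?expR_gt0 ?invr_gt0.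
clearbody A1.
pose Q := expR (- (a / 4)).
have QE : Q = expR (- (a / 4)) by [].
have Q0 : 0 < Q by exact: expR_gt0.
have Q1 : Q < 1 by apply: expRN_lt1; rewrite divr_gt0.
clearbody Q.
(* B1 ensures that eta is small, B2 bounds the distance from P to its first term, B3 the bracket of
   P, and B4 the effect of the gradient of G - p. *)
pose B1 := 3 * A1 * (4 / a).
have B1E : B1 = 3 * A1 * (4 / a) by [].
pose B2 := expR a * A1 * (Q / (1 - Q)).
have B2E : B2 = expR a * A1 * (Q / (1 - Q)) by [].
pose B3 := 2 * A1 * (expR a * (a / 4)) * (24 / a) ^+ 3.
have B3E : B3 = 2 * A1 * (expR a * (a / 4)) * (24 / a) ^+ 3 by [].
pose B4 := rho^-1 * (2 * (cauchyc * ((n + n).+1%:R * M0) / (s / 16)) / (a / 2) * (expR a + 1)).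
have B4E : B4 = rho^-1 * (2 * (cauchyc * ((n + n).+1%:R * M0) / (s / 16)) / (a / 2) * (expR a + 1)) by [].
have B10 : 0 < B1 by rewrite !mulr_gt0 ?invr_gt0.
have B20 : 0 < B2 by rewrite !mulr_gt0 ?expR_gt0 ?invr_gt0 ?subr_gt0.
have B30 : 0 < B3 by rewrite !mulr_gt0 ?expR_gt0 ?invr_gt0 ?exprn_gt0 ?divr_gt0.
have B40 : 0 < B4 by rewrite !mulr_gt0 ?invr_gt0 ?cauchyc_gt0 ?divr_gt0 ?addr_gt0 ?expR_gt0.
clearbody B1 B2 B3 B4.
have tB3 : 0 < tpi * B3 by rewrite mulr_gt0.
exists (B1 + B2 + tpi * B3 + B4), (a / 8); split.
- by rewrite !addr_gt0.
- by rewrite divr_gt0.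
set B := B1 + B2 + tpi * B3 + B4.
have BB1 : B1 <= B by rewrite /B; clear -B20 tB3 B40; lra.
have BB2 : B2 <= B by rewrite /B; clear -B10 tB3 B40; lra.
have BB34 : tpi * B3 + B4 <= B by rewrite /B; clear -B10 B20; lra.
have B0 : 0 < B := lt_le_trans B10 BB1.
clearbody B.
move=> N Y eps G N0 Y1 eps0 small divY Gs Gb j0.
have Y0 : 0 <= Y := le_trans ler01 Y1.
have [p [pN pnorm papprox]] := multi_fourier N s0 (ltW eps0) Gs Gb.
rewrite -M0E in pnorm papprox.
pose F : A := rho%:C^-1 *: p; pose E := rho^-1 * M0 * eps.
have EE : E = rho^-1 * M0 * eps by [].
have E0 : 0 <= E by rewrite !mulr_ge0 ?invr_ge0 ?(ltW rho0) ?(ltW M00) ?(ltW eps0).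
have FE : wnorm (a + a) F <= E.
  have -> : a + a = tpi * (s / 4) by rewrite aE; field.
  by rewrite wnormZ nmV nmC (gtr0_norm rho0) /E -mulrA ler_pM2l ?invr_gt0.
clearbody E.
have FN : suppin (fun k => (l1 k <= N)%N) F by exact: suppinZ.
have E1E : Y * (expR a * (2 / a * E)) = A1 * (Y * eps) by rewrite A1E EE; ring.
have N1 : 1 <= N%:R :> R by rewrite ler1n.
have small1 : B1 * (N%:R * Y) * eps <= 1.
  rewrite (le_trans _ small)// ler_wpM2r ?(ltW eps0)// ler_wpM2r// mulr_ge0//.
have eta : N.*2.+1%:R * (Y * (expR a * (2 / a * E))) <= a / 4.
  rewrite E1E; apply: (@le_trans _ _ (3 * N%:R * (A1 * (Y * eps)))).
    rewrite ler_wpM2r ?mulr_ge0 ?(ltW A10) ?(ltW eps0)//.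
    by rewrite -natrM ler_nat; move: N0; clear; lia.
  have -> : 3 * N%:R * (A1 * (Y * eps)) = a / 4 * (B1 * (N%:R * Y) * eps).
    by rewrite B1E; field; rewrite gt_eqF.
  by rewrite ler_piMr// divr_ge0// ltW.
have E1a : A1 * (Y * eps) <= a / 4.
  rewrite (le_trans _ eta)// E1E ler_peMl ?mulr_ge0 ?(ltW A10) ?(ltW eps0)//.
  by rewrite ler1n.
have [P [P1 P2]] := normal_form nonres j0 a0 Y0 E0 FE divY eta FN.
rewrite E1E -QE in P1 P2.
have P1' : wnorm a (P - mono R (unit_act j0)) <= B * Y * eps.
  rewrite (le_trans P1)//; apply: (@le_trans _ _ (B2 * (Y * eps))).
    by rewrite le_eqVlt; apply/orP; left; apply/eqP; rewrite B2E; ring.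
  by rewrite mulrA ler_wpM2r ?(ltW eps0)// ler_wpM2r.
have Pa : wnorm a P <= expR a + 1.
  have -> : P = mono R (unit_act j0) + (P - mono R (unit_act j0)) by rewrite addrC subrK.
  rewrite (le_trans (wnormD _ _ _))// lerD//.
    by rewrite wnormU nm1 mul1r l1_unit mulr1.
  rewrite (le_trans P1')// (le_trans _ small)// ler_wpM2r ?(ltW eps0)//.
  by rewrite ler_wpM2l ?(ltW B0)// ler_peMl.
have P2' : wnorm a (pbr P (linpart om + F)) <= B3 * eps * expR (- (a / 8 * N%:R)).
  rewrite (le_trans P2)//; set u : nat := N.+1.
  have AE : expR a * (2 / a * E) = A1 * eps by rewrite A1E EE; ring.
  rewrite AE; apply: (@le_trans _ _ (u%:R ^+ 2 * ((2 * u%:R) * (A1 * eps)) * (expR a * (a / 4)) * Q ^+ u)).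
    rewrite ler_wpM2r ?exprn_ge0 ?(ltW Q0)// ler_pM//.
    - by rewrite !mulr_ge0 ?exprn_ge0 ?(ltW A10) ?(ltW eps0).
    - by rewrite !mulr_ge0 ?expR_ge0 ?(ltW A10) ?(ltW eps0).
    - rewrite ler_wpM2l ?exprn_ge0// ler_wpM2r ?mulr_ge0 ?(ltW A10) ?(ltW eps0)//.
      by rewrite -natrM ler_nat /u mul2n doubleS leqnSn.
    by rewrite ler_wpM2l ?expR_ge0.
  apply: (@le_trans _ _ (2 * A1 * (expR a * (a / 4)) * eps * (u%:R ^+ 3 * Q ^+ u))).
    by rewrite le_eqVlt; apply/orP; left; apply/eqP; ring.
  apply: (@le_trans _ _ (2 * A1 * (expR a * (a / 4)) * eps * ((24 / a) ^+ 3 * expR (- (a / 8)) ^+ u))).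
    have cub := cube_expR_le u a0; rewrite -QE in cub; apply: ler_wpM2l cub.
    by rewrite !mulr_ge0 ?expR_ge0 ?invr_ge0 ?(ltW A10) ?(ltW eps0) ?(ltW a0).
  apply: (@le_trans _ _ (B3 * eps * expR (- (a / 8)) ^+ u)).
    by rewrite le_eqVlt; apply/orP; left; apply/eqP; rewrite B3E; ring.
  rewrite ler_wpM2l ?mulr_ge0 ?(ltW B30) ?(ltW eps0)// -expRM_natl ler_expR.
  have h : N%:R <= u%:R :> R by rewrite ler_nat.
  by rewrite mulrN lerN2 [leRHS]mulrC ler_wpM2l// divr_ge0// ltW.
exists P; split.
  move=> w wb; have -> : ev P w - ce (w (rshift n j0)) = ev (P - mono R (unit_act j0)) w.
    by rewrite evB evU mul1r kdot_delta.
  rewrite (le_trans (nm_ev _ wb))// (le_trans _ P1')//; apply: wnorm_mono.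
  by rewrite aE ler_pM2l// ler_pM2l// lef_pV2 ?posrE// ler_nat.
move=> w t dw Gam [wd dwl dwr] wb Xlb Gd.
have ws j : `|complex.Im (w t j)| <= s / 16 by have := wb j; rewrite ler_pM2l.
pose Err := (n + n).+1%:R * M0 * eps * expR (- (tpi * (s / 8))) ^+ N.
have ws' : instrip s (w t).
  by move=> j; rewrite (le_lt_trans (ws j))// ltr_pdivrMr// ltr_pMr// ltr1n.
(* Cauchy's estimate in the j-th variable: discs of radius s / 16 centred in the strip s / 16 remain
   in the strip s / 8, where p approximates G. *)
have errH j : nm (Gam j - evd p j (w t)) <= cauchyc * Err / (s / 16).
  have s16 : 0 < s / 16 by rewrite divr_gt0.
  have xs x : nm (x - w t j) < s / 16 -> `|complex.Im x| <= s / 8.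
    move=> h; have -> : x = w t j + (x - w t j) by rewrite addrC subrK.
    have -> : s / 8 = s / 16 + s / 16 by field.
    rewrite cImD (le_trans (ler_normD _ _))// lerD//.
    by rewrite (le_trans (nm_Im _)) ?(ltW h).
  have xs' x : nm (x - w t j) < s / 16 -> `|complex.Im x| < s.
    by move=> /xs h; rewrite (le_lt_trans h)// ltr_pdivrMr// ltr_pMr// ltr1n.
  apply: (@cauchy_estimate R (fun x => G (upd (w t) j x) - ev p (upd (w t) j x)) (w t j)) => //.
  - move=> x /xs' h; have [d1 H1] := (Gs (w t) j ws').1 x h.
    by exists (d1 - evd p j (upd (w t) j x)); apply: cderivB => //; exact: cderiv_ev.
  - move=> x h; apply: papprox => i; rewrite /upd; case: eqP => _; first exact: xs.
    by rewrite (le_trans (ws i))// ler_pM2l// lef_pV2 ?posrE// ler_nat.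
  apply: cderivB => //.
  by have := cderiv_ev p (w t) j (w t j); rewrite updK.
have Err0 : 0 <= Err by rewrite !mulr_ge0 ?exprn_ge0 ?expR_ge0 ?(ltW M00) ?(ltW eps0).
have H0 : 0 <= cauchyc * Err / (s / 16).
  apply: divr_ge0; last by rewrite divr_ge0// ltW.
  by apply: mulr_ge0 => //; exact: ltW (cauchyc_gt0 R).
have b0 : 0 <= tpi * (s / 16) by rewrite mulr_ge0 ?(ltW t0)// divr_ge0 ?(ltW s0).
have [d Hd dle] := @curve_rderiv_bound R n om w t dw Gam rho P p rho0 wd dwl dwr Xlb
   (a / 2) (tpi * (s / 16)) _ b0 (divr_gt0 a0 (ltr0Sn _ _)) H0 wb errH.
exists d => //; rewrite (le_trans dle)//.
have -> : a / 2 + tpi * (s / 16) = a by rewrite aE; field.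
set q := expR (- (a / 8 * N%:R)).
apply: (@le_trans _ _ ((tpi * B3 + B4) * eps * q)); last first.
  by rewrite ler_wpM2r ?expR_ge0// ler_wpM2r// ltW.
have -> : (tpi * B3 + B4) * eps * q = tpi * (B3 * eps * q) + B4 * eps * q.
  by clearbody q; ring.
apply: lerD.
  rewrite ler_pM2l// (le_trans _ P2')//; apply: wnorm_mono.
  by rewrite aE ler_pM2l// ler_pM2l// lef_pV2 ?posrE// ler_nat.
have Eq : Err <= (n + n).+1%:R * M0 * eps * q.
  rewrite ler_wpM2l ?mulr_ge0 ?(ltW M00) ?(ltW eps0)//.
  rewrite -aE -expRM_natl /q ler_expR mulrN lerN2 [leRHS]mulrC ler_wpM2r//.
  by rewrite ler_pdivrMr// ler_peMr ?ler1n// ltW.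
rewrite B4E -!(mulrA rho^-1) ler_pM2l ?invr_gt0//.
apply: (@le_trans _ _ (2 * (cauchyc * ((n + n).+1%:R * M0 * eps * q) / (s / 16)) / (a / 2) * (expR a + 1))).
  rewrite ler_pM ?wnorm_ge0//.
    apply: divr_ge0; last by rewrite divr_ge0// ltW.
    exact: mulr_ge0.
  rewrite ler_wpM2r ?invr_ge0 ?divr_ge0 ?(ltW a0)// ler_pM2l// ler_wpM2r ?invr_ge0 ?divr_ge0 ?(ltW s0)//.
  by rewrite ler_pM2l ?cauchyc_gt0.
by rewrite le_eqVlt; apply/orP; left; apply/eqP; ring.
Qed.

End ApproximateIntegral.

(** * The perturbation in exponential coordinates *)

Section VectorNorms.
Variables (R : realType) (n : nat).
Local Notation C := R[i].

Lemma mx_entry_le (x : 'rV[R]_n) i : `|x 0 i| <= `|x|.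
Proof.
rewrite [leRHS]/Num.norm/= mx_normrE.
by rewrite (le_trans _ (@le_bigmax _ _ _ _ (fun i : 'I_1 * 'I_n => `|x i.1 i.2|) (0, i))).
Qed.

Lemma mx_norm_le (x : 'rV[R]_n) (e : R) : 0 <= e -> (forall i, `|x 0 i| <= e) -> `|x| <= e.
Proof.
move=> e0 xe; rewrite [leLHS]/Num.norm/= mx_normrE.
by apply: bigmax_le => //= -[i j] _ /=; rewrite ord1.
Qed.

Lemma mx_norm_lt (x : 'rV[R]_n) (e : R) : 0 < e -> (forall i, `|x 0 i| < e) -> `|x| < e.
Proof.
move=> e0 xe; rewrite [ltLHS]/Num.norm/= mx_normrE.
by apply: bigmax_lt => //= -[i j] _ /=; rewrite ord1.
Qed.

Lemma cmx_norm_lt (x : 'rV[R[i]^o]_n) (e : R) : 0 < e ->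
  (forall i, nm (x 0 i) < e) -> complex.Re `|x| < e.
Proof.
move=> e0 xe; have [->|x0] := eqVneq `|x| 0; first by [].
have [[i j] /= E] := mx_norm_neq0 x0.
have -> : `|x| = `|x i j| by exact: E.
by rewrite ord1; have := xe j; rewrite nm.unlock.
Qed.

End VectorNorms.

Section Slices.
Variable R : realType.
Local Notation C := R[i].

(** Restricting F to a complex line reduces differentiability over the scalars R[i] to functions of
    one complex variable. *)
Lemma derivable_cderiv (V : normedModType R[i]) (F : V -> R[i]^o) (a v : V) :
  derivable F a v -> cderiv (fun x : C => F (x *: v + a)) 0 ('D_v F a).
Proof.
move=> Fd e e0; have eC : 0 < e%:C :> C by rewrite ltcR.
rewrite /derivable in Fd; have := (cvgrPdist_le _ _).1 Fd.
move=> /(_ _ _ eC).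
rewrite -/('D_v F a).
move=> /nbhs_ballP[r /= r0 H].
exists (complex.Re r); first by move: r0; rewrite ltcE /= => /andP[].
move=> h hr; have [->|h0] := eqVneq h 0.
  by rewrite add0r subrr mulr0 subrr nm0 mulr0.
have rE : r = (complex.Re r)%:C.
  by move: r0; rewrite ltcE /= => /andP[/eqP i0 _]; apply: complex_eq.
have : `|'D_v F a - h^-1 *: (F (h *: v + a) - F a)| <= e%:C.
  apply: H => //; rewrite -ball_normE /= sub0r normrN rE ltcE /=.
  by rewrite [X in X && _]eqxx /=; move: hr; rewrite nm.unlock.
rewrite lecE /= => /andP[_ Hle].
rewrite add0r scale0r add0r.
have -> : F (h *: v + a) - F a - 'D_v F a * h = - h * ('D_v F a - h^-1 *: (F (h *: v + a) - F a)).
  by rewrite mulrBr mulNr [_ * (_ *: _)]mulNr mulVKf// opprK addrC mulrC.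
rewrite nmM nmN mulrC ler_wpM2r ?nm_ge0// nm.unlock.
exact: Hle.
Qed.

End Slices.

Section ComplexExtension.
Variables (R : realType) (n : nat) (a : 'rV[R]_n.+1) (r sigma eps : R).
Local Notation C := R[i].
Local Notation phase := ('rV[R]_n.+1 * 'rV[R]_n.+1)%type.
Local Notation cphase := ('rV[R[i]^o]_n.+1 * 'rV[R[i]^o]_n.+1)%type.
Local Notation pt := ('I_(n.+1 + n.+1) -> C).
Variables (f : phase -> R) (F : cphase -> R[i]^o).
Hypotheses (sigma0 : 0 < sigma) (hF : holomorphic_extension sigma (ball a r) f F)
  (Fb : (cfun_norm sigma (ball a r) F <= eps%:E)%E).

Lemma in_cnbhd (z : cphase) (c : 'rV[R]_n.+1) : ball a r c ->
  (forall i, `|complex.Im (z.1 0 i)| < sigma) ->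
  (forall i, nm (z.2 0 i - (c 0 i)%:C) < sigma) -> cnbhd sigma (ball a r) z.
Proof.
move=> Bc z1 z2; split; first by apply: mx_norm_lt => // i; rewrite mxE.
apply: (@le_lt_trans _ _ (complex.Re `|z.2 - cvec c|)).
  apply: ge_inf; last by exists c.
  by exists 0 => _ [J _ <-]; have := normr_ge0 (z.2 - cvec J); rewrite lecE => /andP[].
by apply: cmx_norm_lt => // i; rewrite !mxE; exact: z2.
Qed.

Lemma nm_extension z : cnbhd sigma (ball a r) z -> nm (F z) <= eps.
Proof.
move=> hz; rewrite -lee_fin (le_trans _ Fb)//; apply: ereal_sup_ubound.
by exists z => //; rewrite nm.unlock.
Qed.

Definition cphase_of (z : phase) : cphase := (cvec z.1, cvec z.2).

Lemma cphase_in z : ball a r z.2 -> cnbhd sigma (ball a r) (cphase_of z).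
Proof.
move=> Bz; apply: (in_cnbhd Bz) => i; first by rewrite mxE /= normr0.
by rewrite mxE subrr nm0.
Qed.

Definition cdir (v : phase) : cphase := cphase_of v.

Lemma cphase_line (z v : phase) (h : R) :
  cphase_of (h *: v + z) = (h%:C : C) *: cdir v + cphase_of z.
Proof.
by congr pair; apply/rowP => i; rewrite !mxE rmorphD rmorphM.
Qed.

Lemma ball_line (z v : phase) : ball a r z.2 -> exists2 e : R, 0 < e &
  forall h : R, `|h| < e -> ball a r (h *: v + z).2.
Proof.
have v0 : 0 < `|v.2| + 1 by rewrite ltr_wpDl.
rewrite -ball_normE /= => Bz; exists ((r - `|a - z.2|) / (`|v.2| + 1)).
  by rewrite divr_gt0 ?subr_gt0.
move=> h; rewrite ltr_pdivlMr// => hh.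
rewrite (_ : a - _ = (a - z.2) - h *: v.2); last by rewrite opprD addrA addrAC.
rewrite (le_lt_trans (ler_normB _ _))// normrZ -ltrBrDl (le_lt_trans _ hh)//.
by rewrite ler_wpM2l// lerDl.
Qed.

(** Along a real direction the increments of F are those of f, hence real, and so is their limit. *)
Lemma real_partial (z v : phase) : ball a r z.2 ->
  is_derive z v f (complex.Re ('D_(cdir v) F (cphase_of z))) /\
  'D_(cdir v) F (cphase_of z) = (complex.Re ('D_(cdir v) F (cphase_of z)))%:C.
Proof.
move=> Bz; have [Fd _ Ff] := hF.
have Fdz := Fd _ (cphase_in Bz).
have := derivable_cderiv (diff_derivable (v := cdir v) Fdz).
set D := 'D_(cdir v) F (cphase_of z) => HD.
have [e0 e00 He0] := ball_line v Bz.
have key e : 0 < e -> exists2 d : R, 0 < d & forall h : R, `|h| < d ->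
    nm ((f (h *: v + z) - f z)%:C - D * h%:C) <= e * `|h|.
  move=> /HD[d d0 Hd]; exists (Num.min d e0); first by rewrite lt_min d0.
  move=> h; rewrite lt_min => /andP[hd he].
  have := Hd h%:C; rewrite nmC => /(_ hd); rewrite add0r scale0r add0r -cphase_line.
  have FfE y : ball a r y.2 -> F (cphase_of y) = (f y)%:C.
    by move=> By; rewrite /cphase_of Ff//; case: y {By}.
  have E1 := FfE _ (He0 _ he); have E2 := FfE _ Bz.
  have -> : (f (h *: v + z) - f z)%:C = F (cphase_of (h *: v + z)) - F (cphase_of z).
    by rewrite E1 E2 rmorphB.
  by [].
split.
  apply/is_derive_epsP => e /key[d d0 Hd]; exists d => // h /Hd; apply: le_trans.
  rewrite (le_trans _ (nm_Re _))// cReB cReM /= mulr0 subr0 le_eqVlt; apply/orP; left.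
  by rewrite [h *: complex.Re D]mulrC.
have Im0 : complex.Im D = 0.
  apply/eqP; rewrite -normr_eq0 eq_le normr_ge0 andbT; apply: le0_eps => e e1.
  have [d d0 Hd] := key _ e1.
  have d2 : 0 < d / 2 by rewrite divr_gt0.
  have := Hd (d / 2); rewrite gtr0_norm// ltr_pdivrMr// ltr_pMr// ltr1n => /(_ isT).
  move=> /(le_trans (nm_Im _)); rewrite cImB cImM /= mulr0 !add0r normrN normrM.
  by rewrite (gtr0_norm d2) ler_pM2r.
by apply: complex_eq.
Qed.

Variable om : 'rV[R]_n.+1.
Definition ham (x : phase) : R := rdot om x.2 + f x.

Lemma ham_partial (z v : phase) : ball a r z.2 ->
  'D_v ham z = rdot om v.2 + complex.Re ('D_(cdir v) F (cphase_of z)).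
Proof.
move=> /(real_partial v)[fd _].
suff H : is_derive z v ham (rdot om v.2 + complex.Re ('D_(cdir v) F (cphase_of z))).
  exact: (@derive_val _ _ _ _ _ _ _ H).
apply/is_derive_epsP => e e0; have /is_derive_epsP/(_ e e0)[d d0 Hd] := fd.
exists d => // h /Hd; apply: le_trans; rewrite /ham.
have -> : rdot om (h *: v + z).2 = h * rdot om v.2 + rdot om z.2.
  rewrite /rdot mulr_sumr -big_split; apply: eq_bigr => i _ /=.
  by rewrite !mxE mulrDr mulrCA.
rewrite [_ *: (_ + _)]mulrDr [_ *: complex.Re _]/GRing.scale /=.
rewrite le_eqVlt; apply/orP; left; apply/eqP; congr (`|_|).
by move: (f _) (f _) (rdot _ _) (rdot _ _) (h * complex.Re _) => x y u v' w; ring.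
Qed.

Definition dF1 (z : cphase) (i : 'I_n.+1) : C := 'D_(delta_mx 0 i, 0) F z.
Definition dF2 (z : cphase) (i : 'I_n.+1) : C := 'D_(0, delta_mx 0 i) F z.

Lemma cdir1 i : cdir ('e_i, 0) = (delta_mx 0 i, 0).
Proof.
by congr pair; apply/rowP => j; rewrite !mxE//; case: (_ && _).
Qed.

Lemma cdir2 i : cdir (0, 'e_i) = (0, delta_mx 0 i).
Proof.
by congr pair; apply/rowP => j; rewrite !mxE//; case: (_ && _).
Qed.

Lemma rdot0 : rdot om 0 = 0.
Proof. by rewrite /rdot big1// => i _; rewrite mxE mulr0. Qed.

Lemma rdot_delta i : rdot om 'e_i = om 0 i.
Proof.
rewrite /rdot (bigD1 i)//= !mxE !eqxx mulr1 big1 ?addr0// => j ji.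
by rewrite mxE (negPf ji) andbF mulr0.
Qed.

Lemma ham_fieldE z : ball a r z.2 -> ham_field ham z =
  (\row_i (om 0 i + complex.Re (dF2 (cphase_of z) i)),
   - \row_i complex.Re (dF1 (cphase_of z) i)).
Proof.
move=> Bz.
have E1 i : 'D_('e_i, 0) ham z = complex.Re (dF1 (cphase_of z) i).
  by rewrite (ham_partial _ Bz) rdot0 add0r cdir1.
have E2 i : 'D_(0, 'e_i) ham z = om 0 i + complex.Re (dF2 (cphase_of z) i).
  by rewrite (ham_partial _ Bz) rdot_delta cdir2.
apply: (f_equal2 pair); last apply: (f_equal -%R).
  by apply/rowP => i; rewrite !mxE E2.
by apply/rowP => i; rewrite !mxE E1.
Qed.

Lemma dF1_real z i : ball a r z.2 -> dF1 (cphase_of z) i = (complex.Re (dF1 (cphase_of z) i))%:C.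
Proof. by move=> /(real_partial ('e_i, 0))[_]; rewrite cdir1. Qed.

Lemma dF2_real z i : ball a r z.2 -> dF2 (cphase_of z) i = (complex.Re (dF2 (cphase_of z) i))%:C.
Proof. by move=> /(real_partial (0, 'e_i))[_]; rewrite cdir2. Qed.

Variables (c : 'rV[R]_n.+1) (rho s : R).
Hypotheses (Bc : ball a r c) (rho0 : 0 < rho) (rhos : 3 * rho < sigma)
  (ssigma : s <= sigma) (es2 : expR (tpi * s) <= 2).

Definition chart (w : pt) : cphase :=
  (\row_i w (lshift n.+1 i), \row_i ((c 0 i - rho)%:C + rho%:C * ce (w (rshift n.+1 i)))).

Definition chartF (w : pt) : C := F (chart w).

(** On the strip |e(w)| <= 2, so that |e(w) - 1| <= 3 and the complex actions stay within 3 rho <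
    sigma of the real point c. *)
Lemma chart_in w : instrip s w -> cnbhd sigma (ball a r) (chart w).
Proof.
move=> ws; apply: (in_cnbhd Bc) => i; rewrite mxE.
  by rewrite (lt_le_trans (ws _)).
have -> : (c 0 i - rho)%:C + rho%:C * ce (w (rshift n.+1 i)) - (c 0 i)%:C =
    rho%:C * (ce (w (rshift n.+1 i)) - 1).
  by rewrite rmorphB; ring.
rewrite nmM nmC gtr0_norm// (le_lt_trans _ rhos)// mulrC ler_pM2r//.
rewrite (le_trans (nmB _ _))// nm1 -lerBrDr (_ : 3 - 1 = 2); last by lra.
rewrite nm_ce (le_trans _ es2)// ler_expR -mulrN ler_pM2l ?tpi_gt0//.
by rewrite (le_trans (ler_norm _))// normrN ltW.
Qed.

Lemma chart_upd_l w i x : chart (upd w (lshift n.+1 i) x) =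
  (x - w (lshift n.+1 i)) *: (delta_mx 0 i, 0) + chart w.
Proof.
congr pair; apply/rowP => j; rewrite !mxE /upd.
  rewrite eq_lshift eqxx andTb; case: (eqVneq j i) => [->|_]; first by rewrite mulr1 subrK.
  by rewrite mulr0 add0r.
by rewrite eq_rlshift mulr0 add0r.
Qed.

Lemma chart_upd_r w i x : chart (upd w (rshift n.+1 i) x) =
  (rho%:C * ce x - rho%:C * ce (w (rshift n.+1 i))) *: (0, delta_mx 0 i) + chart w.
Proof.
congr pair; apply/rowP => j; rewrite !mxE /upd.
  by rewrite eq_lrshift mulr0 add0r.
rewrite eq_rshift eqxx andTb; case: (eqVneq j i) => [->|_].
  by rewrite mulr1 addrCA subrK.
by rewrite mulr0 add0r.
Qed.

Lemma cderiv_chart_l w i : instrip s w ->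
  cderiv (fun x => chartF (upd w (lshift n.+1 i) x)) (w (lshift n.+1 i)) (dF1 (chart w) i).
Proof.
move=> ws; have [Fd _ _] := hF.
have H := derivable_cderiv (diff_derivable (v := (delta_mx 0 i, 0)) (Fd _ (chart_in ws))).
have : cderiv (fun x : C => F ((x - w (lshift n.+1 i)) *: (delta_mx 0 i, 0) + chart w))
    (w (lshift n.+1 i)) (dF1 (chart w) i).
  by apply: (@cderiv_shift R (fun x => F (x *: (delta_mx 0 i, 0) + chart w))); rewrite subrr.
by apply: cderiv_ext => x; rewrite /chartF chart_upd_l.
Qed.

Lemma cderiv_chart_r w i : instrip s w ->
  cderiv (fun x => chartF (upd w (rshift n.+1 i) x)) (w (rshift n.+1 i))
    (dF2 (chart w) i * (rho%:C * (ipi * ce (w (rshift n.+1 i))))).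
Proof.
move=> ws; have [Fd _ _] := hF.
have H := derivable_cderiv (diff_derivable (v := (0, delta_mx 0 i)) (Fd _ (chart_in ws))).
set x0 := w (rshift n.+1 i).
have : cderiv (fun x : C => F ((rho%:C * ce x - rho%:C * ce x0) *: (0, delta_mx 0 i) + chart w))
    x0 (dF2 (chart w) i * (rho%:C * (ipi * ce x0))).
  apply: (@cderiv_comp R (fun x => F (x *: (0, delta_mx 0 i) + chart w))
     (fun x => rho%:C * ce x - rho%:C * ce x0)); last by rewrite subrr.
  rewrite -[X in cderiv _ _ X]subr0; apply: cderivB; last exact: cderiv_cst.
  by apply: cderivZ; rewrite ipi.unlock; exact: cderiv_ce.
by apply: cderiv_ext => x; rewrite /chartF chart_upd_r.
Qed.

(** In the angles, periodicity is that of F; in the other variables the chart creates it, since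
    w_{n+i} only enters through e(w_{n+i}). *)
Lemma pstrip_chartF : pstrip s chartF.
Proof.
move=> w i ws; split => x xs.
  have ws' := instrip_upd i ws xs.
  have -> : (fun y => chartF (upd w i y)) = (fun y => chartF (upd (upd w i x) i y)).
    by apply/funext => y; rewrite upd_same.
  rewrite -{2}[x](upd_eq w i x); case: (splitP i) => j ij.
    have -> : i = lshift n.+1 j by exact: val_inj.
    by exists (dF1 (chart (upd w (lshift n.+1 j) x)) j); apply: cderiv_chart_l; rewrite (_ : lshift n.+1 j = i)//; exact: val_inj.
  have ij' : i = rshift n.+1 j by exact: val_inj.
  by rewrite ij' in ws' *; eexists; exact: cderiv_chart_r.
case: (splitP i) => j ij.
  have ij' : i = lshift n.+1 j by exact: val_inj.
  have [_ Fp _] := hF.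
  rewrite /chartF -(Fp (delta_mx 0 j) (chart (upd w i x))); last exact/chart_in/instrip_upd.
  congr F; rewrite ij'; congr pair; apply/rowP => l; rewrite !mxE /upd.
    rewrite eq_lshift eqxx andTb; case: (eqVneq l j) => _ //.
    by rewrite addr0.
  by rewrite eq_rlshift.
have ij' : i = rshift n.+1 j by exact: val_inj.
rewrite /chartF ij'; congr F; congr pair; apply/rowP => l; rewrite !mxE /upd.
  by rewrite eq_lrshift.
by rewrite eq_rshift; case: eqP => // _; rewrite ceD ce1 mulr1.
Qed.

Lemma nm_chartF w : instrip s w -> nm (chartF w) <= eps.
Proof. by move=> /chart_in; exact: nm_extension. Qed.

End ComplexExtension.

(** * Real solutions in the exponential chart, and confinement of the actions *)

Section RealCurves.
Variable R : realType.

Lemma is_derive_affine (g : R -> R) (t k e dg : R) : is_derive t (1 : R) g dg ->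
  is_derive t (1 : R) (fun u => k * g u + e) (k * dg).
Proof.
move=> /is_derive_epsP H; apply/is_derive_epsP => e0 e00.
have k1 : 0 < `|k| + 1 by rewrite ltr_wpDl.
have [d d0 Hd] := H _ (divr_gt0 e00 k1); exists d => // h /Hd Hh.
have -> : k * g (h *: 1 + t) + e - (k * g t + e) - h *: (k * dg) =
    k * (g (h *: 1 + t) - g t - h *: dg).
  by rewrite /GRing.scale /=; ring.
rewrite normrM (le_trans (ler_wpM2l (normr_ge0 _) Hh))// mulrA ler_wpM2r//.
by rewrite mulrCA ler_piMr ?(ltW e00)// ler_pdivrMr// mul1r lerDl.
Qed.

Lemma abs_ln_le (x : R) : `|x| <= 1 / 2 -> `|ln (1 + x)| <= 2 * `|x|.
Proof.
move=> x2; have [xl xu] : - (1 / 2) <= x /\ x <= 1 / 2.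
  by apply/andP; rewrite -ler_norml.
have x1 : 0 < 1 + x by lra.
have h1 : ln (1 + x) <= x by apply: le_ln1Dx; lra.
have h2 : - ln (1 + x) <= - x / (1 + x).
  have E : (1 + x)^-1 = 1 + - x / (1 + x) by field; rewrite gt_eqF.
  rewrite -lnV ?posrE// [in leLHS]E.
  by apply: le_ln1Dx; rewrite ltr_pdivlMr//; lra.
have h3 : - x / (1 + x) <= 2 * `|x|.
  rewrite ler_pdivrMr//; have := ler_norm (- x); rewrite normrN => hx.
  have := normr_ge0 x; move: (`|x|) hx => y hx y0; clear -xl hx y0; nra.
rewrite ler_norml; have := ler_norm x; have := normr_ge0 x.
by move: (`|x|) h3 => y h3 y0 xy; apply/andP; split; lra.
Qed.

(** Continuation: on the largest interval where g < r1 the better bound g <= d1 < r1 holds, up to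
    its end by continuity, so the interval can be prolonged unless it ends at 1. *)
Lemma bootstrap (g : R -> R) (d1 r1 : R) : d1 < r1 -> g 0 < r1 ->
  (forall v, 0 <= v <= 1 -> forall e : R, 0 < e -> exists2 d : R, 0 < d &
     forall v', 0 <= v' <= 1 -> `|v' - v| < d -> `|g v' - g v| < e) ->
  (forall v, 0 <= v <= 1 -> (forall v', 0 <= v' <= v -> g v' < r1) -> g v <= d1) ->
  g 1 <= d1.
Proof.
move=> d1r1 g0 gc step.
pose S := [set v : R | 0 <= v <= 1 /\ forall v', 0 <= v' <= v -> g v' < r1].
have S0 : S 0.
  split; first by rewrite lexx ler01.
  by move=> v'; rewrite -eq_le => /eqP <-.
have Sub : has_ubound S by exists 1 => v [/andP[]].
have Ssup : has_sup S by split => //; exists 0.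
set s := sup S.
have s0 : 0 <= s by exact: ub_le_sup.
have s1 : s <= 1 by apply: ge_sup; [exists 0|move=> v [/andP[]]].
have s01 : 0 <= s <= 1 by rewrite s0.
have below v : 0 <= v < s -> g v < r1.
  move=> /andP[v0 vs]; have sv : 0 < s - v by rewrite subr_gt0.
  have [u [_ Su]] := sup_adherent sv Ssup; rewrite opprB addrC subrK => vu.
  by apply: Su; rewrite v0 ltW.
have below' v : 0 <= v < s -> g v <= d1.
  move=> /andP[v0 vs]; apply: step; first by rewrite v0 (le_trans (ltW vs)).
  by move=> v' /andP[v'0 v'v]; apply: below; rewrite v'0 (le_lt_trans v'v).
have gs : g s <= d1.
  have [sz|sp] := leP s 0.
    have -> : s = 0 by apply/eqP; rewrite eq_le sz.
    by apply: step => [|v']; rewrite ?lexx ?ler01// -eq_le => /eqP <-.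
  rewrite -subr_le0; apply: le0_eps => e e0.
  have [d dp Hd] := gc s s01 e e0.
  pose v := Num.max 0 (s - d / 2).
  have vs : 0 <= v < s.
    by rewrite /v le_max lexx /= gt_max sp /= gtrBl divr_gt0.
  have vs' : `|v - s| < d.
    case/andP: vs => v0 vs; rewrite ltr0_norm ?subr_lt0// opprB.
    have : s - d / 2 <= v by rewrite /v le_max lexx orbT.
    by move: v v0 vs => v v0 vs h; lra.
  have v1 : 0 <= v <= 1 by case/andP: vs => -> h; rewrite (le_trans (ltW h)).
  have := below' v vs; have := Hd v v1 vs'; rewrite ltr_norml => /andP[h1 h2] h3.
  by move: v {vs vs' v1} h1 h2 h3 => v h1 h2 h3; lra.
have [s1'|] := eqVneq s 1; first by rewrite -s1'.
move=> sn1; have s1' : s < 1 by rewrite lt_neqAle sn1.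
have rd : 0 < r1 - d1 by rewrite subr_gt0.
have [d dp Hd] := gc s s01 _ rd.
pose v := Num.min 1 (s + d / 2).
have sv : s < v by rewrite /v lt_min s1' ltrDl divr_gt0.
have v1 : v <= 1 by rewrite /v ge_min lexx.
have vd : v - s < d.
  have : v <= s + d / 2 by rewrite /v ge_min lexx orbT.
  by move: v sv v1 => v sv v1 h; lra.
suff : S v by move/(ub_le_sup Sub); rewrite leNgt sv.
split; first by rewrite v1 andbT (le_trans s0)// ltW.
move=> v' /andP[v'0 v'v]; have [v's|sv'] := ltP v' s; first by apply: below; rewrite v'0.
have : `|v' - s| < d.
  by rewrite ger0_norm ?subr_ge0// (le_lt_trans _ vd)// lerD2r.
move=> /(Hd v' _); rewrite v'0 (le_trans v'v v1) => /(_ isT).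
by rewrite ltr_norml => /andP[_ h]; move: (g v') h => y h; lra.
Qed.

End RealCurves.

Section CurveChart.
Variables (R : realType) (n : nat).
Local Notation C := R[i].
Local Notation phase := ('rV[R]_n.+1 * 'rV[R]_n.+1)%type.
Local Notation pt := ('I_(n.+1 + n.+1) -> C).

Lemma phase_entry1_le (x : phase) i : `|x.1 0 i| <= `|x|.
Proof. by rewrite (le_trans (mx_entry_le _ i))// prod_normE le_max lexx. Qed.

Lemma phase_entry2_le (x : phase) i : `|x.2 0 i| <= `|x|.
Proof. by rewrite (le_trans (mx_entry_le _ i))// prod_normE le_max lexx orbT. Qed.

Lemma is_derive_entries (z : R -> phase) (t : R) (dz : phase) : is_derive t (1 : R) z dz ->
  (forall i, is_derive t (1 : R) (fun u => (z u).1 0 i) (dz.1 0 i)) /\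
  (forall i, is_derive t (1 : R) (fun u => (z u).2 0 i) (dz.2 0 i)).
Proof.
move=> /is_derive_epsP H; split=> i; apply/is_derive_epsP => e /H[d d0 Hd];
  exists d => // h /Hd; apply: le_trans.
  by rewrite (le_trans _ (phase_entry1_le _ i))// !mxE.
by rewrite (le_trans _ (phase_entry2_le _ i))// !mxE.
Qed.

Variables (c : 'rV[R]_n.+1) (rho : R) (rho0 : 0 < rho).

(* The inverse of [chart] at real phase points: [jval] is (I_i - c_i + rho) / rho
   and [cval] its logarithm divided by 2 i pi. *)
Definition jval (z : phase) i : R := rho^-1 * z.2 0 i + (1 - rho^-1 * c 0 i).

Definition cval (z : phase) i : C := 'i * (- (ln (jval z i) / tpi))%:C.

Definition ccurve (z : phase) : pt := fun j =>
  match fintype.split j with inl i => (z.1 0 i)%:C | inr i => cval z i end.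

Lemma ccurve_l z i : ccurve z (lshift n.+1 i) = (z.1 0 i)%:C.
Proof. by rewrite /ccurve (unsplitK (inl i)). Qed.

Lemma ccurve_r z i : ccurve z (rshift n.+1 i) = cval z i.
Proof. by rewrite /ccurve (unsplitK (inr i)). Qed.

Lemma Im_cval z i : complex.Im (cval z i) = - (ln (jval z i) / tpi).
Proof. by rewrite /cval cImM /= mul0r add0r mul1r. Qed.

Lemma Re_cval z i : complex.Re (cval z i) = 0.
Proof. by rewrite /cval cReM /= mul0r mulr0 subr0. Qed.

Lemma ce_cval z i : 0 < jval z i -> ce (cval z i) = (jval z i)%:C.
Proof.
move=> j0; rewrite ce.unlock Re_cval Im_cval mulr0 cos0 sin0.
have -> : - (tpi * - (ln (jval z i) / tpi)) = ln (jval z i).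
  by field; rewrite gt_eqF ?tpi_gt0.
rewrite lnK ?posrE//.
by apply: complex_eq; rewrite /=; ring.
Qed.

Lemma jval_expand z i : (c 0 i - rho)%:C + rho%:C * (jval z i)%:C = (z.2 0 i)%:C.
Proof.
rewrite -rmorphM -rmorphD /jval; congr (_%:C); field; by rewrite gt_eqF.
Qed.

Lemma chart_ccurve z : (forall i, 0 < jval z i) -> chart c rho (ccurve z) = cphase_of z.
Proof.
move=> j0; congr pair; apply/rowP => i; rewrite !mxE ?ccurve_l// ccurve_r ce_cval//.
exact: jval_expand.
Qed.

(** g1 and g2 stand for the real partial derivatives of the perturbation in the angles and in the
    actions; the gradient in w carries the extra factor 2 i pi rho e(w_{n+i}) on the action side.
    The coordinates w_{n+i} of a real point are purely imaginary. *)
Lemma curve_ode_ccurve (om : 'I_n.+1 -> R) (z : R -> phase) (t : R) (g1 g2 : 'I_n.+1 -> R) (Gam : pt) :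
  (forall i, 0 < jval (z t) i) ->
  (forall i, is_derive t (1 : R) (fun u => (z u).1 0 i) (om i + g2 i)) ->
  (forall i, is_derive t (1 : R) (fun u => (z u).2 0 i) (- g1 i)) ->
  (forall i, Gam (lshift n.+1 i) = (g1 i)%:C) ->
  (forall i, Gam (rshift n.+1 i) =
     (g2 i)%:C * (rho%:C * (ipi * ce (ccurve (z t) (rshift n.+1 i))))) ->
  exists dw, curve_ode om rho (fun u => ccurve (z u)) t dw Gam.
Proof.
move=> j0 z1 z2 Gl Gr.
have tp := tpi_gt0 R.
exists (fun j => match fintype.split j with inl i => (om i + g2 i)%:C
  | inr i => 'i * (g1 i / (tpi * rho * jval (z t) i))%:C end); split.
- move=> j; rewrite /ccurve; case: (fintype.split j) => i; first exact: rderiv_real.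
  apply: rderivZ; apply: rderiv_real.
  have H1 : is_derive t (1 : R) (fun u => jval (z u) i) (rho^-1 * - g1 i).
    exact: is_derive_affine.
  have H2 := @is_derive1_comp _ (@ln R) (fun u => jval (z u) i) t _ _ (is_derive1_ln (j0 i)) H1.
  have := is_derive_affine (- tpi^-1) 0 H2.
  rewrite (_ : - tpi^-1 * _ = g1 i / (tpi * rho * jval (z t) i)).
    congr (is_derive _ _ _ _); apply/funext => u /=.
    by rewrite addr0 mulNr mulrC.
  by field; rewrite !gt_eqF.
- move=> i; rewrite (unsplitK (inl i)) Gr ccurve_r.
  have -> : (om i + g2 i)%:C = (om i)%:C + (g2 i)%:C by rewrite rmorphD.
  congr (_ + _).
  have := ce_neq0 (cval (z t) i); have := ii_neq0 R.
  have r0 : rho%:C != 0 :> C.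
    by apply/negP => /eqP/(congr1 (@complex.Re R)) /= /eqP; rewrite gt_eqF.
  by move: (ce _) (ipi) ((g2 i)%:C) r0 => x y g r0 y0 x0; field; rewrite r0 y0 x0.
move=> i; rewrite (unsplitK (inr i)) Gl ccurve_r ce_cval// ipi.unlock.
have i2 : 'i * 'i = -1 :> C by rewrite -expr2 sqr_i.
have i0 : 'i != 0 :> C by exact: neq0Ci.
have cne (x : R) : 0 < x -> x%:C != 0 :> C.
  by move=> x0; apply/negP => /eqP/(congr1 (@complex.Re R)) /= /eqP; rewrite gt_eqF.
have -> : (g1 i / (tpi * rho * jval (z t) i))%:C =
    (g1 i)%:C / (tpi%:C * rho%:C * (jval (z t) i)%:C) by rewrite fmorph_div !rmorphM.
have := cne _ (j0 i); have := cne _ tp; have := cne _ rho0.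
move: ((jval (z t) i)%:C) (tpi%:C) (rho%:C) ((g1 i)%:C) => x y w g w0 y0 x0.
rewrite -[LHS]mulr1 -[X in _ * X]opprK -i2 mulrN; congr (- _).
have -> : 'i * (g / (y * w * x)) * ('i * 'i) = ('i * 'i) * ('i * 'i) * (g / ('i * y * w * x)).
  by field; rewrite w0 y0 x0 i0.
by rewrite i2 mulrNN mulr1 mul1r.
Qed.

End CurveChart.

Section Confinement.
Variables (R : realType) (n : nat) (omv : 'rV[R]_n.+1) (sigma : R).
Local Notation C := R[i].
Local Notation phase := ('rV[R]_n.+1 * 'rV[R]_n.+1)%type.
Local Notation cphase := ('rV[R[i]^o]_n.+1 * 'rV[R[i]^o]_n.+1)%type.
Local Notation Z2 := 'rV[int]_(n.+1 + n.+1).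
Hypotheses (sigma0 : 0 < sigma) (omega : nonresonant omv).

Definition small_divisors (N : nat) (Y : R) :=
  forall k : 'rV[int]_n.+1, (forall i, (absz (k ord0 i) <= N)%N) -> k != 0 ->
    `|idot k omv|^-1 <= Y.

Lemma divisor_idot (k : Z2) :
  \sum_(i < n.+1) omv 0 i * (ang k i)%:~R = idot (\row_i ang k i) omv.
Proof. by apply: eq_bigr => i _; rewrite mxE mulrC. Qed.

Lemma nonresonant_ang (k : Z2) :
  \sum_(i < n.+1) omv 0 i * (ang k i)%:~R = 0 -> forall i, ang k i = 0.
Proof.
rewrite divisor_idot => k0 i.
have [/rowP/(_ i)|/omega] := eqVneq (\row_i ang k i) 0; first by rewrite !mxE.
by rewrite k0 eqxx.
Qed.

Lemma small_divisors_divisor N Y (k : Z2) : small_divisors N Y ->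
  (forall i, (absz (ang k i) <= N)%N) ->
  divisor (fun i => omv 0 i) k = 0 \/ (nm (divisor (fun i => omv 0 i) k))^-1 <= Y.
Proof.
move=> sd kN; rewrite /divisor divisor_idot nmC.
have [->|k0] := eqVneq (\row_i ang k i) 0.
  by left; rewrite /idot big1// => i _; rewrite !mxE mul0r.
by right; apply: sd => // i; rewrite mxE.
Qed.

(** The constants are uniform in the ball, the centre and N. The equation is only required while the
    action is within r1 of c, so that the conclusion also applies to solutions of a field modified
    away from c. *)
Lemma confinement : exists B c4 r1 : R, [/\ 0 < B, 0 < c4, 0 < r1 <= 1 / 2 &
  forall (a : 'rV[R]_n.+1) (r eps : R) (f : phase -> R) (F : cphase -> R[i]^o),
  0 < eps -> holomorphic_extension sigma (ball a r) f F ->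
  (cfun_norm sigma (ball a r) F <= eps%:E)%E ->
  forall c : 'rV[R]_n.+1, (forall I, `|I - c| < r1 -> ball a r I) ->
  forall (N : nat) (Y : R), (0 < N)%N -> 1 <= Y -> B * (N%:R * Y) * eps <= 1 ->
  small_divisors N Y ->
  forall tau d1 : R, d1 < r1 -> B * (Y * eps) + B * eps * expR (- (c4 * N%:R)) * tau <= d1 ->
  forall (J : set R) (z : R -> phase), is_interval J -> J 0 -> (z 0).2 = c ->
  (forall t, J t -> forall e : R, 0 < e -> exists2 d : R, 0 < d &
     forall t', J t' -> `|t' - t| < d -> `|(z t').2 - (z t).2| < e) ->
  (forall t, J t -> `|(z t).2 - c| < r1 -> is_derive t 1 z (ham_field (ham f omv) (z t))) ->
  forall t, J t -> `|t| <= tau -> `|(z t).2 - c| <= d1].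
Proof.
have tp := tpi_gt0 R.
pose rho := sigma / 4; have rho0 : 0 < rho by rewrite divr_gt0.
have rhos : 3 * rho < sigma by rewrite /rho mulrA ltr_pdivrMr// mulrC ltr_pM2l// ltr_nat.
clearbody rho.
pose s := Num.min sigma (ln 2 / tpi).
have ln2 : 0 < ln 2 :> R by rewrite ln_gt0// ltr1n.
have s0 : 0 < s by rewrite lt_min sigma0 divr_gt0.
have ssigma : s <= sigma by rewrite ge_min lexx.
have es2 : expR (tpi * s) <= 2.
  rewrite -[leRHS]lnK ?posrE// ler_expR mulrC -ler_pdivlMr//.
  by rewrite ge_min lexx orbT.
clearbody s.
have [B [c4 [B0 c40 HB]]] := approximate_integral nonresonant_ang s0 rho0.
pose b := tpi * (s / 16); have b0 : 0 < b by rewrite mulr_gt0// divr_gt0.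
(* Within r1 of c, |I_i - c_i| / rho is below 1 / 2, so that e(w_{n+i}) >= 1 / 2 and [abs_ln_le]
   applies, and below b / 2, so that tpi |Im w_{n+i}| <= b. The outer 1 / 2 will keep the point in
   the ball. *)
pose r1 := Num.min (1 / 2) (rho * Num.min (1 / 2) (b / 2)).
have r10 : 0 < r1 by rewrite lt_min divr_gt0//= mulr_gt0// lt_min !divr_gt0.
have r12 : r1 <= 1 / 2 by rewrite ge_min lexx.
have B'B : B <= B * (1 + 2 * rho).
  by rewrite ler_peMr ?(ltW B0)// lerDl mulr_ge0// ltW.
exists (B * (1 + 2 * rho)), c4, r1; split => //; [by rewrite (lt_le_trans B0)|by rewrite r10|].
move=> a r eps f F eps0 hF Fb c cB N Y N0 Y1 small sd tau d1 d1r1 hd1 J z Jint J0 z0 zc zd t1 Jt1 t1tau.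
have cB' : ball a r c by apply: cB; rewrite subrr normr0.
have Y0 : 0 <= Y := le_trans ler01 Y1.
have E0 : 0 < expR (- (c4 * N%:R)) by exact: expR_gt0.
have tau0 : 0 <= tau := le_trans (normr_ge0 _) t1tau.
(* A rescaled action moves by at most 2 Q: the distance from P to e(w_{n+i}) counts at both ends,
   and the drift twice because of [complex_mvt]. Rescaling by rho explains the constant B (1 + 2
   rho). *)
pose Q := B * (Y * eps) + B * eps * expR (- (c4 * N%:R)) * tau.
have Q0 : 0 <= Q by rewrite addr_ge0// !mulr_ge0// ltW.
have Qd1 : 2 * rho * Q <= d1.
  rewrite (le_trans _ hd1)// (_ : B * (1 + 2 * rho) * _ + _ = (1 + 2 * rho) * Q).
    by rewrite ler_wpM2r// lerDr.
  by rewrite /Q; move: (expR _) => e; ring.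
have d10 : 0 <= d1 by rewrite (le_trans _ Qd1)// !mulr_ge0// ltW.
have small' : B * (N%:R * Y) * eps <= 1.
  rewrite (le_trans _ small)// ler_wpM2r ?(ltW eps0)// ler_wpM2r ?mulr_ge0//.
have jE (y : phase) i : jval c rho y i = 1 + rho^-1 * (y.2 0 i - c 0 i).
  by rewrite /jval; ring.
have jx (y : phase) i : `|y.2 - c| < r1 -> `|rho^-1 * (y.2 0 i - c 0 i)| < Num.min (1 / 2) (b / 2).
  move=> yr; rewrite normrM gtr0_norm ?invr_gt0// mulrC ltr_pdivrMr//.
  have := mx_entry_le (y.2 - c) i; rewrite !mxE => h.
  rewrite mulrC; apply: le_lt_trans h (lt_le_trans yr _).
  by rewrite ge_min lexx orbT.
have jlb (y : phase) i : `|y.2 - c| < r1 -> 1 / 2 <= jval c rho y i.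
  move=> /(jx _ i); rewrite lt_min => /andP[h _]; rewrite jE.
  by move: h; rewrite ltr_norml => /andP[h _]; lra.
have jpos (y : phase) i : `|y.2 - c| < r1 -> 0 < jval c rho y i.
  by move=> /(jlb _ i); apply: lt_le_trans.
have Imb (y : phase) j : `|y.2 - c| < r1 -> tpi * `|complex.Im (ccurve c rho y j)| <= b.
  move=> yr; rewrite /ccurve; case: (fintype.split j) => i.
    by rewrite /= normr0 mulr0 ltW.
  rewrite Im_cval normrN normrM normfV (gtr0_norm tp) mulrCA mulfV ?gt_eqF// mulr1 jE.
  have := jx y i yr; rewrite lt_min => /andP[h1 h2].
  by rewrite (le_trans (abs_ln_le (ltW h1)))// mulrC -ler_pdivlMr// ltW.
have yB (y : phase) : `|y.2 - c| < r1 -> ball a r y.2 by exact: cB.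
have Gs := pstrip_chartF sigma0 hF cB' rho0 rhos ssigma es2.
have Gb := nm_chartF sigma0 Fb cB' rho0 rhos ssigma es2.
have divY (k : Z2) := @small_divisors_divisor N Y k sd.
(* The segment from time 0 to t1 is parametrised by [0, 1], whatever the sign of t1. *)
pose g (v : R) := `|(z (v * t1)).2 - c|.
suff : g 1 <= d1 by rewrite /g mul1r.
have Jv v : 0 <= v <= 1 -> J (v * t1).
  move=> /andP[v0 v1]; have [t10|t10] := leP 0 t1.
    by apply: (Jint 0 t1) => //; rewrite mulr_ge0// ler_piMl.
  by apply: (Jint t1 0) => //; rewrite mulr_ge0_le0 ?(ltW t10)// andbT ler_niMl ?(ltW t10).
apply: (bootstrap d1r1).
- by rewrite /g mul0r z0 subrr normr0.
- move=> v v01 e e0; have [d dp Hd] := zc _ (Jv v v01) _ e0.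
  have t1p : 0 < `|t1| + 1 by rewrite ltr_wpDl.
  exists (d / (`|t1| + 1)); first by rewrite divr_gt0.
  move=> v' v'01; rewrite ltr_pdivlMr// => hv.
  have hd : `|v' - v| * `|t1| < d by rewrite (le_lt_trans _ hv)// ler_wpM2l// lerDl.
  have := Hd _ (Jv v' v'01); rewrite -mulrBl normrM => /(_ hd); apply: le_lt_trans.
  rewrite /g (_ : (z (v' * t1)).2 - (z (v * t1)).2 = ((z (v' * t1)).2 - c) - ((z (v * t1)).2 - c)).
    exact: ler_dist_dist.
  by rewrite opprB addrA subrK.
move=> v /andP[v0 v1] gv; set u := v * t1.
have good t : Num.min 0 u <= t <= Num.max 0 u -> J t /\ `|(z t).2 - c| < r1.
  move=> /andP[ht1 ht2].
  suff [v' /andP[v'0 v'v] ->] : exists2 v', 0 <= v' <= v & t = v' * t1.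
    by split; [apply: Jv; rewrite v'0 (le_trans v'v)|apply: gv; rewrite v'0].
  have [t1z|t1z] := eqVneq t1 0.
    exists 0; first by rewrite lexx.
    move: ht1 ht2; rewrite /u t1z !mulr0 minxx maxxx => h1 h2.
    by apply/eqP; rewrite eq_le h1 h2.
  exists (t / t1); last by rewrite divfK.
  have [t10|t10] := leP 0 t1.
    have t1p : 0 < t1 by rewrite lt_neqAle eq_sym t1z.
    have u0 : 0 <= u by rewrite mulr_ge0.
    move: ht1 ht2; rewrite min_l// max_r// => h1 h2.
    by rewrite divr_ge0//= ler_pdivrMr.
  have u0 : u <= 0 by rewrite mulr_ge0_le0// ltW.
  move: ht1 ht2; rewrite min_r// max_l// => h1 h2.
  by rewrite mulr_le0 ?invr_le0 ?(ltW t10)//= ler_ndivrMr.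
have g0 : `|(z 0).2 - c| < r1 by rewrite z0 subrr normr0.
have gu : `|(z u).2 - c| < r1 by apply: (good u _).2; rewrite ge_min le_max lexx !orbT.
apply: mx_norm_le => // i; rewrite !mxE.
have [P [P1 P2]] := HB N Y eps _ N0 Y1 eps0 small' divY Gs Gb i.
pose phi t := ev P (ccurve c rho (z t)).
have phid t : Num.min 0 u <= t <= Num.max 0 u -> exists2 d, rderiv phi t d &
    nm d <= B * eps * expR (- (c4 * N%:R)).
  move=> /good[Jt zt].
  have jt i' : 0 < jval c rho (z t) i' by exact: jpos.
  have ct : chart c rho (ccurve c rho (z t)) = cphase_of (z t) by exact: chart_ccurve.
  have win : instrip s (ccurve c rho (z t)).
    move=> j; have := Imb (z t) j zt; rewrite /b ler_pM2l// => h.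
    by rewrite (le_lt_trans h)// ltr_pdivrMr// ltr_pMr// ltr1n.
  have := zd t Jt zt; rewrite (ham_fieldE sigma0 hF omv (yB _ zt)) => /is_derive_entries[/= zd1 zd2].
  pose Gam : 'I_(n.+1 + n.+1) -> C := fun j => match fintype.split j with
    | inl i' => dF1 F (cphase_of (z t)) i'
    | inr i' => dF2 F (cphase_of (z t)) i' * (rho%:C * (ipi * ce (ccurve c rho (z t) (rshift n.+1 i')))) end.
  have [dw Hdw] : exists dw, curve_ode (fun i => omv 0 i) rho (fun u => ccurve c rho (z u)) t dw Gam.
    apply: (@curve_ode_ccurve R n c rho rho0 _ z t (fun i => complex.Re (dF1 F (cphase_of (z t)) i))
      (fun i => complex.Re (dF2 F (cphase_of (z t)) i))) => //.
    - by move=> i'; have := zd1 i'; rewrite mxE.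
    - by move=> i'; have := zd2 i'; rewrite !mxE.
    - by move=> i'; rewrite /Gam (unsplitK (inl i')); apply: (dF1_real sigma0 hF); exact: yB.
    move=> i'; rewrite /Gam (unsplitK (inr i')); congr (_ * _).
    by apply: (dF2_real sigma0 hF); exact: yB.
  apply: (P2 _ _ _ _ Hdw).
  - by move=> j; exact: Imb.
  - by move=> i'; rewrite ccurve_r ce_cval// nmC ger0_norm ?(ltW (jt _))//; exact: jlb.
  move=> j; rewrite /Gam -[j]splitK; case: (fintype.split j) => i'.
    rewrite (unsplitK (inl i')) -ct; exact: (cderiv_chart_l sigma0 hF cB' rho0 rhos ssigma es2).
  rewrite (unsplitK (inr i')) -ct; exact: (cderiv_chart_r sigma0 hF cB' rho0 rhos ssigma es2).
have mvt : nm (phi u - phi 0) <= 2 * (B * eps * expR (- (c4 * N%:R))) * `|u|.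
  have [u0|u0] := leP 0 u.
    rewrite ger0_norm//; have := @complex_mvt R phi 0 u _ u0 _; rewrite subr0; apply.
    by move=> x hx; apply: phid; rewrite min_l// max_r.
  rewrite nm_distC ltr0_norm//; have := @complex_mvt R phi u 0 _ (ltW u0) _; rewrite sub0r; apply.
  by move=> x hx; apply: phid; rewrite min_r ?(ltW u0)// max_l// ltW.
have val y : `|(z y).2 - c| < r1 ->
    nm (phi y - (jval c rho (z y) i)%:C) <= B * Y * eps.
  move=> zy; rewrite -ce_cval ?jpos// -ccurve_r; apply: P1 => j; exact: Imb.
have -> : (z u).2 0 i - c 0 i = rho * (jval c rho (z u) i - jval c rho (z 0) i).
  by rewrite /jval z0; field; rewrite gt_eqF.
rewrite normrM gtr0_norm// -[leLHS]mul1r.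
have nle : `|jval c rho (z u) i - jval c rho (z 0) i| <= 2 * Q.
  rewrite -nmC rmorphB; have h1 := val u gu; have h2 := val 0 g0.
  have -> : (jval c rho (z u) i)%:C - (jval c rho (z 0) i)%:C =
    (phi u - phi 0) - (phi u - (jval c rho (z u) i)%:C) + (phi 0 - (jval c rho (z 0) i)%:C).
    by move: (phi u) (phi 0) (_%:C) (_%:C) => p q x y; ring.
  rewrite (le_trans (nmD _ _))// (le_trans (lerD (nmB _ _) (lexx _)))//.
  rewrite (le_trans (lerD (lerD mvt h1) h2))//.
  have utau : `|u| <= tau.
    rewrite (le_trans _ t1tau)// /u normrM (ger0_norm v0) ler_piMl//.
  have hh : B * eps * expR (- (c4 * N%:R)) * `|u| <= B * eps * expR (- (c4 * N%:R)) * tau.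
    by rewrite ler_wpM2l// !mulr_ge0// ltW.
  rewrite /Q -(mulrA 2) -(mulrA B Y eps) mulrDr.
  by move: (B * (Y * eps)) hh => x; move: (_ * `|u|) (_ * tau) => y w hh; lra.
rewrite mul1r (le_trans (ler_wpM2l (ltW rho0) nle))// (le_trans _ Qd1)//.
by rewrite mulrCA mulrA.
Qed.

End Confinement.

(** * Ordinary differential equations *)

Section Gronwall.
Variable R : realType.

Lemma is_derive_neg (phi : R -> R) (t d : R) : is_derive (- t) (1 : R) phi d ->
  is_derive t (1 : R) (fun u => phi (- u)) (- d).
Proof.
move=> /is_derive_epsP H; apply/is_derive_epsP => e /H[r r0 Hr]; exists r => // h hr.
have := Hr (- h); rewrite normrN => /(_ hr).
rewrite [- h *: 1]mulr1 [- h *: d]mulNr [h *: 1]mulr1 [h *: - d]mulrN opprD.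
by rewrite opprK.
Qed.

Lemma mvt_exp_ge0 (phi dphi : R -> R) (A k t : R) : 0 < k -> 0 <= t ->
  (forall u, 0 <= u <= t -> is_derive u (1 : R) phi (dphi u)) ->
  (forall u, 0 <= u <= t -> dphi u <= A * expR (k * u)) ->
  phi t - phi 0 <= A / k * (expR (k * t) - 1).
Proof.
move=> k0 t0 pd pA.
pose psi u := phi u - A / k * expR (k * u).
have psid u : 0 <= u <= t -> is_derive u (1 : R) psi (dphi u - A * expR (k * u)).
  move=> /pd h.
  have h1 : is_derive u (1 : R) (fun v => k * v + 0) (k * 1) by apply: is_derive_affine; exact: is_derive_id.
  have h2 := @is_derive1_comp _ (@expR R) (fun v => k * v + 0) u _ _ (is_derive_expR _) h1.
  have h3 := is_derive_affine (- (A / k)) 0 h2.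
  have := is_deriveD h h3.
  rewrite (_ : _ + _ = psi); last by apply/funext => v; rewrite /psi /= fctE !addr0 mulNr.
  rewrite (_ : dphi u + _ = dphi u - A * expR (k * u))//.
  by rewrite addr0; field; rewrite gt_eqF.
have [] := @MVT_segment _ psi (fun u => dphi u - A * expR (k * u)) 0 t t0.
- by move=> x; rewrite in_itv /= => /andP[x0 xt]; apply: psid; rewrite !ltW.
- by apply: derivable_within_continuous => x; rewrite in_itv /= => /psid[].
move=> c; rewrite in_itv /= => c0t; rewrite subr0 => E.
have : psi t - psi 0 <= 0 by rewrite E mulr_le0_ge0// subr_le0 pA.
rewrite /psi mulr0 expR0 mulr1 mulrBr mulr1.
by move: (A / k) (expR _) => x y; lra.
Qed.

(** Measured against exp(k |t|), integration gains a factor 1 / k. With k = 2 L the Picard map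
    contracts by 1 / 2 on the whole line, without restriction to short times. *)
Lemma mvt_exp (phi dphi : R -> R) (A k t : R) : 0 < k -> 0 <= A ->
  (forall u, Num.min 0 t <= u <= Num.max 0 t -> is_derive u (1 : R) phi (dphi u)) ->
  (forall u, Num.min 0 t <= u <= Num.max 0 t -> `|dphi u| <= A * expR (k * `|u|)) ->
  `|phi t - phi 0| <= A / k * expR (k * `|t|).
Proof.
move=> k0 A0.
have Ak : 0 <= A / k by rewrite divr_ge0// ltW.
have fwd (f df : R -> R) (s : R) : 0 <= s ->
    (forall u, 0 <= u <= s -> is_derive u (1 : R) f (df u)) ->
    (forall u, 0 <= u <= s -> `|df u| <= A * expR (k * u)) ->
    `|f s - f 0| <= A / k * expR (k * s).
  move=> s0 fd fA.
  have h1 : f s - f 0 <= A / k * (expR (k * s) - 1).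
    by apply: mvt_exp_ge0 fd _ => // u hu; rewrite (le_trans (ler_norm _))// fA.
  have h2 : - f s - - f 0 <= A / k * (expR (k * s) - 1).
    apply: (@mvt_exp_ge0 (fun u => - f u) (fun u => - df u)) => // u hu.
      by have := is_deriveN (fd u hu).
    by rewrite (le_trans (ler_norm _))// normrN fA.
  rewrite mulrBr mulr1 in h1 h2; rewrite ler_norml; move: (_ * expR _) h1 h2 => x h1 h2.
  by apply/andP; split; lra.
have [t0|t0] := leP 0 t.
  rewrite (ger0_norm t0) => fd fA; apply: (fwd phi dphi) => // u hu.
  by case/andP: (hu) => u0 _; rewrite -[X in k * X]ger0_norm// fA.
rewrite (ltr0_norm t0) => fd fA.
have nt : 0 <= - t by rewrite oppr_ge0 ltW.
have tr u : 0 <= u <= - t -> t <= - u <= 0 by rewrite lerNr oppr_le0 andbC.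
have := fwd (fun u => phi (- u)) (fun u => - dphi (- u)) (- t) nt.
rewrite opprK oppr0; apply.
  by move=> u /tr hu; apply: is_derive_neg; exact: fd.
move=> u hu; rewrite normrN (le_trans (fA _ (tr u hu)))// normrN ger0_norm//.
by case/andP: hu.
Qed.

(** The intervals of centre a k and radius 2 S / 2^k are nested, since the radius drops by exactly
    the allowed step; the limit is the supremum of their left ends. *)
Lemma geometric_cauchy (a : nat -> R) (S : R) : 0 <= S ->
  (forall k, `|a k.+1 - a k| <= S / 2 ^+ k) ->
  exists l, forall k, `|a k - l| <= 2 * S / 2 ^+ k.
Proof.
move=> S0 ak; pose c k : R := 2 * S / 2 ^+ k.
have cE k : c k.+1 = S / 2 ^+ k.
  by rewrite /c exprS; field; rewrite expf_neq0.
have c2 k : c k = 2 * c k.+1 by rewrite cE /c mulrA.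
have lo k : a k - c k <= a k.+1 - c k.+1.
  by have := ak k; rewrite -cE ler_norml (c2 k) => /andP[]; move: (c k.+1) (a k.+1) (a k) => x y z; lra.
have hi k : a k.+1 + c k.+1 <= a k + c k.
  by have := ak k; rewrite -cE ler_norml (c2 k) => /andP[]; move: (c k.+1) (a k.+1) (a k) => x y z; lra.
have lo' k j : a k - c k <= a (k + j)%N - c (k + j)%N.
  by elim: j => [|j IH]; rewrite ?addn0// addnS (le_trans IH).
have hi' k j : a (k + j)%N + c (k + j)%N <= a k + c k.
  by elim: j => [|j IH]; rewrite ?addn0// addnS (le_trans _ IH).
have c0 k : 0 <= c k by rewrite divr_ge0 ?mulr_ge0 ?exprn_ge0.
have lohi k j : a k - c k <= a j + c j.
  rewrite (le_trans (lo' k j))// (le_trans _ (hi' j k))// addnC.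
  by rewrite lerD2l (le_trans _ (c0 _))// oppr_le0.
pose E := [set a k - c k | k in [set: nat]].
have E0 : E !=set0 by exists (a 0%N - c 0%N); exists 0%N.
have Eub j : ubound E (a j + c j) by move=> _ [k _ <-]; exact: lohi.
have Es : has_ubound E by exists (a 0%N + c 0%N).
exists (sup E) => k; rewrite ler_distl; apply/andP; split.
  by rewrite lerBlDr; apply: ge_sup.
by rewrite -lerBlDr; apply: ub_le_sup => //; exists k.
Qed.

Lemma pow2_small (C e : R) : 0 <= C -> 0 < e -> exists k, C / 2 ^+ k <= e.
Proof.
move=> C0 e0; set k := (Num.truncn (C / e)).+1; exists k.
have h1 : C / e < k%:R by exact: truncnS_gt.
have h2 : k%:R <= 2 ^+ k :> R by rewrite -natrX ler_nat ltnW// ltn_expl.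
rewrite ler_pdivrMr ?exprn_gt0// mulrC -ler_pdivrMr//.
exact: le_trans (ltW h1) h2.
Qed.

Lemma antiderivative (g : R -> R) (k : R) : 0 <= k ->
  (forall t u, `|g t - g u| <= k * `|t - u|) ->
  exists A : R -> R, A 0 = 0 /\ forall t, is_derive t (1 : R) A (g t).
Proof.
move=> k0 gl.
have geps t e : 0 < e -> exists2 d : R, 0 < d & forall u, `|u - t| < d -> `|g u - g t| < e.
  move=> e0; have k1 : 0 < k + 1 by rewrite ltr_wpDl.
  exists (e / (k + 1)); first by rewrite divr_gt0.
  move=> u; rewrite ltr_pdivlMr// => h; rewrite (le_lt_trans (gl _ _))// mulrC.
  by rewrite (le_lt_trans _ h)// ler_wpM2l// lerDl.
have gc a b : rcont g a b.
  by move=> x _ e /(geps x)[d d0 Hd]; exists d => // y _; exact: Hd.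
pose A t := if 0 <= t then rint g 0 t else - rint g t 0.
have rint0 t : rint g t t = 0.
  have := rint_split (lexx t) (lexx t) (gc t t).
  by move/eqP; rewrite -subr_eq subrr => /eqP.
have AE t u : t <= u -> A u - A t = rint g t u.
  move=> tu; rewrite /A; have [t0|t0] := leP 0 t.
    by rewrite (le_trans t0 tu) (rint_split t0 tu (gc _ _)) addrAC subrr add0r.
  have [u0|u0] := leP 0 u.
    by rewrite opprK (rint_split (ltW t0) u0 (gc _ _)) addrC.
  by rewrite (rint_split tu (ltW u0) (gc _ _)) opprK addrC addrK.
exists A; split; first by rewrite /A lexx rint0.
move=> t; apply: real_derive_of_eps => e /(geps t)[d d0 Hd]; exists d => // h hd.
have [h0|h0] := leP 0 h.
  rewrite AE ?lerDl//; have := @rint_bound _ g (g t) e t (t + h).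
  rewrite addrAC subrr add0r (ger0_norm h0); apply; rewrite ?lerDl// => x /andP[x1 x2].
  apply: ltW; apply: Hd; rewrite ger0_norm ?subr_ge0// (le_lt_trans _ hd)// ger0_norm//.
  by rewrite lerBlDl.
have th : t + h <= t by rewrite gerDl ltW.
have -> : A (t + h) - A t = - rint g (t + h) t by rewrite -AE// opprB.
rewrite -opprD normrN (_ : g t * h = - (g t * (t - (t + h)))); last by ring.
rewrite (ltr0_norm h0) (_ : - h = t - (t + h)); last by ring.
apply: rint_bound => // x /andP[x1 x2].
apply: ltW; apply: Hd; rewrite ler0_norm ?subr_le0// opprB (le_lt_trans _ hd)// ltr0_norm//.
by rewrite lerBlDl -lerBlDr opprK.
Qed.

End Gronwall.

Section Picard.
Variables (R : realType) (d : nat).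
Local Notation st := ('I_d -> R).
Variables (X : st -> st) (L M : R).
Hypotheses (L0 : 0 < L) (M0 : 0 <= M)
  (XL : forall x y D, 0 <= D -> (forall j, `|x j - y j| <= D) ->
     forall i, `|X x i - X y i| <= L * D)
  (XM : forall x i, `|X x i| <= M).

(** The conclusion is a second-order estimate rather than a derivative: it passes to the limit of
    the iterates and is uniform in the components. *)
Lemma picard (x0 : st) : exists y : R -> st, y 0 = x0 /\
  forall t h i, `|y (t + h) i - y t i - h * X (y t) i| <= L * M * h ^+ 2.
Proof.
pose lipc (y : R -> st) := forall t u i, `|y t i - y u i| <= M * `|t - u|.
have /choice[anti Hanti] (g : R -> R) : exists A : R -> R,
    (forall t u, `|g t - g u| <= L * M * `|t - u|) ->
    A 0 = 0 /\ forall t, is_derive t (1 : R) A (g t).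
  have [gl|ngl] := pselect (forall t u, `|g t - g u| <= L * M * `|t - u|); last by exists g.
  have [|A HA] := antiderivative _ gl; last by exists A.
  by rewrite mulr_ge0// ltW.
pose step (y : R -> st) : R -> st := fun t i => x0 i + anti (fun u => X (y u) i) t.
have stepP y : lipc y -> [/\ step y 0 = x0, lipc (step y) &
    forall t i, is_derive t (1 : R) (fun u => step y u i) (X (y t) i)].
  move=> yl; have gl i t u : `|X (y t) i - X (y u) i| <= L * M * `|t - u|.
    by rewrite -mulrA; apply: XL; rewrite ?mulr_ge0.
  have Hi i := Hanti (fun u => X (y u) i) (gl i).
  have sd t i : is_derive t (1 : R) (fun u => step y u i) (X (y t) i).
    have := is_derive_affine 1 (x0 i) ((Hi i).2 t); rewrite mul1r.
    by congr (is_derive _ _ _ _); apply/funext => u; rewrite mul1r addrC.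
  split => //; first by apply/funext => i; rewrite /step (Hi i).1 addr0.
  move=> t u i; wlog tu : t u / u <= t.
    move=> H; have [|/ltW] := leP u t; first exact: H.
    by move=> /H; rewrite distrC [`|u - t|]distrC.
  rewrite (ger0_norm (_ : 0 <= t - u)) ?subr_ge0//.
  exact: (real_mvt tu (fun x _ => sd x i) (fun x _ => XM _ i)).
pose Y k := iter k step (fun=> x0).
have Yl k : lipc (Y k).
  elim: k => [|k IH]; last by have [] := stepP _ IH.
  by move=> t u i; rewrite /= subrr normr0 mulr_ge0.
have Y0 k : Y k 0 = x0 by case: k => // k; have [] := stepP _ (Yl k).
have Yd k t i : is_derive t (1 : R) (fun u => Y k.+1 u i) (X (Y k t) i).
  by have [_ _] := stepP _ (Yl k); exact.
(* The first increment is at most S exp(2 L |t|) by [mvt_exp]; each iteration then brings the ratio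
   L / (2 L) = 1 / 2. *)
pose S := M / (2 * L).
have S0 : 0 <= S by rewrite divr_ge0// mulr_ge0// ltW.
have L20 : 0 < 2 * L by rewrite mulr_gt0.
have Ydiff k t i : `|Y k.+1 t i - Y k t i| <= S / 2 ^+ k * expR (2 * L * `|t|).
  elim: k t i => [|k IH] t i.
    rewrite expr0 divr1; have := @mvt_exp R (fun u => Y 1%N u i) (fun u => X (Y 0%N u) i) M (2 * L) t L20 M0.
    rewrite (Y0 1%N) => H; apply: (H (fun u _ => Yd 0%N u i)) => u _.
    rewrite (le_trans (XM _ _))// ler_peMr// -[leLHS]expR0 ler_expR.
    by rewrite mulr_ge0// ltW.
  pose D u := Y k.+2 u i - Y k.+1 u i.
  have : `|D t - D 0| <= (L * (S / 2 ^+ k)) / (2 * L) * expR (2 * L * `|t|).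
    apply: (@mvt_exp R D (fun u => X (Y k.+1 u) i - X (Y k u) i)) => //.
    - by rewrite mulr_ge0 ?(ltW L0)// divr_ge0 ?exprn_ge0.
    move=> u _; rewrite -mulrA; apply: XL; last by move=> j; exact: IH.
    by rewrite mulr_ge0 ?expR_ge0// divr_ge0 ?exprn_ge0.
  rewrite /D !Y0 subrr subr0 => /le_trans; apply; rewrite ler_wpM2r ?expR_ge0//.
  rewrite exprS le_eqVlt; apply/orP; left; apply/eqP; field.
  by rewrite expf_neq0//= gt_eqF.
have /choice[y Hy] (t : R) : exists x : st, forall k i,
    `|Y k t i - x i| <= 2 * (S * expR (2 * L * `|t|)) / 2 ^+ k.
  have /choice[x Hx] (i : 'I_d) : exists l, forall k,
      `|Y k t i - l| <= 2 * (S * expR (2 * L * `|t|)) / 2 ^+ k.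
    apply: geometric_cauchy; first by rewrite mulr_ge0 ?expR_ge0.
    by move=> k; rewrite (le_trans (Ydiff k t i))// mulrAC.
  by exists x => k i; exact: Hx.
pose c (t : R) : R := 2 * (S * expR (2 * L * `|t|)).
have c0 (t : R) : 0 <= c t by apply: mulr_ge0 => //; apply: mulr_ge0 => //; exact: expR_ge0.
exists y; split.
  apply/funext => i; apply/eqP; rewrite -subr_eq0 -normr_eq0 eq_le normr_ge0 andbT.
  apply: le0_eps => e e0; have [k hk] := pow2_small (c0 0) e0.
  by have := Hy 0 k i; rewrite Y0 distrC => /le_trans; apply.
move=> t h i; rewrite -subr_le0; apply: le0_eps => e e0.
pose K := c (t + h) + c t + L * c t * `|h|.
have K0 : 0 <= K.
  apply: addr_ge0; first exact: addr_ge0.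
  by apply: mulr_ge0 => //; apply: mulr_ge0 => //; exact: ltW.
have [k hk] := pow2_small K0 e0.
have Yk1 : c (t + h) / 2 ^+ k.+1 <= c (t + h) / 2 ^+ k.
  by rewrite ler_wpM2l// lef_pV2 ?posrE ?exprn_gt0// ler_weXn2l// ler1n.
have Yk2 : c t / 2 ^+ k.+1 <= c t / 2 ^+ k.
  by rewrite ler_wpM2l// lef_pV2 ?posrE ?exprn_gt0// ler_weXn2l// ler1n.
pose phi (u : R) := Y k.+1 u i - X (y t) i * u.
have key : `|phi (t + h) - phi t| <= L * (M * `|h| + c t / 2 ^+ k) * `|h|.
  have pd (u : R) : is_derive u (1 : R) phi (X (Y k u) i - X (y t) i).
    have h1 : is_derive u (1 : R) (fun v : R => X (y t) i * v + 0) (X (y t) i * 1).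
      by apply: is_derive_affine; exact: is_derive_id.
    have := is_deriveB (Yd k u i) h1; rewrite mulr1.
    by congr (is_derive _ _ _ _); apply/funext => v; rewrite /phi !fctE addr0.
  have pb (u : R) : `|u - t| <= `|h| -> `|X (Y k u) i - X (y t) i| <= L * (M * `|h| + c t / 2 ^+ k).
    move=> uh; apply: XL => [|j].
      apply: addr_ge0; first exact: mulr_ge0.
      by apply: divr_ge0 => //; exact: exprn_ge0.
    have -> : Y k u j - y t j = (Y k u j - Y k t j) + (Y k t j - y t j) by ring.
    rewrite (le_trans (ler_normD _ _))//; apply: lerD; last exact: (Hy t k j).
    by rewrite (le_trans (Yl k _ _ _))// ler_wpM2l.
  have [h0|h0] := leP 0 h.
    have hE : t + h - t = `|h| by rewrite ger0_norm//; ring.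
    rewrite -{2}hE; apply: (real_mvt _ (fun u _ => pd u)); first by rewrite lerDl.
    move=> u /andP[u1 u2]; apply: pb; rewrite !ger0_norm ?subr_ge0//.
    by rewrite lerBlDl.
  have hE : t - (t + h) = `|h| by rewrite ltr0_norm//; ring.
  rewrite distrC -{2}hE; apply: (real_mvt _ (fun u _ => pd u)); first by rewrite gerDl ltW.
  move=> u /andP[u1 u2]; apply: pb; rewrite ler0_norm ?subr_le0// ltr0_norm// opprB.
  by rewrite lerBlDl -lerBlDr opprK.
have E : y (t + h) i - y t i - h * X (y t) i =
   (phi (t + h) - phi t) - (Y k.+1 (t + h) i - y (t + h) i) + (Y k.+1 t i - y t i).
  by rewrite /phi; ring.
have e1 := Hy (t + h) k.+1 i; have e2 := Hy t k.+1 i.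
rewrite -/(c t) in e2; rewrite -/(c (t + h)) in e1.
have : `|y (t + h) i - y t i - h * X (y t) i| <= L * (M * `|h| + c t / 2 ^+ k) * `|h| +
    c (t + h) / 2 ^+ k + c t / 2 ^+ k.
  rewrite E (le_trans (ler_normD _ _))// lerD ?(le_trans e2)//.
  by rewrite (le_trans (ler_normB _ _))// lerD ?(le_trans e1).
rewrite lerBlDr => /le_trans; apply.
have -> : L * (M * `|h| + c t / 2 ^+ k) * `|h| + c (t + h) / 2 ^+ k + c t / 2 ^+ k =
    L * M * `|h| ^+ 2 + K / 2 ^+ k by rewrite /K; ring.
by rewrite real_normK ?num_real// addrC lerD2r.
Qed.

(** The contraction of [picard] acts on the difference of two solutions: starting from the crude
    bound 2 M on the difference of the fields, it halves the bound at each round. *)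
Lemma ode_unique (J : set R) (y z : R -> st) : is_interval J -> J 0 -> y 0 = z 0 ->
  (forall t i, J t -> is_derive t (1 : R) (fun u => y u i) (X (y t) i)) ->
  (forall t i, J t -> is_derive t (1 : R) (fun u => z u i) (X (z t) i)) ->
  forall t, J t -> y t = z t.
Proof.
move=> Jint J0 y0 yd zd.
have seg t u : J t -> Num.min 0 t <= u <= Num.max 0 t -> J u.
  move=> Jt; have [t0|t0] := leP 0 t; first exact: Jint.
  exact: Jint.
have L20 : 0 < 2 * L by rewrite mulr_gt0.
pose S := 2 * M / (2 * L).
have S0 : 0 <= S by rewrite divr_ge0 ?mulr_ge0// ltW.
have D0 i : y 0 i - z 0 i = 0 by rewrite y0 subrr.
have diff k t i : J t -> `|y t i - z t i| <= S / 2 ^+ k * expR (2 * L * `|t|).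
  elim: k t i => [|k IH] t i Jt.
    have := @mvt_exp R (fun u => y u i - z u i) (fun u => X (y u) i - X (z u) i) (2 * M) (2 * L) t L20.
    rewrite D0 subr0 expr0 divr1; apply => [|u /(seg _ _ Jt) Ju|u _]; first by rewrite mulr_ge0.
      by apply: is_deriveB; [exact: yd|exact: zd].
    rewrite (le_trans (ler_normB _ _))// (le_trans (lerD (XM _ _) (XM _ _)))//.
    have -> : M + M = 2 * M by ring.
    rewrite ler_peMr ?mulr_ge0// -[leLHS]expR0 ler_expR.
    by rewrite mulr_ge0// ltW.
  have := @mvt_exp R (fun u => y u i - z u i) (fun u => X (y u) i - X (z u) i)
    (L * (S / 2 ^+ k)) (2 * L) t L20.
  rewrite D0 subr0 => H; rewrite (le_trans (H _ _ _))//.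
  - by rewrite mulr_ge0 ?(ltW L0)// divr_ge0 ?exprn_ge0.
  - move=> u /(seg _ _ Jt) Ju; apply: is_deriveB; [exact: yd|exact: zd].
  - move=> u /(seg _ _ Jt) Ju; rewrite -mulrA; apply: XL; last by move=> j; exact: IH.
    by rewrite mulr_ge0 ?expR_ge0// divr_ge0 ?exprn_ge0.
  rewrite ler_wpM2r ?expR_ge0// exprS le_eqVlt; apply/orP; left; apply/eqP; field.
  by rewrite expf_neq0//= gt_eqF.
move=> t Jt; apply/funext => i; apply/eqP; rewrite -subr_eq0 -normr_eq0 eq_le normr_ge0 andbT.
apply: le0_eps => e e0; pose K := S * expR (2 * L * `|t|).
have K0 : 0 <= K by rewrite mulr_ge0 ?expR_ge0.
have [k hk] := pow2_small K0 e0.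
by rewrite (le_trans (diff k t i Jt))// mulrAC.
Qed.

End Picard.

(** * Bounds on the gradient of the perturbation and on its Lipschitz constant *)

Section GradientBounds.
Variables (R : realType) (n : nat) (a : 'rV[R]_n.+1) (r sigma eps : R).
Local Notation C := R[i].
Local Notation phase := ('rV[R]_n.+1 * 'rV[R]_n.+1)%type.
Local Notation cphase := ('rV[R[i]^o]_n.+1 * 'rV[R[i]^o]_n.+1)%type.
Variables (f : phase -> R) (F : cphase -> R[i]^o).
Hypotheses (sigma0 : 0 < sigma) (eps0 : 0 < eps)
  (hF : holomorphic_extension sigma (ball a r) f F)
  (Fb : (cfun_norm sigma (ball a r) F <= eps%:E)%E).

Definition centries_le (w : cphase) (D : R) :=
  (forall i, nm (w.1 0 i) <= D) /\ (forall i, nm (w.2 0 i) <= D).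

Lemma centries_leZ w D (x : C) : centries_le w D -> centries_le (x *: w) (nm x * D).
Proof.
by move=> [w1 w2]; split=> i; rewrite mxE nmM ler_wpM2l ?nm_ge0.
Qed.

Lemma centries_leD w w' D D' : centries_le w D -> centries_le w' D' ->
  centries_le (w + w') (D + D').
Proof.
by move=> [w1 w2] [w1' w2']; split=> i; rewrite mxE (le_trans (nmD _ _))// lerD.
Qed.

Lemma centries_le_trans w D D' : D <= D' -> centries_le w D -> centries_le w D'.
Proof. by move=> DD [w1 w2]; split=> i; rewrite (le_trans _ DD). Qed.

Lemma near_cnbhd (x : phase) (q : cphase) (D : R) : ball a r x.2 -> D < sigma ->
  centries_le q D -> cnbhd sigma (ball a r) (q + cphase_of x).
Proof.
move=> Bx Ds [q1 q2]; apply: (in_cnbhd sigma0 Bx) => i; rewrite !mxE.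
  rewrite cImD /= addr0 (le_lt_trans _ Ds)// (le_trans (nm_Im _))//.
by rewrite addrK (le_lt_trans _ Ds).
Qed.

Lemma cderiv_line (p w : cphase) (x : C) : cnbhd sigma (ball a r) (x *: w + p) ->
  cderiv (fun y : C => F (y *: w + p)) x ('D_w F (x *: w + p)).
Proof.
move=> hx; have [Fd _ _] := hF.
have H := derivable_cderiv (diff_derivable (v := w) (Fd _ hx)).
have : cderiv (fun y : C => F ((y - x) *: w + (x *: w + p))) x ('D_w F (x *: w + p)).
  by apply: (@cderiv_shift R (fun y => F (y *: w + (x *: w + p)))); rewrite subrr.
by apply: cderiv_ext => y; rewrite addrA -scalerDl subrK.
Qed.

(** Cauchy's estimate on the complex line of direction w: over a disc of radius sigma / (4 D) the
    point moves by sigma / 4, and together with q it stays within sigma / 2 of a real point. *)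
Lemma gradient_bound (x : phase) (q w : cphase) (D : R) : ball a r x.2 ->
  centries_le q (sigma / 4) -> 0 < D -> centries_le w D ->
  nm ('D_w F (q + cphase_of x)) <= cauchyc * eps / (sigma / (4 * D)).
Proof.
move=> Bx hq D0 hw; set p := q + cphase_of x.
have rho0 : 0 < sigma / (4 * D) by rewrite divr_gt0// mulr_gt0.
have dom y : nm y < sigma / (4 * D) -> cnbhd sigma (ball a r) (y *: w + p).
  move=> hy; rewrite /p addrA; apply: (@near_cnbhd _ _ (sigma / 2)) => //.
    by rewrite ltr_pdivrMr// ltr_pMr// ltr1n.
  have -> : sigma / 2 = sigma / 4 + sigma / 4 by field.
  apply: centries_leD => //; apply: (centries_le_trans _ (centries_leZ y hw)).
  have -> : sigma / 4 = sigma / (4 * D) * D by field; rewrite gt_eqF.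
  by rewrite ler_pM2r// ltW.
apply: (@cauchy_estimate R (fun y => F (y *: w + p)) 0) => //.
- move=> y; rewrite subr0 => hy; eexists; apply: cderiv_line; exact: dom.
- by move=> y; rewrite subr0 => /dom; exact: nm_extension.
have := @cderiv_line p w 0; rewrite scale0r add0r; apply.
by rewrite -[p]add0r -(scale0r w); apply: dom; rewrite nm0.
Qed.

Lemma centries_le_dir (v : phase) (D : R) :
  (forall i, `|v.1 0 i| <= D) -> (forall i, `|v.2 0 i| <= D) -> centries_le (cdir v) D.
Proof. by move=> h1 h2; split=> i; rewrite mxE nmC. Qed.

Lemma cphase_of0 (x : phase) : 0 + cphase_of x = cphase_of x.
Proof. by rewrite add0r. Qed.

(* Two Cauchy estimates, on polydiscs of radius sigma / 4. *)
Definition gradlip : R := cauchyc * (2 * (cauchyc * eps / (sigma / 4))) / (sigma / 4).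

Lemma gradlip_gt0 : 0 < gradlip.
Proof. by rewrite !mulr_gt0 ?invr_gt0 ?cauchyc_gt0// divr_gt0. Qed.

(** Cauchy's estimate in the direction u is applied to the difference of F at x + z u and y + z u,
    which the mean value inequality along the segment bounds by a gradient. No second derivative
    appears. *)
Lemma gradient_lipschitz (x y : phase) (u : cphase) (D : R) : 0 < D ->
  (forall s : R, 0 <= s <= 1 -> ball a r (s *: (x - y) + y).2) ->
  (forall i, `|x.1 0 i - y.1 0 i| <= D) -> (forall i, `|x.2 0 i - y.2 0 i| <= D) ->
  centries_le u 1 ->
  nm ('D_u F (cphase_of x) - 'D_u F (cphase_of y)) <= gradlip * D.
Proof.
move=> D0 seg xy1 xy2 hu; have s40 : 0 < sigma / 4 by rewrite divr_gt0.
have By : ball a r y.2 by have := seg 0; rewrite lexx ler01 scale0r add0r; exact.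
have Bx : ball a r x.2.
  by have := seg 1; rewrite lexx ler01 scale1r subrK; exact.
have hv : centries_le (cdir (x - y)) D.
  by apply: centries_le_dir => i; rewrite !mxE.
have -> : gradlip * D = cauchyc * (2 * (cauchyc * eps / (sigma / (4 * D)))) / (sigma / 4).
  by rewrite /gradlip; field; rewrite !gt_eqF.
have zu (z : C) : nm z < sigma / 4 -> centries_le (z *: u) (sigma / 4).
  by move=> hz; apply: (centries_le_trans _ (centries_leZ z hu)); rewrite mulr1 ltW.
have s41 : sigma / 4 < sigma by rewrite ltr_pdivrMr// ltr_pMr// ltr1n.
have dom w z : ball a r w.2 -> nm z < sigma / 4 -> cnbhd sigma (ball a r) (z *: u + cphase_of w).
  by move=> Bw /zu; exact: near_cnbhd.
have d0 w : ball a r w.2 -> cderiv (fun z : C => F (z *: u + cphase_of w)) 0 ('D_u F (cphase_of w)).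
  move=> Bw; have := @cderiv_line (cphase_of w) u 0; rewrite scale0r add0r; apply.
  by rewrite -cphase_of0 -(scale0r u); apply: dom; rewrite ?nm0.
apply: (@cauchy_estimate R (fun z => F (z *: u + cphase_of x) - F (z *: u + cphase_of y)) 0) => //.
- move=> z; rewrite subr0 => hz.
  by eexists; apply: cderivB; apply: cderiv_line; exact: dom.
- move=> z; rewrite subr0 => hz.
  pose phi (s : R) : C := F (s%:C *: cdir (x - y) + (z *: u + cphase_of y)).
  have pt (s : R) : s%:C *: cdir (x - y) + (z *: u + cphase_of y) =
      z *: u + cphase_of (s *: (x - y) + y).
    by rewrite cphase_line addrCA.
  have -> : F (z *: u + cphase_of x) - F (z *: u + cphase_of y) = phi 1 - phi 0.
    by rewrite /phi !pt scale1r scale0r add0r subrK.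
  suff H : nm (phi 1 - phi 0) <= 2 * (cauchyc * eps / (sigma / (4 * D))) * (1 - 0).
    by rewrite subr0 mulr1 in H.
  apply: complex_mvt => // s hs.
  exists ('D_(cdir (x - y)) F (s%:C *: cdir (x - y) + (z *: u + cphase_of y))).
    have := @cderiv_rderiv R (fun t : C => F (t *: cdir (x - y) + (z *: u + cphase_of y))) 0 1 s.
    rewrite add0r mul1r => /(_ ('D_(cdir (x - y)) F (s%:C *: cdir (x - y) + (z *: u + cphase_of y)))).
    rewrite mulr1 => H.
    have : rderiv (fun t : R => F ((0 + 1 * t%:C) *: cdir (x - y) + (z *: u + cphase_of y))) s
        ('D_(cdir (x - y)) F (s%:C *: cdir (x - y) + (z *: u + cphase_of y))).
      by apply: H; apply: cderiv_line; rewrite pt; apply: dom => //; exact: seg.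
    by apply: (rderiv_near ltr01) => t _; rewrite add0r mul1r.
  by rewrite pt; apply: gradient_bound => //; [exact: seg|exact: zu].
by apply: cderivB; exact: d0.
Qed.

End GradientBounds.

(** * Maximal solutions *)

Section Maximality.
Variables (R : realType) (n : nat) (a : 'rV[R]_n.+1) (r sigma eps : R).
Local Notation C := R[i].
Local Notation phase := ('rV[R]_n.+1 * 'rV[R]_n.+1)%type.
Local Notation cphase := ('rV[R[i]^o]_n.+1 * 'rV[R[i]^o]_n.+1)%type.
Local Notation st := ('I_(n.+1 + n.+1) -> R).
Variables (f : phase -> R) (F : cphase -> R[i]^o) (omv c : 'rV[R]_n.+1) (r1 tau d1 : R).
Hypotheses (sigma0 : 0 < sigma) (eps0 : 0 < eps)
  (hF : holomorphic_extension sigma (ball a r) f F)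
  (Fb : (cfun_norm sigma (ball a r) F <= eps%:E)%E)
  (r10 : 0 < r1) (tau0 : 0 < tau) (d1r1 : d1 < r1)
  (cB : forall I : 'rV[R]_n.+1, (forall i, `|I 0 i - c 0 i| <= r1) -> ball a r I).

Local Notation H := (ham f omv).
Local Notation L := (gradlip sigma eps).
Let M : R := `|omv| + cauchyc * eps / (sigma / 4).

Let L0 : 0 < L. Proof. exact: gradlip_gt0. Qed.

Let M0 : 0 <= M.
Proof.
apply: addr_ge0 => //; apply: divr_ge0; last by rewrite divr_ge0// ltW.
by rewrite mulr_ge0// ltW// cauchyc_gt0.
Qed.

(* Clamping the actions makes the Hamiltonian field globally Lipschitz.  The
   solution of the clamped equation is confined up to time tau, so it solves the
   original equation there, and extends any solution by uniqueness. *)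
Definition clampc (i : 'I_n.+1) (t : R) : R :=
  Num.max (c 0 i - r1) (Num.min (c 0 i + r1) t).

Lemma clampc_id i t : `|t - c 0 i| <= r1 -> clampc i t = t.
Proof.
rewrite ler_distl => /andP[h1 h2].
by rewrite /clampc min_r// max_r.
Qed.

Lemma clampc_in i t : `|clampc i t - c 0 i| <= r1.
Proof.
rewrite ler_distl /clampc le_max lexx /= ge_max ge_min lexx /= andbT.
by rewrite lerD2l (le_trans _ (ltW r10))// oppr_le0 ltW.
Qed.

Lemma clampc_lip i t u : `|clampc i t - clampc i u| <= `|t - u|.
Proof.
wlog tu : t u / u <= t.
  move=> W; have [|/ltW] := leP u t; first exact: W.
  by move=> /W; rewrite distrC [`|u - t|]distrC.
have mono : clampc i u <= clampc i t.
  rewrite /clampc ge_max le_max lexx /= le_max; apply/orP; right.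
  by rewrite le_min !ge_min lexx /= tu orbT.
rewrite !ger0_norm ?subr_ge0// /clampc lerBlDr ge_max; apply/andP; split.
  by rewrite ler_wpDl ?subr_ge0// le_max lexx.
rewrite (@le_trans _ _ (t - u + Num.min (c 0 i + r1) u))//.
  by rewrite addr_minr le_min !ge_min lerDr subr_ge0 tu subrK lexx orbT.
by rewrite lerD2l le_max lexx orbT.
Qed.

Definition of_st (x : st) : phase :=
  (\row_i x (lshift n.+1 i), \row_i x (rshift n.+1 i)).

Definition of_stc (x : st) : phase :=
  (\row_i x (lshift n.+1 i), \row_i clampc i (x (rshift n.+1 i))).

Definition to_st (z : phase) : st := fun j =>
  match fintype.split j with inl i => z.1 0 i | inr i => z.2 0 i end.

Lemma to_stK z : of_st (to_st z) = z.
Proof.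
case: z => th I; congr pair; apply/rowP => i; rewrite mxE /to_st.
  by rewrite (unsplitK (inl i)).
by rewrite (unsplitK (inr i)).
Qed.

Lemma to_st_l z i : to_st z (lshift n.+1 i) = z.1 0 i.
Proof. by rewrite /to_st (unsplitK (inl i)). Qed.

Lemma to_st_r z i : to_st z (rshift n.+1 i) = z.2 0 i.
Proof. by rewrite /to_st (unsplitK (inr i)). Qed.

Lemma of_st1 x i : (of_st x).1 0 i = x (lshift n.+1 i).
Proof. by rewrite mxE. Qed.

Lemma of_st2 x i : (of_st x).2 0 i = x (rshift n.+1 i).
Proof. by rewrite mxE. Qed.

Lemma of_stc_id x : (forall i, `|(of_st x).2 0 i - c 0 i| <= r1) -> of_stc x = of_st x.
Proof.
move=> h; congr pair; apply/rowP => i; rewrite !mxE clampc_id//.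
by have := h i; rewrite mxE.
Qed.

Definition field (x : st) : st := fun j => match fintype.split j with
  | inl i => omv 0 i + complex.Re (dF2 F (cphase_of (of_stc x)) i)
  | inr i => - complex.Re (dF1 F (cphase_of (of_stc x)) i) end.

Lemma of_stc_ball x : ball a r (of_stc x).2.
Proof. by apply: cB => i; rewrite mxE clampc_in. Qed.

Lemma nm_delta1 (b : bool) : nm (b%:R : C) <= 1.
Proof. by case: b; rewrite ?nm1// nm0. Qed.

Lemma dir1_le i : centries_le ((delta_mx 0 i, 0) : cphase) 1.
Proof. by split=> j; rewrite mxE ?nm0// nm_delta1. Qed.

Lemma dir2_le i : centries_le ((0, delta_mx 0 i) : cphase) 1.
Proof. by split=> j; rewrite mxE ?nm0// nm_delta1. Qed.

Lemma field_lip x y D : 0 <= D -> (forall j, `|x j - y j| <= D) ->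
  forall i, `|field x i - field y i| <= L * D.
Proof.
move=> D0 xy i; have [D00|Dn0] := eqVneq D 0.
  have -> : x = y.
    apply/funext => j; apply/eqP; rewrite -subr_eq0 -normr_eq0 eq_le normr_ge0 andbT.
    by rewrite -D00.
  by rewrite subrr normr0 D00 mulr0.
have Dp : 0 < D by rewrite lt_neqAle eq_sym Dn0.
have seg (s : R) : 0 <= s <= 1 -> ball a r (s *: (of_stc x - of_stc y) + of_stc y).2.
  move=> /andP[s0 s1]; apply: cB => j; rewrite !mxE.
  have h1 := clampc_in j (x (rshift n.+1 j)); have h2 := clampc_in j (y (rshift n.+1 j)).
  set u := clampc j (x _) in h1 *; set v := clampc j (y _) in h2 *.
  have -> : s * (u - v) + v - c 0 j = s * (u - c 0 j) + (1 - s) * (v - c 0 j) by ring.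
  rewrite (le_trans (ler_normD _ _))// !normrM (ger0_norm s0) (ger0_norm (_ : 0 <= 1 - s)) ?subr_ge0//.
  have -> : r1 = s * r1 + (1 - s) * r1 by ring.
  by rewrite lerD// ler_wpM2l// subr_ge0.
have e1 j : `|(of_stc x).1 0 j - (of_stc y).1 0 j| <= D by rewrite !mxE.
have e2 j : `|(of_stc x).2 0 j - (of_stc y).2 0 j| <= D.
  by rewrite !mxE (le_trans (clampc_lip _ _ _)).
rewrite /field; case: (fintype.split i) => j.
  rewrite opprD addrACA subrr add0r -cReB (le_trans (nm_Re _))//.
  exact: (gradient_lipschitz sigma0 hF Fb Dp seg e1 e2 (dir2_le j)).
rewrite -opprD normrN -cReB (le_trans (nm_Re _))//.
exact: (gradient_lipschitz sigma0 hF Fb Dp seg e1 e2 (dir1_le j)).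
Qed.

Lemma field_bound x i : `|field x i| <= M.
Proof.
have s4 : centries_le (0 : cphase) (sigma / 4).
  by split=> j; rewrite mxE nm0 divr_ge0// ltW.
have sE : sigma / (4 * 1) = sigma / 4 by rewrite mulr1.
rewrite /field; case: (fintype.split i) => j.
  rewrite (le_trans (ler_normD _ _))// lerD ?mx_entry_le// (le_trans (nm_Re _))//.
  have := gradient_bound sigma0 hF Fb (of_stc_ball x) s4 ltr01 (dir2_le j).
  by rewrite cphase_of0 sE.
rewrite normrN (le_trans (nm_Re _))//.
have := gradient_bound sigma0 hF Fb (of_stc_ball x) s4 ltr01 (dir1_le j).
rewrite cphase_of0 sE => /le_trans; apply.
by rewrite lerDr.
Qed.

Lemma entries_of_norm (I : 'rV[R]_n.+1) : `|I - c| <= r1 -> forall i, `|I 0 i - c 0 i| <= r1.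
Proof. by move=> h i; have := mx_entry_le (I - c) i; rewrite !mxE => /le_trans; apply. Qed.

Lemma ball_of_norm (I : 'rV[R]_n.+1) : `|I - c| <= r1 -> ball a r I.
Proof. by move=> /entries_of_norm; exact: cB. Qed.

Lemma ham_field_st (x : st) : `|(of_st x).2 - c| <= r1 ->
  ham_field H (of_st x) = of_st (field x).
Proof.
move=> hx; rewrite (ham_fieldE sigma0 hF omv (ball_of_norm hx)).
rewrite -(of_stc_id (entries_of_norm hx)); congr pair; apply/rowP => i; rewrite !mxE /field.
  by rewrite (unsplitK (inl i)).
by rewrite (unsplitK (inr i)).
Qed.

Lemma phase_norm_le (z : phase) (e : R) : 0 <= e -> (forall i, `|z.1 0 i| <= e) ->
  (forall i, `|z.2 0 i| <= e) -> `|z| <= e.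
Proof. by move=> e0 h1 h2; rewrite prod_normE ge_max !mx_norm_le. Qed.

Lemma is_derive_cont (z : R -> phase) (t : R) (dz : phase) : is_derive t (1 : R) z dz ->
  forall e : R, 0 < e -> exists2 d : R, 0 < d &
    forall t', `|t' - t| < d -> `|(z t').2 - (z t).2| < e.
Proof.
move=> /is_derive_epsP Hz e e0; have [d d0 Hd] := Hz 1 ltr01.
have k0 : 0 < `|dz| + 2 by rewrite ltr_wpDl.
exists (Num.min d (e / (`|dz| + 2))); first by rewrite lt_min d0 divr_gt0.
move=> t'; rewrite lt_min ltr_pdivlMr// => /andP[h1 h2].
have := Hd _ h1; rewrite [(t' - t) *: 1]mulr1 subrK mul1r => h3.
have -> : (z t').2 - (z t).2 = (z t' - z t).2 by [].
apply: (@le_lt_trans _ _ `|z t' - z t|); first by rewrite [leRHS]prod_normE le_max lexx orbT.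
have -> : z t' - z t = (z t' - z t - (t' - t) *: dz) + (t' - t) *: dz by rewrite subrK.
rewrite (le_lt_trans (ler_normD _ _))// normrZ (le_lt_trans (lerD h3 (lexx _)))//.
rewrite (le_lt_trans _ h2)// mulrDr addrC lerD2l ler_peMr// ler1n//.
Qed.

Lemma is_derive_local (z z' : R -> phase) (t d : R) (dz : phase) : 0 < d ->
  (forall u, `|u - t| < d -> z' u = z u) -> is_derive t (1 : R) z dz -> is_derive t (1 : R) z' dz.
Proof.
move=> d0 E /is_derive_epsP Hz; apply/is_derive_epsP => e /Hz[s s0 Hs].
exists (Num.min d s); first by rewrite lt_min d0.
move=> h; rewrite lt_min => /andP[h1 h2].
rewrite !E ?subrr ?normr0//; first exact: Hs.
by rewrite [h *: 1]mulr1 addrK.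
Qed.

Hypothesis Hconf : forall (J : set R) (z : R -> phase), is_interval J -> J 0 -> (z 0).2 = c ->
  (forall t, J t -> forall e : R, 0 < e -> exists2 d : R, 0 < d &
     forall t', J t' -> `|t' - t| < d -> `|(z t').2 - (z t).2| < e) ->
  (forall t, J t -> `|(z t).2 - c| < r1 -> is_derive t 1 z (ham_field H (z t))) ->
  forall t, J t -> `|t| <= tau -> `|(z t).2 - c| <= d1.

Lemma solution_confined (J : set R) (z : R -> phase) :
  ham_solution H (ball a r) J z -> (z 0).2 = c ->
  forall t, J t -> `|t| <= tau -> `|(z t).2 - c| <= d1.
Proof.
move=> [_ Jint J0 zd] z0; apply: Hconf => // [t Jt e e0|t Jt _]; last by have [] := zd t Jt.
have [_ zdt] := zd t Jt; have [d d0 Hd] := is_derive_cont zdt e0.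
by exists d => // t' _; exact: Hd.
Qed.

Lemma global_solution (z0 : phase) : z0.2 = c -> exists y : R -> st,
  [/\ of_st (y 0) = z0,
      forall t i, is_derive t (1 : R) (fun u => y u i) (field (y t) i),
      forall t, `|(of_st (y t)).2 - c| <= r1 ->
        is_derive t (1 : R) (fun u => of_st (y u)) (ham_field H (of_st (y t))) &
      forall t, `|t| <= tau -> `|(of_st (y t)).2 - c| <= d1].
Proof.
move=> z0c; have [y [y0 yP]] := picard L0 M0 field_lip field_bound (to_st z0).
have LM : 0 <= L * M by rewrite mulr_ge0// ltW.
have LM1 : 0 < L * M + 1 by rewrite ltr_wpDl.
have quad (e h : R) : `|h| < e / (L * M + 1) -> L * M * h ^+ 2 <= e * `|h|.
  rewrite ltr_pdivlMr// => he; rewrite -(real_normK (num_real h)) expr2 mulrA.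
  rewrite ler_wpM2r// mulrC (le_trans _ (ltW he))// ler_wpM2l// lerDl//.
have yd t i : is_derive t (1 : R) (fun u => y u i) (field (y t) i).
  apply: real_derive_of_eps => e e0; exists (e / (L * M + 1)); first by rewrite divr_gt0.
  by move=> h /quad; apply: le_trans; rewrite mulrC yP.
have zd t : `|(of_st (y t)).2 - c| <= r1 ->
    is_derive t (1 : R) (fun u => of_st (y u)) (ham_field H (of_st (y t))).
  move=> ht; rewrite ham_field_st//; apply/is_derive_epsP => e e0.
  exists (e / (L * M + 1)); first by rewrite divr_gt0.
  move=> h /quad hq; rewrite [h *: 1]mulr1 [h + t]addrC; apply: le_trans hq.
  apply: phase_norm_le => [|i|i]; first by rewrite mulr_ge0// sqr_ge0.
    by rewrite !mxE; exact: yP.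
  by rewrite !mxE; exact: yP.
have yz : of_st (y 0) = z0 by rewrite y0 to_stK.
exists y; split => // t; apply: (@Hconf setT (fun u => of_st (y u))) => //.
- by rewrite yz.
- move=> u _ e e0; have k0 : 0 < M + 1 by rewrite ltr_wpDl.
  exists (e / (M + 1)); first by rewrite divr_gt0.
  move=> u' _; rewrite ltr_pdivlMr// => hu; apply: mx_norm_lt => // i; rewrite !mxE.
  have yl : `|y u' (rshift n.+1 i) - y u (rshift n.+1 i)| <= M * `|u' - u|.
    have key s s' : s <= s' -> `|y s' (rshift n.+1 i) - y s (rshift n.+1 i)| <= M * (s' - s).
      move=> ss; exact: (real_mvt ss (fun x _ => yd x _) (fun x _ => field_bound _ _)).
    have [h|h] := leP u u'; first by rewrite (ger0_norm (_ : 0 <= u' - u)) ?subr_ge0// key.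
    by rewrite distrC (ltr0_norm (_ : u' - u < 0)) ?subr_lt0// opprB key// ltW.
  rewrite (le_lt_trans yl)// mulrC (le_lt_trans _ hu)// ler_wpM2l// lerDl//.
by move=> u _ hu; apply: zd; exact: ltW.
Qed.

Lemma solution_maximal (J : set R) (z : R -> phase) :
  maximal_ham_solution H (ball a r) J z -> (z 0).2 = c -> forall t, `|t| < tau -> J t.
Proof.
move=> [sol maxi] z0c; have [Jo Jint J0 zd] := sol.
have conf := solution_confined sol z0c.
have [y [y0 yd yh yc]] := global_solution z0c.
pose J2 := [set t | J t /\ `|t| < tau].
have absint (s t u : R) : `|s| < tau -> `|t| < tau -> s <= u <= t -> `|u| < tau.
  rewrite !ltr_norml => /andP[h1 h2] /andP[h3 h4] /andP[h5 h6].
  by rewrite (lt_le_trans h1)// (le_lt_trans h6).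
have agree t : J2 t -> to_st (z t) = y t.
  apply: (ode_unique L0 M0 field_lip field_bound (J := J2) (y := fun t => to_st (z t)) (z := y)) => //.
  - move=> s u [Js s1] [Ju u1] v sv; split; first exact: (Jint s u).
    exact: (absint s u).
  - by split=> //; rewrite normr0.
  - by rewrite -(to_stK (z 0)) in y0; apply/funext => j; move: (congr1 (fun p : phase => to_st p j) y0);
      rewrite to_stK /to_st; case: (fintype.splitP j) => i ij /= <-; rewrite mxE; congr (y 0 _); exact: val_inj.
  - move=> t' l [Jt' t'tau]; have [Bz] := zd t' Jt'.
    have hc : `|(of_st (to_st (z t'))).2 - c| <= r1.
      by rewrite to_stK (le_trans (conf t' Jt' (ltW t'tau)))// ltW.
    have -> : ham_field H (z t') = of_st (field (to_st (z t'))).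
      by rewrite -ham_field_st// to_stK.
    move=> /is_derive_entries[e1 e2]; rewrite -[l]splitK; case: (fintype.split l) => k.
      have -> : (fun u => to_st (z u) (unsplit (inl k))) = (fun u => (z u).1 0 k).
        by apply/funext => u; exact: to_st_l.
      by rewrite -[X in is_derive _ _ _ X]/(field (to_st (z t')) (lshift n.+1 k)) -of_st1.
    have -> : (fun u => to_st (z u) (unsplit (inr k))) = (fun u => (z u).2 0 k).
      by apply/funext => u; exact: to_st_r.
    by rewrite -[X in is_derive _ _ _ X]/(field (to_st (z t')) (rshift n.+1 k)) -of_st2.
have agree' t : J t -> `|t| < tau -> z t = of_st (y t).
  by move=> Jt ht; rewrite -agree// to_stK.
(* The given solution is glued to the global one on ]- tau, tau[. They agree on the overlap, so the
   union of the two intervals carries a solution and maximality makes it equal to J. *)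
pose J' := [set t | J t \/ `|t| < tau].
pose z' (t : R) := if pselect (J t) is left _ then z t else of_st (y t).
have z'J t : J t -> z' t = z t by rewrite /z'; case: pselect.
have z'y t : `|t| < tau -> z' t = of_st (y t).
  by move=> ht; rewrite /z'; case: pselect => // Jt; exact: agree'.
have J'J : J' = J.
  apply: (maxi J' z') => [|t|t Jt]; [|by left|exact: z'J].
  split.
  - rewrite openE => t [Jt|ht].
      have := Jo; rewrite openE => /(_ t Jt); apply: filterS => u; by left.
    apply/nbhs_ballP; exists (tau - `|t|) => /=; first by rewrite subr_gt0.
    move=> u; rewrite -ball_normE /= => hu; right.
    rewrite -[u](subrK t) addrC (le_lt_trans (ler_normD _ _))// -ltrBrDl.
    by rewrite distrC.
  - have side (s u v : R) : J s -> `|u| < tau -> (s <= v <= u) || (u <= v <= s) -> J' v.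
      move=> Js hu hv; have [v0|v0] := leP 0 v.
        case/orP: hv => /andP[h1 h2].
          by right; rewrite ger0_norm// (le_lt_trans h2)// (le_lt_trans (ler_norm _)).
        by left; apply: (Jint 0 s) => //; rewrite v0.
      case/orP: hv => /andP[h1 h2].
        by left; apply: (Jint s 0) => //; rewrite h1 ltW.
      right; rewrite ltr0_norm//; move: hu; rewrite ltr_norml => /andP[hu _].
      by rewrite ltrNl (lt_le_trans hu).
    move=> s u [Js|hs] [Ju|hu] v sv.
    + by left; exact: (Jint s u).
    + by apply: (side s u) => //; rewrite sv.
    + by apply: (side u s) => //; rewrite sv orbT.
    by right; exact: (absint s u).
  - by left.
  move=> t [Jt|ht].
    rewrite z'J//; have [Bz zdt] := zd t Jt; split => //.
    have := Jo; rewrite openE => /(_ t Jt)/nbhs_ballP[d /= d0 Hd].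
    apply: (is_derive_local d0 _ zdt) => u hu; apply: z'J; apply: Hd.
    by rewrite -ball_normE /= distrC.
  have hc : `|(of_st (y t)).2 - c| <= r1 by rewrite (le_trans (yc t (ltW ht)))// ltW.
  rewrite z'y//; split; first exact: ball_of_norm.
  have td : 0 < tau - `|t| by rewrite subr_gt0.
  apply: (is_derive_local td _ (yh t hc)) => u hu; apply: z'y.
  by rewrite -[u](subrK t) addrC (le_lt_trans (ler_normD _ _))// -ltrBrDl.
by move=> t ht; rewrite -J'J; right.
Qed.

End Maximality.

(** * Small divisors *)

Section DistZ.
Variable R : realType.
Implicit Types y : R.

Lemma distZ_le y (p : int) : distZ y <= `|y - p%:~R|.
Proof.
apply: ge_inf; last by exists p.
by exists 0 => _ [q _ <-].
Qed.

Lemma distZ_le1 y : distZ y <= 1.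
Proof.
apply: (le_trans (distZ_le y (Num.floor y))).
rewrite ger0_norm ?subr_ge0 ?floor_le//.
by have := floorD1_gt y; rewrite intrD => /ltW h; rewrite lerBlDl.
Qed.

Lemma distZ_gt0 y : (forall p : int, y != p%:~R) -> 0 < distZ y.
Proof.
move=> yZ; pose q := Num.floor y.
have h1 : q%:~R < y by rewrite lt_neqAle eq_sym yZ floor_le.
have h2 : y < (q + 1)%:~R by exact: floorD1_gt.
have e0 : 0 < Num.min (y - q%:~R) ((q + 1)%:~R - y) by rewrite lt_min !subr_gt0 h1.
apply: (lt_le_trans e0); apply: lb_le_inf; first by exists `|y - 0%:~R|, 0.
move=> _ [p _ <-]; rewrite ge_min; have [pq|qp] := leP p q.
  by apply/orP; left; rewrite (le_trans _ (ler_norm _))// lerD2l lerN2 ler_int.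
apply/orP; right; rewrite distrC (le_trans _ (ler_norm _))// lerD2r ler_int.
by rewrite lezD1.
Qed.

End DistZ.

Section Frequencies.
Variables (R : realType) (m : nat) (alpha : 'rV[R]_m) (Psi : R -> R).
Hypotheses (homega : nonresonant (freq alpha))
  (hPsi : extends_Psi alpha Psi).

Lemma idot_freq (k : 'rV[int]_m.+1) :
  idot k (freq alpha) = (k 0 0)%:~R + idot (\row_i k 0 (rshift 1 i)) alpha.
Proof.
rewrite /idot (@big_split_ord _ _ _ 1 m) big_ord1 /=; congr (_ + _).
  have -> : lshift m ord0 = 0 :> 'I_(1 + m) by exact: val_inj.
  have E : (0 : 'I_m.+1) = lshift m (0 : 'I_1) by exact: val_inj.
  by rewrite E /freq (row_mxEl (1%:M : 'rV[R]_1)) mxE eqxx mulr1.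
by apply: eq_bigr => i _; rewrite /freq (row_mxEr (1%:M : 'rV[R]_1)) mxE.
Qed.

Lemma idot_notin_int (k : 'rV[int]_m) (p : int) : k != 0 -> idot k alpha != p%:~R.
Proof.
move=> k0; pose K : 'rV[int]_m.+1 := row_mx (const_mx (- p) : 'rV[int]_1) k.
have KE : idot K (freq alpha) = (- p)%:~R + idot k alpha.
  rewrite idot_freq; congr (_%:~R + _).
    have -> : (0 : 'I_m.+1) = lshift m (0 : 'I_1) by exact: val_inj.
    by rewrite /K (row_mxEl (const_mx (- p) : 'rV[int]_1)) mxE.
  by congr idot; apply/rowP => i; rewrite mxE /K (row_mxEr (const_mx (- p) : 'rV[int]_1)).
have : K != 0.
  apply: contraNneq k0 => K0; apply/eqP/rowP => i.
  by have := congr1 (fun A : 'rV[int]_m.+1 => A 0 (rshift 1 i)) K0; rewrite /K (row_mxEr (const_mx (- p) : 'rV[int]_1)) !mxE.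
by move=> /homega; rewrite KE mulrNz addrC subr_eq0.
Qed.

Lemma distZ_idot_gt0 (k : 'rV[int]_m) : k != 0 -> 0 < distZ (idot k alpha).
Proof. by move=> k0; apply: distZ_gt0 => p; exact: idot_notin_int. Qed.

Lemma inorm_gt0 (k : 'rV[int]_m) : (0 < inorm k)%N = (k != 0).
Proof.
rewrite lt0n; congr negb; apply/eqP/eqP => [h|->].
  apply/rowP => i; rewrite mxE; apply/eqP; rewrite -absz_eq0 -leqn0.
  suff: (absz (k ord0 i) <= inorm k)%N by rewrite h.
  exact: (@leq_bigmax_cond _ xpredT (fun i => absz (k ord0 i)) i).
by apply: big1 => i _; rewrite mxE.
Qed.

Lemma Psi_ge1_nat (N : nat) : (0 < N)%N -> 1 <= Psi N%:R.
Proof.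
move=> N0; have [/(_ N N0)[[k /= /andP[k0 _] <-] _] _ _] := hPsi.
rewrite inorm_gt0 in k0; rewrite invr_ge1 ?distZ_le1 ?inE ?distZ_idot_gt0//.
by rewrite unitfE gt_eqF// distZ_idot_gt0.
Qed.

Lemma Psi_le x y : 1 <= x -> x <= y -> Psi x <= Psi y.
Proof.
move=> x1 xy; have [_ _] := hPsi; apply => //; rewrite in_itv /= andbT//.
exact: le_trans xy.
Qed.

Lemma Psi_ge1 x : 1 <= x -> 1 <= Psi x.
Proof. by move=> x1; rewrite (le_trans (Psi_ge1_nat (ltn0Sn 0)))// Psi_le. Qed.

(** The integer part of k . omega cannot bring it closer to 0 than the distance of k' . alpha to the
    integers. When k' = 0 the divisor is a non-zero integer, and Psi >= 1 suffices. *)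
Lemma small_divisors_Psi (N : nat) : (0 < N)%N -> small_divisors (freq alpha) N (Psi N%:R).
Proof.
move=> N0 k kN k0; have [/(_ N N0)[_ ub] _ _] := hPsi.
rewrite idot_freq; set k' := \row_i _.
have [k'0|k'0] := eqVneq k' 0.
  have -> : idot k' alpha = 0 by rewrite k'0 /idot big1// => i _; rewrite mxE mul0r.
  rewrite addr0 (le_trans _ (Psi_ge1_nat N0))//.
  have z0 : k 0 0 != 0.
    apply: contraNneq k0 => z0; apply/eqP/rowP => j; rewrite mxE.
    case: (unliftP ord0 j) => [l ->|->//].
    have -> : lift ord0 l = rshift 1 l by exact: val_inj.
    by have := congr1 (fun A : 'rV[int]_m => A 0 l) k'0; rewrite !mxE.
  rewrite invf_le1 ?normr_gt0 ?intr_eq0// -intr_norm ler1z.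
  by rewrite -gtz0_ge1 normr_gt0.
have d0 := distZ_idot_gt0 k'0.
have d1 : distZ (idot k' alpha) <= `|(k 0 0)%:~R + idot k' alpha|.
  by have := distZ_le (idot k' alpha) (- k 0 0); rewrite mulrNz opprK addrC.
apply: (@le_trans _ _ (distZ (idot k' alpha))^-1).
  by rewrite lef_pV2// posrE// (lt_le_trans d0).
apply: ub; exists k' => //=; rewrite inorm_gt0 k'0 /=.
by apply/bigmax_leqP => i _; rewrite mxE.
Qed.

Lemma Lambda_ge x : 1 <= x -> x <= Lambda Psi x.
Proof. by move=> x1; rewrite ler_peMr ?Psi_ge1// (le_trans ler01). Qed.

Lemma Lambda_lt x y : 1 <= x -> x < y -> Lambda Psi x < Lambda Psi y.
Proof.
move=> x1 xy; have y0 : 0 < y by rewrite (lt_trans _ xy)// (lt_le_trans ltr01).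
rewrite /Lambda (@lt_le_trans _ _ (y * Psi x))//.
  by rewrite ltr_pM2r// (lt_le_trans ltr01)// Psi_ge1.
by rewrite ler_pM2l// Psi_le// ltW.
Qed.

Lemma Lambda_inj : {in `[1, +oo[%classic &, injective (Lambda Psi)}.
Proof.
move=> x y; rewrite !in_setE /= !in_itv /= !andbT => x1 y1 E.
have [/(Lambda_lt x1)|/(Lambda_lt y1)|//] := ltgtP x y; by rewrite E ltxx.
Qed.

Lemma Lambda_continuous : {within `[1, +oo[, continuous (Lambda Psi)}.
Proof.
have [_ Pc _] := hPsi; move=> x.
apply: (@cvgM _ (subspace `[1, +oo[) (nbhs x) _ idfun Psi); last exact: Pc.
exact: (@continuous_subspaceT _ _ _ idfun (fun _ => cvg_id)).
Qed.

(** Since Psi >= 1, Lambda(x) >= x: the value x is reached on [K0, x] by the intermediate value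
    theorem, and injectivity identifies the point as Delta(x). *)
Lemma Delta_ge (K0 x : R) : 1 <= K0 -> Lambda Psi K0 <= x ->
  K0 <= Delta Psi x /\ Lambda Psi (Delta Psi x) = x.
Proof.
move=> K1 xK; have K0x : K0 <= x by rewrite (le_trans _ xK)// Lambda_ge.
have [K KI KE] : exists2 K, K \in `[K0, x] & Lambda Psi K = x.
  apply: IVT => //.
    apply: continuous_subspaceW Lambda_continuous => y /=; rewrite !in_itv /= andbT.
    by move=> /andP[+ _]; exact: le_trans.
  by rewrite ge_min xK /= le_max Lambda_ge ?orbT// (le_trans K1).
have /andP[h1 h2] : K0 <= K <= x by move: KI; rewrite in_itv.
have -> : Delta Psi x = K.
  rewrite -KE /Delta; apply: (pinvKV (fun=> 1) Lambda_inj).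
  by rewrite in_setE /= in_itv /= andbT (le_trans K1).
by [].
Qed.

End Frequencies.

(** * Balance of the constants and the stability estimate *)

Lemma expR_ge_sqr (R : realType) (x : R) : 0 <= x -> x ^+ 2 / 4 <= expR x.
Proof.
move=> x0; have -> : expR x = expR (x / 2) ^+ 2.
  by rewrite expr2 -expRD; congr expR; field.
have h := expR_ge1Dx (x / 2).
have -> : x ^+ 2 / 4 = (x / 2) ^+ 2 by field.
by rewrite lerXn2r ?nnegrE ?expR_ge0 ?divr_ge0// (le_trans _ h)// lerDr.
Qed.

(** As N >= K - 1, the exponent - b N + b K / 2 is at most b - b K / 2, and exp(- b K / 2) <= 16 /
    (b K)^2. One factor 1 / K is kept, the other is absorbed by the lower bound on K. *)
Lemma long_time_drift (R : realType) (B b r delta eps K N : R) :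
  0 < B -> 0 < b -> 0 < eps -> 0 <= delta -> delta <= r / 2 -> 0 < K ->
  K <= N + 1 -> 32 * B * r * expR b / b ^+ 2 <= K ->
  B * eps * expR (- (b * N)) * (2 * (delta / eps * expR (b / 2 * K))) <= (2 * K)^-1.
Proof.
move=> B0 b0 e0 d0 dr K0 KN hK.
have -> : B * eps * expR (- (b * N)) * (2 * (delta / eps * expR (b / 2 * K))) =
    B * (2 * delta) * expR (- (b * N) + b / 2 * K).
  rewrite expRD; move: (expR (- (b * N))) (expR (b / 2 * K)) => u v.
  by field; rewrite gt_eqF.
have hb : b * K <= b * N + b by rewrite -[X in _ + X]mulr1 -mulrDr ler_pM2l.
have h1 : expR (- (b * N) + b / 2 * K) <= expR b / expR (b / 2 * K).
  by rewrite -expRN -expRD ler_expR; move: hb; nra.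
have h2 : (b * K) ^+ 2 / 16 <= expR (b / 2 * K).
  have -> : (b * K) ^+ 2 / 16 = (b / 2 * K) ^+ 2 / 4 by field.
  by apply: expR_ge_sqr; rewrite mulr_ge0// ?divr_ge0// ltW.
have bK : 0 < (b * K) ^+ 2 / 16 by rewrite divr_gt0// exprn_gt0// mulr_gt0.
have h3 : expR b / expR (b / 2 * K) <= expR b * (16 / (b * K) ^+ 2).
  rewrite ler_pM2l ?expR_gt0// -[16 / _]invrK lef_pV2 ?posrE ?expR_gt0//.
    by rewrite invf_div.
  by rewrite invr_gt0 divr_gt0// exprn_gt0// mulr_gt0.
have r0 : 0 <= r by move: d0 dr; lra.
apply: (@le_trans _ _ (B * r * (expR b * (16 / (b * K) ^+ 2)))).
  apply: ler_pM; rewrite ?expR_ge0// ?mulr_ge0 ?(ltW B0)//.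
    by rewrite ler_pM2l//; move: dr; lra.
  exact: (le_trans h1).
have -> : B * r * (expR b * (16 / (b * K) ^+ 2)) =
    (32 * B * r * expR b / b ^+ 2) / K * (2 * K)^-1.
  by move: (expR b) => u; field; rewrite !gt_eqF.
by rewrite ler_piMl ?invr_ge0 ?mulr_ge0 ?(ltW K0)// ler_pdivrMr// mul1r.
Qed.

(** Both contributions to the displacement are brought below 1 / (2 K), K = Delta(c / eps): this
    fixes c = 1 / (2 B), and the sum 1 / K <= delta allows c1 = 1. Half of the exponential rate b
    becomes c2, the other half pays for the powers of K. *)
Theorem theorem1p1 (R : realType) (m : nat) (hm : (1 <= m)%N)
    (r sigma : R) (hr : 1 < r) (hsigma : 0 < sigma)
    (alpha : 'rV[R]_m) (halpha : forall i, `|alpha 0 i| < 1)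
    (homega : nonresonant (freq alpha))
    (Psi : R -> R) (hPsi : extends_Psi alpha Psi) :
  exists eps0 c c1 c2 : R,
    [/\ 0 < eps0, 0 < c, 0 < c1, 0 < c2 &
     (* Delta (c / eps) is defined for 0 < eps <= eps0 *)
     Lambda Psi 1 <= c / eps0 /\
     forall (a : 'rV[R]_m.+1) (eps : R)
       (f : 'rV[R]_m.+1 * 'rV[R]_m.+1 -> R)
       (F : 'rV[R[i]^o]_m.+1 * 'rV[R[i]^o]_m.+1 -> R[i]^o),
     0 < eps <= eps0 ->
     periodic_on (ball a r) f ->
     holomorphic_extension sigma (ball a r) f F ->
     (cfun_norm sigma (ball a r) F <= eps%:E)%E ->
     forall delta : R,
     (Delta Psi (c / eps))^-1 <= c1 * delta < r / 2 ->
     let H (x : 'rV[R]_m.+1 * 'rV[R]_m.+1) :=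
       rdot (freq alpha) x.2 + f x in
     let T := delta / eps * expR (c2 * Delta Psi (c / eps)) in
     forall (J : set R) (z : R -> 'rV[R]_m.+1 * 'rV[R]_m.+1),
     ham_solution H (ball a r) J z ->
     ball a (r / 2) (z 0).2 ->
     (forall t : R, J t -> `|t| <= T -> `|(z t).2 - (z 0).2| <= c1 * delta) /\
     (maximal_ham_solution H (ball a r) J z ->
      forall t : R, `|t| <= T -> J t)].
Proof.
have [B [b [r1 [B0 b0 /andP[r10 r1h] conf]]]] := confinement hsigma homega.
pose c : R := (2 * B)^-1.
(* K >= K0, forced by eps <= c / Lambda(K0), gives 1 / K < r1 and the lower bound required by
   [long_time_drift]; the 2 ensures K0 > 1. *)
pose K0 : R := 2 + r1^-1 + 32 * B * r * expR b / b ^+ 2.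
have r0 : 0 < r by rewrite (lt_trans ltr01).
have c0 : 0 < c by rewrite invr_gt0 mulr_gt0.
have w0 : 0 < 32 * B * r * expR b / b ^+ 2.
  by rewrite divr_gt0 ?exprn_gt0// !mulr_gt0// expR_gt0.
have r1v : 0 < r1^-1 by rewrite invr_gt0.
have K02 : 2 <= K0 by rewrite /K0; move: w0 r1v; lra.
have K01 : 1 <= K0 by rewrite (le_trans _ K02)// ler1n.
have L0 : 0 < Lambda Psi K0 by rewrite (lt_le_trans _ (Lambda_ge homega hPsi K01))// (lt_le_trans ltr01).
have cL : c / (c / Lambda Psi K0) = Lambda Psi K0.
  by rewrite invf_div mulrCA divff ?mulr1// gt_eqF.
exists (c / Lambda Psi K0), c, 1, (b / 2); split; rewrite ?divr_gt0//.
split.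
  rewrite cL ltW// (Lambda_lt homega hPsi)// (lt_le_trans _ K02)// ltr1n//.
move=> a eps f F /andP[e0 ele] _ hF Fb delta; rewrite !mul1r => /andP[dl dr].
move=> H T J z sol z0B.
have [KK KE] : K0 <= Delta Psi (c / eps) /\ Lambda Psi (Delta Psi (c / eps)) = c / eps.
  apply: (Delta_ge homega hPsi K01).
  by rewrite -{1}cL ler_pM2l// lef_pV2 ?posrE ?divr_gt0.
rewrite /T; move: (Delta Psi (c / eps)) KK KE dl => K KK KE dl {T}.
have K2 : 2 <= K by rewrite (le_trans K02).
have Kp : 0 < K by rewrite (lt_le_trans _ K2).
have K1 : 1 <= K by rewrite (le_trans K01).
have d0 : 0 < delta by rewrite (lt_le_trans _ dl)// invr_gt0.
set T := delta / eps * _.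
have T0 : 0 < T by rewrite !mulr_gt0 ?invr_gt0// expR_gt0.
have /andP[NK KN] : (Num.truncn K)%:R <= K < (Num.truncn K).+1%:R by apply: truncn_itv; exact: ltW.
set N := Num.truncn K in NK KN *.
have N0 : (0 < N)%N by rewrite -ltnS -(ltr_nat R) (le_lt_trans K1).
have N1 : 1 <= N%:R :> R by rewrite ler1n.
have PN : Psi N%:R <= Psi K by apply: (Psi_le hPsi).
have P1 : 1 <= Psi N%:R := Psi_ge1_nat homega hPsi N0.
have BcE : B * c = 2^-1 by rewrite /c invfM mulrCA divff ?mulr1// gt_eqF.
have PKE : K * Psi K * eps = c by rewrite -[K * Psi K]/(Lambda Psi K) KE divfK// gt_eqF.
have small : B * (N%:R * Psi N%:R) * eps <= 1.
  apply: (@le_trans _ _ (B * c)); last by rewrite BcE invf_le1// ler1n.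
  by rewrite -PKE [leRHS]mulrA ler_pM2r// ler_pM2l// ler_pM// (le_trans ler01).
(* By monotonicity of Psi, Psi(N) eps <= Psi(K) eps = c / K, and B c = 1 / 2. *)
have near_id : B * (Psi N%:R * eps) <= (2 * K)^-1.
  rewrite invfM -BcE -PKE -[leRHS]mulrA ler_pM2l// mulrAC -mulrA.
  have -> : K * Psi K * (K^-1 * eps) = Psi K * eps by field; rewrite gt_eqF.
  by rewrite ler_pM2r.
have drift : B * eps * expR (- (b * N%:R)) * (2 * T) <= (2 * K)^-1.
  apply: (@long_time_drift _ B b r) => //; [exact: ltW|exact: ltW|by rewrite natr1 ltW|].
  by rewrite (le_trans _ KK)// /K0 lerDr addr_ge0// ltW.
have total : B * (Psi N%:R * eps) + B * eps * expR (- (b * N%:R)) * (2 * T) <= K^-1.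
  by rewrite (le_trans (lerD near_id drift))// invfM -mulrDl -[X in X + X]mul1r -splitr mul1r.
have Kr1 : K^-1 < r1.
  rewrite invf_plt ?posrE// (lt_le_trans _ KK)// /K0 addrAC ltrDr.
  by rewrite addr_gt0.
(* The initial action lies in the half ball, and r1 <= 1 / 2 < r / 2 because r > 1. *)
have cB (I : 'rV[R]_m.+1) : (forall i, `|I 0 i - (z 0).2 0 i| <= r1) -> ball a r I.
  move=> hI; move: z0B; rewrite -ball_normE /= => {}z0B.
  have hz : `|(z 0).2 - I| <= r1.
    by rewrite distrC; apply: mx_norm_le => [|i]; [exact: ltW|rewrite !mxE; exact: hI].
  rewrite -[a](subrK (z 0).2) -addrA (le_lt_trans (ler_normD _ _))//.
  by move: z0B hz r1h hr; lra.
have cB' (I : 'rV[R]_m.+1) : `|I - (z 0).2| < r1 -> ball a r I.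
  move=> h; apply: cB => i; have := mx_entry_le (I - (z 0).2) i; rewrite !mxE => /le_trans; apply.
  exact: ltW.
(* Confinement is used up to 2 T: [solution_maximal] only yields times strictly below its bound, and
   |t| <= T has to be covered. *)
have Hconf := conf a r eps f F e0 hF Fb (z 0).2 cB' N (Psi N%:R) N0 P1 small
  (small_divisors_Psi homega hPsi N0) (2 * T) K^-1 Kr1 total.
have TT : T < 2 * T by rewrite ltr_pMl// ltr1n.
split=> [t Jt tT|maxi t tT].
  apply: (le_trans _ dl).
  exact: (solution_confined Hconf sol erefl Jt (le_trans tT (ltW TT))).
apply: (solution_maximal hsigma e0 hF Fb r10 _ Kr1 cB Hconf maxi erefl); first by rewrite mulr_gt0.
exact: le_lt_trans TT.
Qed.
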